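(* Let $\varphi:S^2\rightarrow G(2,n+2)$ be a linearly full irreducible constantly curved holomorphic two-sphere of degree $\mathrm{d}=4$ with constant square norm of the second fundamental form $S$. Then $n=4$, and the corresponding holomorphic two-spheres are given, up to $U(6)$, by the family $$ \varphi=\begin{bmatrix} 1&0&|t-2|z^3&\sqrt{t}\,z&\sqrt{\frac{3-t}{4-t}}\,|t-2|z^2&\sqrt{\frac{t}{4-t}}\,z^2\\ 0&1&\sqrt{3-t}\,z^2&0&\sqrt{4-t}\,z&0 \end{bmatrix}\subset G(2,6),\qquad 0<t\leq 3, $$ and the member with parameter $t$ has $S=t^2-4t+6$. Here, when $t=3$, $\varphi=V_0^{(1)}\oplus V_0^{(3)}$ (up to $U(6)$) with $S=3$; when $t=2$, $\varphi=V_0^{(2)}\oplus V_0^{(2)}$ (up to $U(6)$) with $S=2$.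
   Context: Grassmannian and metric. $G(2,n+2)$ ($n\ge 2$) is the complex Grassmannian of $2$-dimensional subspaces of $\mathbb{C}^{n+2}$ (row vectors, standard Hermitian inner product). A $2\times(n+2)$ matrix of rank 2 in brackets denotes its row span; $U(n+2)$ acts by right multiplication, and ''up to $U(n+2)$'' means up to this action. $G(2,n+2)$ carries the standard Kähler metric $ds^2_{G(2,n+2)}$ induced via the Plücker embedding from the Fubini–Study metric of constant holomorphic sectional curvature $4$ on $\mathbb{C}P^{N}$, $N=\binom{n+2}{2}-1$. Constantly curved holomorphic two-spheres. $S^2=\mathbb{C}\cup\{\infty\}$ with coordinate $z$. A constantly curved holomorphic two-sphere of degree $\mathrm{d}$ is a holomorphic immersion $\varphi:S^2\to G(2,n+2)$ whose induced metric has constant Gauss curvature $K$; then $K=4/\mathrm{d}$, where $\mathrm{d}$ is the degree of the composition of $\varphi$ with the Plücker embedding, and the coordinate $z$ is always chosen so that $\varphi^*ds^2_{G(2,n+2)}=\frac{\mathrm{d}}{(1+z\bar z)^2}dz\,d\bar z$. $\varphi$ is linearly full if there is no proper linear subspace of $\mathbb{C}^{n+2}$ containing all the $2$-planes $\varphi(p)$, $p\in S^2$. Second fundamental form. $S=\sum_{i,j}|B(\epsilon_i,\epsilon_j)|^2$, where $B$ is the second fundamental form of the isometric immersion $\varphi$ and $\epsilon_1,\epsilon_2$ is a local real orthonormal tangent frame for the induced metric. Reducible/irreducible. Let $v_1,v_2$ be a local holomorphic frame of the rank-2 bundle $\varphi$. $\varphi$ is reducible if $v_1\wedge v_2\wedge\partial_z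 v_1\wedge\partial_z v_2\equiv 0$ on $S^2$ and irreducible otherwise. (Equivalently, for a local unitary frame $e_1,e_2$ of $\varphi$ and unitary $e_3,e_4$ whose span contains the projection of $\partial_z\varphi$ to $\varphi^\perp$, with $\partial_z e_i\equiv a_{i3}e_3+a_{i4}e_4 \bmod \varphi$, the globally defined form $|a_{13}a_{24}-a_{14}a_{23}|^2dz^2d\bar z^2$ is identically zero, resp. not identically zero.) Veronese maps. $V_0^{(n)}(z)=\left[1,\sqrt{\tbinom n1}\,z,\dots,\sqrt{\tbinom nn}\,z^n\right]\in\mathbb{C}P^n$. For maps $f$ into $\mathbb{C}P^{a}$ and $g$ into $\mathbb{C}P^{b}$, $f\oplus g$ denotes the map into $G(2,a+b+2)$ sending a point to the span of the line $f$ in $\mathbb{C}^{a+1}\oplus 0$ and the line $g$ in $0\oplus\mathbb{C}^{b+1}$. *)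

(* Defs.v *)
From HB Require Import structures.
From mathcomp Require Import all_boot all_order all_algebra.
From mathcomp Require Import spectral.
From mathcomp Require Import complex.
From mathcomp Require Import all_classical all_reals all_analysis.

Set Implicit Arguments.
Unset Strict Implicit.
Unset Printing Implicit Defensive.

Import Order.TTheory GRing.Theory Num.Theory.
Import numFieldNormedType.Exports.

Local Open Scope classical_set_scope.
Local Open Scope ring_scope.
Local Open Scope sesquilinear_scope.
Local Open Scope complex_scope.

Section Defs.
Variable R : realType.
Local Notation C := R[i].

(* The Riemann sphere C u {oo}: [None] is the point at infinity. *)
Definition sphere : Type := option C.

Definition chart0 (z : C) : sphere := Some z.
Definition chartoo (w : C) : sphere := if w == 0 then None else Some w^-1.

(* [gr m] is G(2,m). *)
Definition gr (m : nat) : Type := {W : {vspace 'rV[C]_m} | \dim W == 2%N}.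

Definition rowspan (m : nat) (V : 'M[C]_(2, m)) : {vspace 'rV[C]_m} :=
  <<[:: row 0%R V; row 1%R V]>>%VS.

(* Complex differentiability; the limit is over complex increments. *)
Definition cdiff (h : C -> C) (z : C) : Prop :=
  derivable (h : C^o -> C^o) z 1.

Definition cderiv (m : nat) (F : C -> 'M[C]_(2, m)) (z : C) : 'M[C]_(2, m) :=
  \matrix_(i, j) ('D_1 (fun w : C^o => F w i j : C^o) z : C).

(* Derivatives along the real line z + s u, s real; u : C is a real tangent
   vector of the plane. *)
Definition ddirR (h : C -> R) (u z : C) : R :=
  derive1 (fun s : R => h (z + s%:C * u)) 0.

Definition ddir (m : nat) (F : C -> 'M[C]_(2, m)) (u z : C) : 'M[C]_(2, m) :=
  \matrix_(i, j) (ddirR (fun w => complex.Re (F w i j)) u z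
                  +i* ddirR (fun w => complex.Im (F w i j)) u z).

Definition laplacian (h : C -> R) (z : C) : R :=
  ddirR (ddirR h 1) 1 z + ddirR (ddirR h 'i) 'i z.

Definition pair_idx (m : nat) : finType := {p : 'I_m * 'I_m | (p.1 < p.2)%N}.

Definition wedge (m : nat) (v w : 'rV[C]_m) : {ffun pair_idx m -> C} :=
  [ffun p => v 0 (val p).1 * w 0 (val p).2 - v 0 (val p).2 * w 0 (val p).1].

Definition plucker (m : nat) (V : 'M[C]_(2, m)) : {ffun pair_idx m -> C} :=
  wedge (row 0 V) (row 1 V).

Definition dplucker (m : nat) (V X : 'M[C]_(2, m)) : {ffun pair_idx m -> C} :=
  wedge (row 0 X) (row 1 V) + wedge (row 0 V) (row 1 X).

Definition hdot (I : finType) (p q : {ffun I -> C}) : C :=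
  \sum_i p i * (q i)^*.

(* Fubini-Study Hermitian form at the line through p, on tangent vectors given
   by variations x, y of p.  On a projective line it is
   dw dw^* / (1 + |w|^2)^2, whose curvature is 4. *)
Definition fubini_study (I : finType) (p x y : {ffun I -> C}) : C :=
  (hdot x y * hdot p p - hdot x p * hdot p y) / hdot p p ^+ 2.

(* The Riemannian metric of G(2,m) at the row span of V, on tangent vectors
   given by variations X, Y of the basis V. *)
Definition gmetric (m : nat) (V X Y : 'M[C]_(2, m)) : R :=
  complex.Re (fubini_study (plucker V) (dplucker V X) (dplucker V Y)).

Definition frame_near (m : nat) (f : C -> gr m) (z0 : C)
    (F : C -> 'M[C]_(2, m)) : Prop :=
  \forall z \near (z0 : C^o),
    val (f z) = rowspan (F z) /\ forall i j, cdiff (fun w => F w i j) z.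

Definition holomorphic_at (m : nat) (f : C -> gr m) (z0 : C) : Prop :=
  exists F, frame_near f z0 F.

(* The tangent space of G(2,m) at W is Hom(W, C^m / W): a variation X of the
   basis represents 0 iff its rows lie in W. *)
Definition immersive_at (m : nat) (f : C -> gr m) (z0 : C) : Prop :=
  exists2 F, frame_near f z0 F &
    forall u : C, (forall i, row i (ddir F u z0) \in val (f z0)) -> u = 0.

(* The induced metric, on real tangent vectors u, v of the plane at z. *)
Definition induced (m : nat) (F : C -> 'M[C]_(2, m)) (z u v : C) : R :=
  gmetric (F z) (ddir F u z) (ddir F v z).

(* A holomorphic f is conformal, so that its induced metric is
   rho (dx^2 + dy^2) with rho = induced F z 1 1. *)
Definition gauss_curvature (m : nat) (F : C -> 'M[C]_(2, m)) (z : C) : R :=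
  - laplacian (fun w => ln (induced F w 1 1)) z / (2 * induced F z 1 1).

Definition gauss_curvature_at (m : nat) (K : R) (f : C -> gr m) (z0 : C)
    : Prop :=
  exists2 F, frame_near f z0 F & gauss_curvature F z0 = K.

(* v1 /\ v2 /\ w1 /\ w2 = 0, through the coordinates of the wedge in
   Lambda^4 C^m. *)
Definition wedge4_eq0 (m : nat) (V W : 'M[C]_(2, m)) : Prop :=
  forall s : 'I_(2 + 2) -> 'I_m, \det (colsub s (col_mx V W)) = 0.

Definition reducible_at (m : nat) (f : C -> gr m) (z0 : C) : Prop :=
  forall F, frame_near f z0 F -> wedge4_eq0 (F z0) (cderiv F z0).

(* Near the point with orthonormal basis V0, G(2,m) is parametrized by the
   affine space of the matrices V with V V0^* = 1 (graphs of linear maps from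
   the point to its orthogonal complement); the tangent vectors are then the X
   with X V0^* = 0, and every tangent vector extends to a constant vector field.
   For a map f, the frame F with values in this space is the expression of f in
   that parametrization. *)
Definition chart_frame (m : nat) (f : C -> gr m) (z0 : C)
    (F : C -> 'M[C]_(2, m)) : Prop :=
  frame_near f z0 F /\ \forall z \near (z0 : C^o), F z *m (F z0)^t* = 1%:M.

Definition chart_tangent (m : nat) (V0 X : 'M[C]_(2, m)) : Prop :=
  X *m V0^t* = 0.

(* Derivative of the metric coefficient g(Y,Z) in the direction X. *)
Definition dgmetric (m : nat) (V X Y Z : 'M[C]_(2, m)) : R :=
  derive1 (fun s : R => gmetric (V + s%:C *: X) Y Z) 0.

(* Christoffel symbol of the first kind: g(D_X Y, Z) for the Levi-Civita
   connection D and constant vector fields X, Y, Z. *)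
Definition christoffel (m : nat) (V X Y Z : 'M[C]_(2, m)) : R :=
  (dgmetric V X Y Z + dgmetric V Y X Z - dgmetric V Z X Y) / 2.

(* g(D_u f_*v, Z) for constant vector fields u, v of the plane. *)
Definition hessian (m : nat) (F : C -> 'M[C]_(2, m)) (z u v : C)
    (Z : 'M[C]_(2, m)) : R :=
  gmetric (F z) (ddir (ddir F v) u z) Z
  + christoffel (F z) (ddir F u z) (ddir F v z) Z.

Definition normal_vector (m : nat) (F : C -> 'M[C]_(2, m)) (z : C)
    (X : 'M[C]_(2, m)) : Prop :=
  chart_tangent (F z) X /\ forall w, gmetric (F z) X (ddir F w z) = 0.

(* b = B(u,v), the normal component of D_u f_*v. *)
Definition is_sff (m : nat) (F : C -> 'M[C]_(2, m)) (z u v : C)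
    (b : 'M[C]_(2, m)) : Prop :=
  normal_vector F z b /\
  forall X, normal_vector F z X -> gmetric (F z) b X = hessian F z u v X.

(* The squared norm S of the second fundamental form of f at z0 is s; it
   depends neither on the basis of f z0 nor on the orthonormal basis e. *)
Definition sff_sqnorm_at (m : nat) (s : R) (f : C -> gr m) (z0 : C) : Prop :=
  exists (F : C -> 'M[C]_(2, m)) (e : 'I_2 -> C)
         (B : 'I_2 -> 'I_2 -> 'M[C]_(2, m)),
    [/\ chart_frame f z0 F,
        forall i j, induced F z0 (e i) (e j) = (i == j)%:R,
        forall i j, is_sff F z0 (e i) (e j) (B i j)
      & s = \sum_i \sum_j gmetric (F z0) (B i j) (B i j)].

Definition everywhere (m : nat) (P : (C -> gr m) -> C -> Prop)
    (phi : sphere -> gr m) : Prop :=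
  forall z, P (phi \o chart0) z /\ P (phi \o chartoo) z.

Definition holomorphic (m : nat) : (sphere -> gr m) -> Prop :=
  everywhere (@holomorphic_at m).

Definition immersion (m : nat) : (sphere -> gr m) -> Prop :=
  everywhere (@immersive_at m).

Definition has_gauss_curvature (m : nat) (K : R) : (sphere -> gr m) -> Prop :=
  everywhere (gauss_curvature_at K).

Definition has_sff_sqnorm (m : nat) (s : R) : (sphere -> gr m) -> Prop :=
  everywhere (sff_sqnorm_at s).

Definition irreducible (m : nat) (phi : sphere -> gr m) : Prop :=
  ~ everywhere (@reducible_at m) phi.

Definition linearly_full (m : nat) (phi : sphere -> gr m) : Prop :=
  forall H : {vspace 'rV[C]_m},
    (forall p, (val (phi p) <= H)%VS) -> H = fullv.

(* The composition of phi with the Pluecker embedding is z |-> [P z], where the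
   polynomials P i have no common zero and d is the largest of their degrees. *)
Definition plucker_degree (m : nat) (d : nat) (phi : sphere -> gr m) : Prop :=
  exists P : pair_idx m -> {poly C},
    [/\ forall z, exists p, (P p).[z] != 0,
        (\max_p size (P p))%N = d.+1
      & forall z V, rowspan V = val (phi (chart0 z)) ->
          exists2 c : C, c != 0 & forall p, plucker V p = c * (P p).[z]].

(* phi^* ds^2 = d / (1 + |z|^2)^2 dz dz^*. *)
Definition normalized_metric (m : nat) (d : nat) (phi : sphere -> gr m)
    : Prop :=
  forall z, exists2 F, frame_near (phi \o chart0) z F &
    forall u v, induced F z u v =
      d%:R / (1 + complex.Re (z * z^*)) ^+ 2 * complex.Re (u * v^*).

Definition constantly_curved (m : nat) (d : nat) (phi : sphere -> gr m)
    : Prop :=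
  [/\ holomorphic phi, immersion phi, exists K, has_gauss_curvature K phi,
      plucker_degree d phi & normalized_metric d phi].

(* phi is the holomorphic map given on C by z |-> [M z]; its value at infinity
   is then determined by continuity. *)
Definition given_by (m : nat) (phi : sphere -> gr m)
    (M : C -> 'M[C]_(2, m)) : Prop :=
  holomorphic phi /\ forall z, val (phi (chart0 z)) = rowspan (M z).

(* Homogeneous coordinates of the Veronese map V_0^(n). *)
Definition veronese (n : nat) (z : C) : 'rV[C]_(n.+1) :=
  \row_j ((Num.sqrt ('C(n, j)%:R : R))%:C * z ^+ j).

Definition oplus (a b : nat) (f : C -> 'rV[C]_(a.+1)) (g : C -> 'rV[C]_(b.+1))
    (z : C) : 'M[C]_(2, a.+1 + b.+1) :=
  block_mx (f z) 0 0 (g z).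

Definition sphere_family (t : R) (z : C) : 'M[C]_(2, 6) :=
  \matrix_(i, j) nth 0 (nth [::]
    [:: [:: 1; 0; (`|t - 2|)%:C * z ^+ 3; (Num.sqrt t)%:C * z;
            (Num.sqrt ((3 - t) / (4 - t)) * `|t - 2|)%:C * z ^+ 2;
            (Num.sqrt (t / (4 - t)))%:C * z ^+ 2];
        [:: 0; 1; (Num.sqrt (3 - t))%:C * z ^+ 2; 0;
            (Num.sqrt (4 - t))%:C * z; 0]] i) j.

End Defs.

(* Main.v *)
(** The induced metric determines the Pluecker curve up to a unitary map (Calabi), so the
    Pluecker curve [P] may be normalized by [|P z|^2 = (1 + |z|^2)^4].  At a point with
    orthonormal basis [V0], and in a coordinate [z] centred there, the sphere is the row span
    of [V0 + z A_1 + ... + z^4 A_4] with the rows [a_k], [b_k] of [A_k] orthogonal to [V0].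
    Polarizing the norm of [P] gives equations for the scalar products of the [a_k] and [b_k],
    and [S = 6 - tau] with [tau = |a_1 /\ b_1|^2].  Hence [S] is constant exactly when the Gram
    determinant of the frame and its derivative is [tau (1 + |z|^2)^4] at every [z], and
    irreducibility means [tau <> 0].  Polarizing this identity gives further equations; after a
    rotation of the frame they force [a_4 = b_4 = b_3 = 0] and leave one real parameter [t], with
    [tau = t (4 - t)].  Conversely, the family satisfies these equations, and the point at
    infinity is covered because a unitary map exchanges the two charts of the family. *)

Require Import Defs.
From HB Require Import structures.
From mathcomp Require Import all_boot all_order all_algebra.
From mathcomp Require Import spectral.
From mathcomp Require Import complex ring lra.
From mathcomp Require Import all_classical all_reals all_analysis.

Set Implicit Arguments.
Unset Strict Implicit.
Unset Printing Implicit Defensive.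

Import Order.TTheory GRing.Theory Num.Theory.
Import numFieldNormedType.Exports.
Local Open Scope ring_scope.
Local Open Scope sesquilinear_scope.

(** * Hermitian and wedge products *)

Section HermitianProduct.
Variable R : realType.
Local Notation C := R[i].

(** In the chart centred at an orthonormal basis the metric has no first-order term, and the second
    fundamental form is a multiple of [A 2]. The relations [|A 1|^2 = 4] and [|A 2|^2 + tau = 6]
    carry the binomial coefficients of the norm of the Pluecker curve; this is the origin of
    [S = 6 - tau]. Recentring at [z] brings the power 8 of [1 + |z|^2] from the change of frame and
    the power -4 from the derivative, hence the exponent 4 of the Gram identity. The equations have
    three sources: orthogonality of the Pluecker coefficients, the absence of coefficients beyond
    [z^4] (which makes rows collinear and allows the rotations), and the low-order terms of the Gram
    determinant. They still leave two numerical solutions with [a_4 <> 0], one with [tau = 4] and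
    one with [tau = 3]; the value of the whole determinant at [z = w = 1] excludes these. Identities
    in [z] and its conjugate become polynomial identities in two independent variables, so that
    limits enter only through derivatives of frames and the point at infinity. *)

Definition dot m (u v : 'rV[C]_m) : C := \sum_j u 0 j * (v 0 j)^*.

Section Dot.
Context {m : nat}.
Implicit Types u v w : 'rV[C]_m.

Lemma dotDl u v w : dot (u + v) w = dot u w + dot v w.
Proof. by rewrite -big_split; apply: eq_bigr => j _; rewrite mxE mulrDl. Qed.

Lemma dotZl c u w : dot (c *: u) w = c * dot u w.
Proof. by rewrite mulr_sumr; apply: eq_bigr => j _; rewrite mxE mulrA. Qed.

Lemma dotC u v : dot v u = (dot u v)^*.
Proof.
by rewrite rmorph_sum; apply: eq_bigr => j _; rewrite rmorphM /= conjCK mulrC.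
Qed.

Lemma dotDr u v w : dot w (u + v) = dot w u + dot w v.
Proof. by rewrite dotC dotDl rmorphD /= -!dotC. Qed.

Lemma dotZr c u w : dot w (c *: u) = c^* * dot w u.
Proof. by rewrite dotC dotZl rmorphM /= -!dotC. Qed.

Lemma dotNl u w : dot (- u) w = - dot u w.
Proof. by rewrite -scaleN1r dotZl mulN1r. Qed.

Lemma dotNr u w : dot w (- u) = - dot w u.
Proof. by rewrite dotC dotNl rmorphN /= -dotC. Qed.

Lemma dot0l w : dot 0 w = 0.
Proof. by rewrite -(scale0r (0 : 'rV_m)) dotZl mul0r. Qed.

Lemma dot0r w : dot w 0 = 0.
Proof. by rewrite dotC dot0l conjC0. Qed.

Lemma dot_ge0 u : 0 <= dot u u.
Proof. by apply: sumr_ge0 => j _; rewrite mul_conjC_ge0. Qed.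

Lemma dot_conj u : (dot u u)^* = dot u u.
Proof. by rewrite -dotC. Qed.

Lemma dot_eq0 u : dot u u = 0 -> u = 0.
Proof.
move/eqP; rewrite psumr_eq0 => [/allP u0|j _]; last by rewrite mul_conjC_ge0.
apply/rowP => j; rewrite mxE; have := u0 j (mem_index_enum j).
by rewrite mul_conjC_eq0 => /eqP.
Qed.

Lemma dotC0 u v : dot u v = 0 -> dot v u = 0.
Proof. by move=> h; rewrite dotC h conjC0. Qed.

End Dot.

Lemma mulmx_ctE m k n (A : 'M[C]_(m, n)) (B : 'M[C]_(k, n)) i j :
  (A *m B^t*) i j = dot (row i A) (row j B).
Proof. by rewrite mxE; apply: eq_bigr => l _; rewrite !mxE. Qed.

Lemma ctM m k n (A : 'M[C]_(m, n)) (B : 'M[C]_(n, k)) :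
  (A *m B)^t* = B^t* *m A^t*.
Proof. by rewrite trmx_mul map_mxM. Qed.

Lemma ctK m n (A : 'M[C]_(m, n)) : A^t*^t* = A.
Proof. by apply/matrixP => i j; rewrite !mxE conjCK. Qed.

Lemma det_ct n (A : 'M[C]_n) : \det (A^t*) = (\det A)^*.
Proof. by rewrite det_map_mx det_tr. Qed.

Section HDot.
Context {I : finType}.
Implicit Types p q r : {ffun I -> C}.

Lemma hdotDl p q r : hdot (p + q) r = hdot p r + hdot q r.
Proof. by rewrite -big_split; apply: eq_bigr => j _; rewrite ffunE mulrDl. Qed.

Lemma ffunZE c p i : (c *: p) i = c * p i.
Proof. by rewrite ffunE. Qed.

Lemma hdotZl c p r : hdot (c *: p) r = c * hdot p r.
Proof. by rewrite mulr_sumr; apply: eq_bigr => j _; rewrite ffunE mulrA. Qed.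

Lemma hdotC p q : hdot q p = (hdot p q)^*.
Proof.
by rewrite rmorph_sum; apply: eq_bigr => j _; rewrite rmorphM /= conjCK mulrC.
Qed.

Lemma hdotDr p q r : hdot r (p + q) = hdot r p + hdot r q.
Proof. by rewrite hdotC hdotDl rmorphD /= -!hdotC. Qed.

Lemma hdotZr c p r : hdot r (c *: p) = c^* * hdot r p.
Proof. by rewrite hdotC hdotZl rmorphM /= -!hdotC. Qed.

Lemma hdot0l p : hdot 0 p = 0.
Proof. by rewrite -(scale0r (0 : {ffun I -> C})) hdotZl mul0r. Qed.

Lemma hdot0r p : hdot p 0 = 0.
Proof. by rewrite hdotC hdot0l conjC0. Qed.

Lemma hdotNl p r : hdot (- p) r = - hdot p r.
Proof. by rewrite -scaleN1r hdotZl mulN1r. Qed.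

Lemma hdotNr p r : hdot r (- p) = - hdot r p.
Proof. by rewrite hdotC hdotNl rmorphN /= -hdotC. Qed.

Lemma hdot_suml n (F : 'I_n -> {ffun I -> C}) p :
  hdot (\sum_i F i) p = \sum_i hdot (F i) p.
Proof.
by elim/big_rec2: _ => [|i x y _ <-]; rewrite ?hdot0l // hdotDl.
Qed.

Lemma hdot_eq0 p : hdot p p = 0 -> p = 0.
Proof.
move/eqP; rewrite psumr_eq0 => [/allP u0|j _]; last by rewrite mul_conjC_ge0.
apply/ffunP => j; rewrite !ffunE; have := u0 j (mem_index_enum j).
by rewrite mul_conjC_eq0 => /eqP.
Qed.

End HDot.

Section Wedge.
Context {m : nat}.
Implicit Types u v x y : 'rV[C]_m.

(** Pluecker coordinates are indexed by [i < j], while products of [dot] are sums over all pairs.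
    Doubling passes from one to the other; transposing the indices matches the two halves. *)
Lemma sum_pair_idx (F : 'I_m -> 'I_m -> C) :
    (forall i j, F i j = F j i) -> (forall i, F i i = 0) ->
  (\sum_(p : pair_idx m) F (val p).1 (val p).2) *+ 2 = \sum_i \sum_j F i j.
Proof.
move=> Fs F0; rewrite pair_big /=.
have -> : \sum_(p : pair_idx m) F (val p).1 (val p).2
          = \sum_(p : 'I_m * 'I_m | (p.1 < p.2)%N) F p.1 p.2.
  rewrite [RHS](reindex_omap (val : pair_idx m -> _) insub) => [|p p12]; last by rewrite insubT.
  by apply: eq_bigl => -[p p12] /=; rewrite p12 insubT /= eqxx.
rewrite [RHS](bigID (fun p : 'I_m * 'I_m => (p.1 < p.2)%N)) /= mulr2n.
congr (_ + _).
rewrite [RHS](bigID (fun p : 'I_m * 'I_m => (p.2 < p.1)%N)) /=.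
rewrite [X in _ = _ + X]big1 ?addr0 => [|[i j] /= /andP[]]; last first.
  by rewrite -!leqNgt => h1 h2; have -> : i = j; [apply/val_inj/eqP; rewrite eqn_leq h2 h1|].
rewrite (reindex (fun p : 'I_m * 'I_m => (p.2, p.1))) /=; last first.
  by exists (fun p => (p.2, p.1)) => [[]|[]].
rewrite (eq_bigr (fun p : 'I_m * 'I_m => F p.1 p.2)) => [|[i j] _ /=]; last by rewrite Fs.
by apply: eq_bigl => -[i j] /=; rewrite -leqNgt; apply/idP/andP => [h|[]//]; split=> //; apply: ltnW.
Qed.

(** Lagrange's identity. After doubling, each product of [dot] is written once as a double sum and
    once with its indices exchanged, so that the summands agree term by term. *)
Lemma hdot_wedge u v x y :
  hdot (wedge u v) (wedge x y) = dot u x * dot v y - dot u y * dot v x.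
Proof.
apply: (@mulIf _ 2%:R); first by rewrite pnatr_eq0.
rewrite !mulr_natr.
pose G i j := (u 0 i * v 0 j - u 0 j * v 0 i) * (x 0 i * y 0 j - x 0 j * y 0 i)^*.
have -> : hdot (wedge u v) (wedge x y) = \sum_(p : pair_idx m) G (val p).1 (val p).2.
  by apply: eq_bigr => p _; rewrite !ffunE.
rewrite sum_pair_idx => [||i]; first 2 last.
- by rewrite /G subrr mul0r.
- have S (a b c d : 'rV[C]_m) : dot a b * dot c d
      = \sum_i \sum_j (a 0 i * (b 0 i)^*) * (c 0 j * (d 0 j)^*).
    by rewrite mulr_suml; apply: eq_bigr => i _; rewrite mulr_sumr.
  have S' (a b c d : 'rV[C]_m) : dot a b * dot c d
      = \sum_i \sum_j (a 0 j * (b 0 j)^*) * (c 0 i * (d 0 i)^*).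
    by rewrite S exchange_big.
  rewrite mulr2n {1}(S u x) {1}(S u y v x) (S' u x) (S' u y) -!sumrB -big_split.
  apply: eq_bigr => i _; rewrite -!sumrB -big_split; apply: eq_bigr => j _.
  by rewrite /G rmorphB !rmorphM /=; ring.
by move=> i j; rewrite /G !rmorphB /=; ring.
Qed.

Lemma wedgeDl u v x : wedge (u + v) x = wedge u x + wedge v x.
Proof. by apply/ffunP => p; rewrite !ffunE !mxE; ring. Qed.
Lemma wedgeDr u v x : wedge x (u + v) = wedge x u + wedge x v.
Proof. by apply/ffunP => p; rewrite !ffunE !mxE; ring. Qed.
Lemma wedgeZl c u x : wedge (c *: u) x = c *: wedge u x.
Proof. by apply/ffunP => p; rewrite ffunZE !ffunE !mxE; ring. Qed.
Lemma wedgeZr c u x : wedge x (c *: u) = c *: wedge x u.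
Proof. by apply/ffunP => p; rewrite ffunZE !ffunE !mxE; ring. Qed.
Lemma wedge_self u : wedge u u = 0.
Proof. by apply/ffunP => p; rewrite !ffunE; ring. Qed.
Lemma wedgeC u v : wedge u v = - wedge v u.
Proof. by apply/ffunP => p; rewrite !ffunE; ring. Qed.
Lemma wedge0l u : wedge 0 u = 0.
Proof. by apply/ffunP => p; rewrite !ffunE !mxE !mul0r subrr. Qed.
Lemma wedge0r u : wedge u 0 = 0.
Proof. by rewrite wedgeC wedge0l oppr0. Qed.

(** The coefficient is that of the orthogonal projection of [v] on [u]; by Lagrange's identity the
    remainder has norm 0. *)
Lemma wedge_eq0_collinear u v : u != 0 -> wedge u v = 0 -> exists c, v = c *: u.
Proof.
move=> u0 w0; have nu : dot u u != 0 by apply: contra_neq u0 => /dot_eq0.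
exists (dot v u / dot u u); apply/eqP; rewrite -subr_eq0; apply/eqP/dot_eq0.
have := hdot_wedge u v u v; rewrite w0 hdot0l => h.
rewrite !(dotDl, dotDr, dotNl, dotNr, dotZl, dotZr) !rmorphM /= fmorphV /=.
rewrite dot_conj -(dotC v u).
apply: (@mulfI _ (dot u u)) => //; rewrite mulr0 [RHS]h.
by field.
Qed.

End Wedge.
End HermitianProduct.

(** * Planes as row spans, and their Pluecker vectors *)

Section Planes.
Variable R : realType.
Local Notation C := R[i].

Lemma det2E (S : comPzRingType) (A : 'M[S]_2) :
  \det A = A 0 0 * A 1 1 - A 0 1 * A 1 0.
Proof.
rewrite (expand_det_row _ 0) !big_ord_recl big_ord0 addr0 /cofactor !det_mx11.
rewrite !mxE /= expr0 expr1 mul1r mulN1r mulrN.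
by congr (_ * A _ _ - A _ _ * A _ _); apply/val_inj.
Qed.

Lemma row_mulmx2 (S : pzRingType) k m (g : 'M[S]_(k, 2)) (V : 'M[S]_(2, m)) i :
  row i (g *m V) = g i 0 *: row 0 V + g i 1 *: row 1 V.
Proof.
apply/rowP => j; rewrite !mxE !big_ord_recl big_ord0 addr0 /=.
by congr (g _ _ * V _ _ + g _ _ * V _ _); apply/val_inj.
Qed.

Lemma ord2P (i : 'I_2) : i = 0 \/ i = 1.
Proof. by case: i => [[|[|//]] lt_i2]; [left | right]; apply/val_inj. Qed.

(** The four terms of [(a u + b v) /\ (c u + d v)] once [u /\ u] and [v /\ v] are 0, in the form in
    which rewriting leaves them. *)
Lemma alternating_expand (K : comPzRingType) (E : lmodType K) (a b c d : K) (w : E) :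
  a *: (c *: 0) + a *: (d *: w) + (b *: (c *: - w) + b *: (d *: 0)) = (a * d - b * c) *: w.
Proof. by rewrite !scaler0 add0r addr0 !scalerN !scalerA -scalerBl. Qed.

Variable m : nat.
Implicit Types V W : 'M[C]_(2, m).

Lemma hdot_plucker V W : hdot (plucker V) (plucker W) = \det (V *m W^t*).
Proof. by rewrite hdot_wedge det2E !mulmx_ctE. Qed.

Lemma plucker_mul (g : 'M[C]_2) V : plucker (g *m V) = \det g *: plucker V.
Proof.
rewrite /plucker !row_mulmx2 !(wedgeDl, wedgeDr, wedgeZl, wedgeZr, wedge_self).
by rewrite (wedgeC (row 1 V)) det2E; apply: alternating_expand.
Qed.

Lemma mem_rowspan V (x : 'rV[C]_m) :
  reflect (exists c : 'rV[C]_2, x = c *m V) (x \in rowspan V).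
Proof.
have cE (c : 'rV[C]_2) : c *m V = c 0 0 *: row 0 V + c 0 1 *: row 1 V.
  by rewrite -[LHS](row_id 0) row_mulmx2.
apply: (iffP idP) => [|[c ->]].
  rewrite /rowspan span_cons span_seq1 => /memv_addP[u /vlineP[a ->] [v /vlineP[b ->] ->]].
  by exists (\row_j if j == 0 then a else b); rewrite cE !mxE.
rewrite cE memvD // memvZ // memv_span // !inE eqxx ?orbT //.
Qed.

Lemma row_rowspan V i : row i V \in rowspan V.
Proof. by apply/mem_rowspan; exists (row i 1%:M); rewrite -row_mul mul1mx. Qed.

Lemma sub_rowspan k (X : 'M[C]_(k, m)) V :
  (forall i, row i X \in rowspan V) <-> exists g : 'M[C]_(k, 2), X = g *m V.
Proof.
split=> [h|[g ->] i]; last by apply/mem_rowspan; exists (row i g); rewrite row_mul.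
have /choice[c cE] : forall i, exists c : 'rV[C]_2, row i X = c *m V by move=> i; apply/mem_rowspan.
exists (\matrix_(i, j) c i 0 j); apply/row_matrixP => i; rewrite cE row_mul.
by congr (_ *m _); apply/rowP => j; rewrite !mxE.
Qed.

Lemma rowspan_sub V W : (rowspan V <= rowspan W)%VS <-> exists g : 'M[C]_2, V = g *m W.
Proof.
rewrite -sub_rowspan; split=> [/subvP h i|h]; first exact/h/row_rowspan.
by apply/span_subvP => v; rewrite !inE => /orP[]/eqP->.
Qed.

Lemma rowspan_mul (g : 'M[C]_2) V : g \in unitmx -> rowspan (g *m V) = rowspan V.
Proof.
move=> gu; apply/eqP; rewrite eqEsubv; apply/andP; split; apply/rowspan_sub.
  by exists g.
by exists (invmx g); rewrite mulmxA mulVmx // mul1mx.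
Qed.

Lemma plucker_rowspan_dim V : (\dim (rowspan V) == 2%N) = (plucker V != 0).
Proof.
apply/idP/idP.
  apply: contraTN => /eqP p0; rewrite neq_ltn; apply/orP; left; rewrite ltnS.
  have [r0|r0] := eqVneq (row 0 V) 0.
    rewrite /rowspan r0 span_cons span_seq1.
    have /addv_idPr -> : (<[0%R]> <= <[row 1%R V]>)%VS by rewrite -memvE mem0v.
    by rewrite dim_vline; case: eqP.
  have [c cE] := wedge_eq0_collinear r0 p0.
  rewrite /rowspan cE span_cons span_seq1.
  have /addv_idPl -> : (<[c *: row 0%R V]> <= <[row 0%R V]>)%VS.
    by rewrite -memvE memvZ // memv_line.
  by rewrite dim_vline r0.
move=> p0; have fr : free [:: row 0 V; row 1 V].
  rewrite free_cons seq1_free span_seq1; apply/andP; split; last first.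
    by apply: contraNneq p0; rewrite /plucker => ->; rewrite wedge0r.
  apply/negP => /vlineP[k kE]; move/negP: p0; apply.
  by rewrite /plucker kE wedgeZl wedge_self scaler0.
by move: fr; rewrite /free.
Qed.

Lemma gr_basis (W : gr R m) :
  exists2 V : 'M[C]_(2, m), V *m V^t* = 1%:M & rowspan V = val W.
Proof.
have [U UW] : exists U : 'M[C]_(2, m), rowspan U = val W.
  have dW := eqP (valP W).
  have sz : size (vbasis (val W)) = 2%N by rewrite size_tuple.
  exists (\matrix_(i < 2) (vbasis (val W))`_i); rewrite /rowspan !rowK.
  rewrite -[RHS](span_basis (vbasisP _)).
  by case: (tval _) sz => [|x [|y []]].
have Ufree : row_free U.
  apply/inj_row_free => v v0; have := valP W; rewrite -UW plucker_rowspan_dim.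
  have [//|vn0] := eqVneq v 0; apply: contraNeq => _; apply/eqP.
  pose g : 'M[C]_2 := \matrix_(i < 2) v.
  have [r rn0] : exists r, v 0 r != 0.
    apply/existsP; apply: contraNT vn0 => /existsPn h; apply/eqP/rowP => j.
    by rewrite mxE; apply/eqP/negPn/h.
  have vE : v 0 0 *: row 0 U + v 0 1 *: row 1 U = 0.
    by rewrite -row_mulmx2 v0 row0.
  (* Multiplied by its coefficient in the relation, one row becomes proportional to the other, and
     the wedge vanishes. *)
  have wE i : v 0 i *: plucker U = 0.
    rewrite /plucker; case: (ord2P i) => ->.
      rewrite -wedgeZl; move/eqP: vE; rewrite addr_eq0 => /eqP ->.
      by rewrite -scaleNr wedgeZl wedge_self scaler0.
    rewrite -wedgeZr; move/eqP: vE; rewrite addrC addr_eq0 => /eqP ->.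
    by rewrite -scaleNr wedgeZr wedge_self scaler0.
  by have /eqP := wE r; rewrite scaler_eq0 (negPf rn0) => /eqP.
have le2m : (2 <= m)%N by rewrite -(eqP Ufree) rank_leq_col.
have eqU := eqmx_schmidt_free Ufree.
exists (schmidt U); first exact/unitarymxP/schmidt_unitarymx.
rewrite -UW; apply/eqP; rewrite eqEsubv.
by apply/andP; split; apply/rowspan_sub/submxP; rewrite eqU.
Qed.

End Planes.
(** * Polynomial identities *)

Section PolynomialFunctions.
Variable K : numFieldType.
Implicit Types (f g h : K -> K) (p q : {poly K}).

(** Stated for functions, so that closure under the ring operations proves polynomiality without
    exhibiting the polynomial. *)
Definition polyfun f := exists p, forall s, f s = p.[s].

Lemma polyfun_horner p : polyfun (horner p).
Proof. by exists p. Qed.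
Lemma polyfun_cst c : polyfun (fun=> c).
Proof. by exists c%:P => s; rewrite hornerC. Qed.
Lemma polyfun_id : polyfun id.
Proof. by exists 'X => s; rewrite hornerX. Qed.
Lemma polyfunD f g : polyfun f -> polyfun g -> polyfun (fun s => f s + g s).
Proof. by move=> [p pE] [q qE]; exists (p + q) => s; rewrite hornerD pE qE. Qed.
Lemma polyfunN f : polyfun f -> polyfun (fun s => - f s).
Proof. by move=> [p pE]; exists (- p) => s; rewrite hornerN pE. Qed.
Lemma polyfunM f g : polyfun f -> polyfun g -> polyfun (fun s => f s * g s).
Proof. by move=> [p pE] [q qE]; exists (p * q) => s; rewrite hornerM pE qE. Qed.
Lemma polyfunX f n : polyfun f -> polyfun (fun s => f s ^+ n).
Proof. by move=> [p pE]; exists (p ^+ n) => s; rewrite horner_exp pE. Qed.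
Lemma polyfun_sum (I : finType) (F : I -> K -> K) :
  (forall i, polyfun (F i)) -> polyfun (fun s => \sum_i F i s).
Proof.
move=> /choice[p pE]; exists (\sum_i p i) => s.
by rewrite horner_sum; apply: eq_bigr.
Qed.

(** The natural numbers serve as test points because conjugation fixes them, which [polarization]
    needs. *)
Lemma poly_eq_nat p q : (forall n : nat, p.[n%:R] = q.[n%:R]) -> p = q.
Proof.
move=> h; apply/eqP; rewrite -subr_eq0; apply: contraT => r0.
pose s : seq K := [seq i%:R | i <- iota 0 (size (p - q))].
have us : uniq s by rewrite map_inj_uniq ?iota_uniq //; apply: mulrIn (oner_neq0 _).
have rs : all (root (p - q)) s.
  by apply/allP => _ /mapP[i _ ->]; rewrite rootE hornerD hornerN h subrr.
by have := max_poly_roots r0 rs us; rewrite size_map size_iota ltnn.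
Qed.

Lemma poly_eq_fun p q : (forall s, p.[s] = q.[s]) -> p = q.
Proof. by move=> h; apply: poly_eq_nat. Qed.

(** The difference times [h] vanishes everywhere, and [h] is not the zero polynomial. This extends
    identities across the pole of a rotation of the sphere or across 0. *)
Lemma polyfun_eq_cofinite f g h s0 :
    polyfun f -> polyfun g -> polyfun h -> h s0 != 0 ->
  (forall s, h s != 0 -> f s = g s) -> f =1 g.
Proof.
move=> [p pE] [q qE] [r rE] r0 fg s.
have /eqP : (p - q) * r = 0.
  apply: poly_eq_fun => z; rewrite hornerM !hornerE.
  have [->|rz] := eqVneq r.[z] 0; first by rewrite mulr0.
  by rewrite -pE -qE fg ?rE // subrr mul0r.
rewrite mulf_eq0 => /orP[|/eqP r00]; first by rewrite subr_eq0 pE qE => /eqP ->.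
by move: r0; rewrite rE r00 horner0 eqxx.
Qed.

Lemma poly_sum_coef n (c d : nat -> K) :
    (forall s, \sum_(k < n) c k * s ^+ k = \sum_(k < n) d k * s ^+ k) ->
  forall k, (k < n)%N -> c k = d k.
Proof.
move=> h k kn; have E : \poly_(i < n) c i = \poly_(i < n) d i.
  by apply: poly_eq_fun => s; rewrite !horner_poly.
by have := congr1 (fun p => p`_k) E; rewrite !coef_poly kn.
Qed.

(** Reads off a first-order jet: everything of order at least 2 is hidden in an unspecified
    polynomial [h]. *)
Lemma poly_mod2_coef (c0 c1 d0 d1 : K) h :
    polyfun h -> (forall s, c0 + c1 * s + s ^+ 2 * h s = d0 + d1 * s) ->
  c0 = d0 /\ c1 = d1.
Proof.
move=> [p pE] h0.
have E : c0%:P + c1 *: 'X + p * 'X^2 = d0%:P + d1 *: 'X.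
  apply: poly_eq_fun => s; by rewrite !hornerE -h0 pE /=; ring.
have := congr1 (fun p => p`_0) E; have := congr1 (fun p => p`_1) E.
rewrite !coefD !coefC !coefZ !coefX !coefMXn /= !mulr0 !mulr1 !addr0 !add0r.
by move=> -> ->.
Qed.

Lemma coef_binomial c n k : ((1 + c *: 'X : {poly K}) ^+ n)`_k = 'C(n, k)%:R * c ^+ k.
Proof.
rewrite exprDn coef_sum.
under eq_bigr => i _ do rewrite expr1n mul1r exprZn coefMn coefZ coefXn.
have [kn|nk] := ltnP k n.+1.
  rewrite (bigD1 (Ordinal kn)) //= big1 ?addr0 => [|i /negPf ik].
    by rewrite eqxx mulr1 mulr_natl.
  by rewrite [k == i]eq_sym; have := ik; rewrite -val_eqE /= => ->; rewrite mulr0 mul0rn.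
rewrite big1 => [|i _]; last first.
  by rewrite gtn_eqF ?mulr0 ?mul0rn // (leq_trans _ nk).
by rewrite bin_small ?mul0r.
Qed.

(** Polynomial along every affine line of the plane: this is what polarization uses, and it avoids
    bivariate polynomials. *)
Definition bipoly (F : K -> K -> K) :=
  forall a b c d, polyfun (fun s => F (a + s * b) (c + s * d)).

Lemma bipoly_cst k : bipoly (fun _ _ => k).
Proof. by move=> a b c d; apply: polyfun_cst. Qed.
Lemma bipoly_fst f : polyfun f -> bipoly (fun z _ => f z).
Proof.
move=> [p pE] a b c d; exists (p \Po (a%:P + b *: 'X)) => s.
by rewrite horner_comp !hornerE pE [b * s]mulrC.
Qed.
Lemma bipoly_snd f : polyfun f -> bipoly (fun _ w => f w).
Proof. by move=> /bipoly_fst h a b c d; apply: h. Qed.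
Lemma bipolyD F G : bipoly F -> bipoly G -> bipoly (fun z w => F z w + G z w).
Proof. by move=> hF hG a b c d; apply: polyfunD. Qed.
Lemma bipolyN F : bipoly F -> bipoly (fun z w => - F z w).
Proof. by move=> hF a b c d; apply: polyfunN. Qed.
Lemma bipolyM F G : bipoly F -> bipoly G -> bipoly (fun z w => F z w * G z w).
Proof. by move=> hF hG a b c d; apply: polyfunM. Qed.
Lemma bipolyX F n : bipoly F -> bipoly (fun z w => F z w ^+ n).
Proof. by move=> hF a b c d; apply: polyfunX. Qed.
Lemma bipoly_sum (I : finType) (F : I -> K -> K -> K) :
  (forall i, bipoly (F i)) -> bipoly (fun z w => \sum_i F i z w).
Proof. by move=> hF a b c d; apply: polyfun_sum => i; apply: hF. Qed.

(** In characteristic 0 exactly one degree is lost; for constants both sides are 0, since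
    [(size p).-1] is then 0. *)
Lemma lead_coef_deriv p : lead_coef p^`() = lead_coef p *+ (size p).-1.
Proof.
have [s1|s1] := leqP (size p) 1.
  by rewrite (size1_polyC s1) derivC lead_coef0 size_polyC; case: eqP.
have top : p^`()`_(size p).-2 = lead_coef p *+ (size p).-1.
  by rewrite coef_deriv lead_coefE -subn2 -subSn // subSS subn1.
have sz : size p^`() = (size p).-1.
  apply/eqP; rewrite eqn_leq; apply/andP; split.
    by rewrite -ltnS (ltn_predK s1) lt_size_deriv // -size_poly_gt0 ltnW.
  have [//|] := leqP (size p).-1 (size p^`()).
  rewrite -ltnS (ltn_predK s1) => lt.
  move: top; rewrite nth_default => [/esym/eqP|]; last first.
    by rewrite -ltnS prednK // -ltnS ?(ltn_predK s1).
  rewrite -mulr_natr mulf_eq0 lead_coef_eq0 pnatr_eq0 -size_poly_eq0.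
  by move: s1; case: (size p) => [|[]].
by rewrite lead_coefE sz.
Qed.

(* p/q is constant because its derivative vanishes; over the polynomials this
   is a comparison of leading coefficients. *)
Lemma poly_wronskian0 p q : q != 0 -> p^`() * q = p * q^`() -> exists c, p = c *: q.
Proof.
move=> q0 W; exists (lead_coef p / lead_coef q).
set c := _ / _; pose r := p - c *: q; apply/eqP; rewrite -subr_eq0 -/r.
have Wr : r^`() * q = r * q^`().
  rewrite /r derivB derivZ !mulrBl W; congr (_ - _).
  by rewrite -!scalerAl mulrC.
(* The leading coefficients of the two sides differ only by the degrees of [u] and [q] as factors,
   so a nonzero solution has the size of [q]. *)
have lead (u : {poly K}) : u != 0 -> u^`() * q = u * q^`() -> size u = size q.
  move=> u0 /(congr1 lead_coef).
  rewrite lead_coefM [RHS]lead_coefM.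
  rewrite lead_coef_deriv [X in _ = _ * X]lead_coef_deriv.
  rewrite mulrnAl mulrnAr => /eqP.
  rewrite -subr_eq0 -[X in X - _]mulr_natr -[X in _ - X]mulr_natr -mulrBr.
  rewrite !mulf_eq0 !lead_coef_eq0 (negPf u0) (negPf q0) /= subr_eq0 eqr_nat => /eqP E.
  have su : (0 < size u)%N by rewrite size_poly_gt0.
  have sq : (0 < size q)%N by rewrite size_poly_gt0.
  by rewrite -(prednK su) E prednK.
apply: contraT => r0; have sr := lead _ r0 Wr.
have p0 : p != 0 by apply: contraNneq r0; rewrite /r /c => ->; rewrite lead_coef0 mul0r scale0r subrr.
have sp := lead _ p0 W.
(* [p], [q] and [r] have the same size, and [c] cancels the coefficient of [r] in that degree. *)
have : lead_coef r = 0.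
  rewrite lead_coefE sr /r coefB coefZ -[q`_ _]lead_coefE -{1}sp -lead_coefE.
  by rewrite /c divfK ?subrr // lead_coef_eq0.
by move/eqP; rewrite lead_coef_eq0 (negPf r0).
Qed.

End PolynomialFunctions.

Section Polarization.
Variable R : realType.
Local Notation C := R[i].

Lemma conj_lin (a b : C) n : (a + n%:R * b)^* = a^* + n%:R * b^*.
Proof. by rewrite rmorphD rmorphM /= conjC_nat. Qed.

(** On the line through [a] and [b] in the first argument, and through their conjugates in the
    second, every natural parameter gives a pair of conjugate numbers. So [F] vanishes there, hence
    on the whole line. The values of [a] and [b] are such that the parameter ['i] gives the point
    [(z, w)]. *)
Lemma polarization (F : C -> C -> C) :
  bipoly F -> (forall z, F z z^* = 0) -> forall z w, F z w = 0.
Proof.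
move=> hF F0 z w; have two : (2%:R : C) != 0 by rewrite pnatr_eq0.
have i0 : ('i : C) != 0 by rewrite neq0Ci.
pose a := (z + w^*) / 2%:R; pose b := (z - w^*) / (2%:R * 'i).
have [p pE] := hF a b a^* b^*.
have p0 : p = 0.
  apply: poly_eq_nat => n; rewrite horner0 -pE -[RHS](F0 (a + n%:R * b)).
  by rewrite conj_lin.
have := pE 'i; rewrite p0 horner0 => <-.
have cc (x : C) : x^*^* = x by exact: conjCK.
congr (F _ _); rewrite /a /b.
  by field; rewrite ?two ?i0.
have c2 : ((2%:R : C)^-1)^* = 2%:R^-1 by rewrite fmorphV /= conjC_nat.
have ci : ((2%:R * 'i : C)^-1)^* = (2%:R * - 'i)^-1.
  by rewrite fmorphV rmorphM /= conjC_nat conjCi.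
rewrite rmorphM [X in _ + _ * X]rmorphM /= c2 ci rmorphD rmorphB /= !cc.
by field; rewrite ?two ?i0.
Qed.

End Polarization.

(** One variable at a time: for fixed [w] both sides are polynomials in [z], and the conjugated
    result is an identity of polynomials in [w]. *)
Lemma veronese_coef (K : numClosedFieldType) (I : finType) (P : I -> {poly K}) n :
    (forall z w, \sum_i (P i).[z] * ((P i).[w])^* = (1 + z * w^*) ^+ n) ->
  forall k l, \sum_i (P i)`_k * ((P i)`_l)^* = (k == l)%:R * 'C(n, k)%:R.
Proof.
move=> h k l.
have h1 w : \sum_i (P i)`_k * ((P i).[w])^* = 'C(n, k)%:R * (w^*) ^+ k.
  rewrite -coef_binomial; have <- : \sum_i ((P i).[w])^* *: P i = (1 + w^* *: 'X) ^+ n.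
    apply: poly_eq_fun => z; rewrite horner_exp !hornerE horner_sum [_ * z]mulrC -h.
    by apply: eq_bigr => i _; rewrite hornerZ mulrC.
  by rewrite coef_sum; apply: eq_bigr => i _; rewrite coefZ mulrC.
have E : \sum_i ((P i)`_k)^* *: P i = 'C(n, k)%:R *: 'X^k.
  apply: poly_eq_fun => w; rewrite hornerZ hornerXn -[LHS]conjCK.
  rewrite horner_sum rmorph_sum /= -[RHS]conjCK rmorphM rmorphXn /= conjC_nat -h1.
  by congr (_^*); apply: eq_bigr => i _; rewrite hornerZ rmorphM /= conjCK.
have := congr1 (fun p : {poly K} => (p`_l)^*) E; rewrite coef_sum coefZ coefXn rmorph_sum /=.
rewrite rmorphM /= !conjC_nat [l == k]eq_sym [_%:R * _]mulrC => <-.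
by apply: eq_bigr => i _; rewrite coefZ rmorphM /= conjCK.
Qed.
Lemma adj2E (S : comPzRingType) (A : 'M[S]_2) :
  (\adj A 0 0 = A 1 1) * (\adj A 0 1 = - A 0 1) *
  (\adj A 1 0 = - A 1 0) * (\adj A 1 1 = A 0 0).
Proof.
have aE i j : \adj A i j = (-1) ^+ (j + i) * A (lift j ord0) (lift i ord0).
  by rewrite mxE /cofactor det_mx11 !mxE.
have l0 : lift (0 : 'I_2) ord0 = 1 by apply/val_inj.
have l1 : lift (1 : 'I_2) ord0 = 0 by apply/val_inj.
by rewrite !aE !l0 !l1 /= !expr0 !expr1 expr2 mulrNN !mulN1r !mul1r.
Qed.

(** * Recovering a plane from its Pluecker vector *)

Section Contraction.
Variable R : realType.
Local Notation C := R[i].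
Variable m : nat.
Implicit Types (p q : {ffun pair_idx m -> C}) (u v x y : 'rV[C]_m).

(** The antisymmetric matrix of a Pluecker vector, whose coordinates are stored for [i < j] only. *)
Definition alt p (i j : 'I_m) : C :=
  if insub (i, j) is Some r then p r
  else if insub (j, i) is Some r then - p r else 0.

(** The interior product, adjoint to [wedge x] by [dot_contr]. *)
Definition contr p x : 'rV[C]_m := \row_j \sum_i alt p i j * (x 0 i)^*.

Lemma alt_sym p i j : alt p j i = - alt p i j.
Proof.
rewrite /alt; case: insubP => [r /= rij _|/= nij]; case: insubP => [r' /= rji _|/= nji].
- by have := ltn_trans rij rji; rewrite ltnn.
- by rewrite opprK.
- by [].
- by rewrite oppr0.
Qed.

Lemma alt_val p (r : pair_idx m) : alt p (val r).1 (val r).2 = p r.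
Proof. by rewrite /alt -surjective_pairing valK. Qed.

Lemma altP p i j :
  [\/ exists2 r : pair_idx m, val r = (i, j) & alt p i j = p r,
      exists2 r : pair_idx m, val r = (j, i) & alt p i j = - p r
    | i = j /\ alt p i j = 0].
Proof.
have [ij|ij|ij] := ltngtP i j.
- by apply: Or31; exists (Sub (i, j) ij); rewrite ?SubK // -alt_val SubK.
- by apply: Or32; exists (Sub (j, i) ij); rewrite ?SubK // alt_sym -alt_val SubK.
- by apply: Or33; split; [exact/val_inj | rewrite /alt !insubF //= ?ij ?ltnn].
Qed.

Lemma alt_wedge u v i j : alt (wedge u v) i j = u 0 i * v 0 j - u 0 j * v 0 i.
Proof.
case: (altP (wedge u v) i j) => [[r rE ->]|[r rE ->]|[-> ->]]; rewrite ?ffunE ?rE /=.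
- by [].
- by rewrite opprB.
- by rewrite subrr.
Qed.

Lemma altD p q i j : alt (p + q) i j = alt p i j + alt q i j.
Proof.
rewrite /alt; case: insub => [r|]; first by rewrite ffunE.
by case: insub => [r|]; rewrite ?ffunE ?opprD ?addr0.
Qed.

Lemma altZ c p i j : alt (c *: p) i j = c * alt p i j.
Proof.
rewrite /alt; case: insub => [r|]; first by rewrite ffunE.
by case: insub => [r|]; rewrite ?ffunE ?mulrN ?mulr0.
Qed.

Lemma contrD p q x : contr (p + q) x = contr p x + contr q x.
Proof.
by apply/rowP => j; rewrite !mxE -big_split; apply: eq_bigr => i _;
   rewrite altD mulrDl.
Qed.

Lemma contrZ c p x : contr (c *: p) x = c *: contr p x.
Proof.
by apply/rowP => j; rewrite !mxE mulr_sumr; apply: eq_bigr => i _;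
   rewrite altZ mulrA.
Qed.

Lemma contr_wedge u v x : contr (wedge u v) x = dot u x *: v - dot v x *: u.
Proof.
apply/rowP => j; rewrite !mxE !mulr_suml -sumrB; apply: eq_bigr => i _.
by rewrite alt_wedge; ring.
Qed.

Lemma dot_contr p x y : dot (contr p x) y = hdot p (wedge x y).
Proof.
apply: (@mulIf _ 2%:R); first by rewrite pnatr_eq0.
rewrite !mulr_natr.
pose G i j := alt p i j * (x 0 i * y 0 j - x 0 j * y 0 i)^*.
have -> : hdot p (wedge x y) = \sum_(r : pair_idx m) G (val r).1 (val r).2.
  by apply: eq_bigr => r _; rewrite ffunE /G alt_val.
rewrite sum_pair_idx => [|i j|i]; last first.
- by rewrite /G subrr conjC0 mulr0.
- by rewrite /G alt_sym !rmorphB /=; ring.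
have -> : dot (contr p x) y = \sum_i \sum_j alt p i j * (x 0 i)^* * (y 0 j)^*.
  by rewrite exchange_big; apply: eq_bigr => j _; rewrite mxE mulr_suml.
rewrite mulr2n {2}exchange_big -big_split; apply: eq_bigr => i _.
rewrite -big_split; apply: eq_bigr => j _ /=.
by rewrite /G (alt_sym p j i) rmorphB !rmorphM /=; ring.
Qed.

(** On [plucker V] this gives an adjugate times [V] ([contr_frame_plucker]), so a basis of the same
    plane when the determinant of [V *m V0^t*] is not 0. As it is linear in [p], a polynomial
    Pluecker curve yields a polynomial frame of the same degree. *)
Definition contr_frame (V0 : 'M[C]_(2, m)) p : 'M[C]_(2, m) :=
  \matrix_(i < 2) (if i == 0 then - contr p (row 1 V0) else contr p (row 0 V0)).

Lemma contr_frameD V0 p q :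
  contr_frame V0 (p + q) = contr_frame V0 p + contr_frame V0 q.
Proof.
apply/row_matrixP => i; rewrite /contr_frame linearD /= !rowK.
by case: (i == 0); rewrite contrD ?opprD.
Qed.

Lemma contr_frameZ V0 c p : contr_frame V0 (c *: p) = c *: contr_frame V0 p.
Proof.
apply/row_matrixP => i; rewrite /contr_frame linearZ /= !rowK.
by case: (i == 0); rewrite contrZ ?scalerN.
Qed.

Lemma contr_frame_plucker V0 V :
  contr_frame V0 (plucker V) = \adj (V *m V0^t*) *m V.
Proof.
apply/row_matrixP => i; rewrite rowK row_mulmx2.
have aE : (\adj (V *m V0^t*) 0 0 = dot (row 1 V) (row 1 V0)) *
          (\adj (V *m V0^t*) 0 1 = - dot (row 0 V) (row 1 V0)) *
          (\adj (V *m V0^t*) 1 0 = - dot (row 1 V) (row 0 V0)) *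
          (\adj (V *m V0^t*) 1 1 = dot (row 0 V) (row 0 V0)).
  by rewrite !adj2E !mulmx_ctE.
case: (ord2P i) => -> /=; rewrite /plucker contr_wedge !aE ?opprB !scaleNr //.
by rewrite addrC.
Qed.

Lemma contr_frame_orth V0 p : V0 *m V0^t* = 1%:M ->
  contr_frame V0 p *m V0^t* = (hdot p (plucker V0))%:M.
Proof.
move=> V01; apply/matrixP => i j; rewrite mulmx_ctE rowK !mxE.
have dE k l : hdot p (wedge (row k V0) (row l V0)) = dot (contr p (row k V0)) (row l V0).
  by rewrite dot_contr.
case: (ord2P i) => ->; case: (ord2P j) => -> /=; rewrite ?dotNl dot_contr ?wedge_self ?hdot0r ?oppr0 //.
by rewrite wedgeC hdotNr opprK.
Qed.

End Contraction.

(** * The affine frame at a base point *)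

Section BaseFrame.
Variable R : realType.
Local Notation C := R[i].

Definition pcurve (E : lmodType C) (A : nat -> E) (z : C) : E :=
  \sum_(k < 5) z ^+ k *: A k.

Lemma pcurveE (E : lmodType C) (A : nat -> E) z :
  pcurve A z = A 0 + z *: A 1%N + z ^+ 2 *: A 2%N + z ^+ 3 *: A 3%N + z ^+ 4 *: A 4%N.
Proof.
by rewrite /pcurve !big_ord_recr big_ord0 /= add0r expr0 scale1r expr1.
Qed.

Lemma pcurve0 (E : lmodType C) (A : nat -> E) : pcurve A 0 = A 0.
Proof. by rewrite pcurveE !expr0n /= !scale0r !addr0. Qed.

Lemma pcurve_linear (E F : lmodType C) (g : E -> F) (A : nat -> E) z :
    (forall u v, g (u + v) = g u + g v) -> (forall a u, g (a *: u) = a *: g u) ->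
  g (pcurve A z) = pcurve (g \o A) z.
Proof. by move=> gD gZ; rewrite !pcurveE !gD !gZ. Qed.

Variable m : nat.

Definition orth5 (p : nat -> {ffun pair_idx m -> C}) :=
  forall k l, (k < 5)%N -> (l < 5)%N ->
    hdot (p k) (p l) = (k == l)%:R * 'C(4, k)%:R.

Definition spans_on (D : C -> Prop) (f : C -> gr R m) (p : nat -> {ffun pair_idx m -> C}) :=
  forall z, D z -> forall V, rowspan V = val (f z) ->
    exists2 c : C, c != 0 & plucker V = c *: pcurve p z.

Lemma hdot_pcurve p z w : orth5 p ->
  hdot (pcurve p z) (pcurve p w) = (1 + z * w^*) ^+ 4.
Proof.
move=> op; rewrite /pcurve hdot_suml exprDn; apply: eq_bigr => k _.
rewrite hdotZl hdotC hdot_suml rmorph_sum /= (bigD1 k) //= big1 => [|l /negPf lk].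
  by rewrite addr0 -hdotC hdotZr op // eqxx mul1r expr1n mul1r exprMn rmorphXn /= mulrA mulr_natr.
by rewrite -hdotC hdotZr op // [k == l :> nat]eq_sym; have := lk; rewrite -val_eqE /= => ->;
   rewrite mul0r mulr0.
Qed.

(** The frame is [contr_frame] applied to the Pluecker curve; orthogonality of [p k] to [p 0] makes
    its higher coefficients orthogonal to [V0]. The domain [D] leaves out the point where a rotation
    of the sphere has its pole. *)
Lemma base_frame (f : C -> gr R m) p (D : C -> Prop) (V0 : 'M[C]_(2, m)) :
    orth5 p -> D 0 -> spans_on D f p ->
    V0 *m V0^t* = 1%:M -> rowspan V0 = val (f 0) ->
  exists A : nat -> 'M[C]_(2, m),
    [/\ A 0%N = V0, forall k, (0 < k < 5)%N -> A k *m V0^t* = 0,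
        forall z, D z -> val (f z) = rowspan (pcurve A z)
      & exists2 c : C, c * c^* = 1 &
        forall z, D z -> plucker (pcurve A z) = c *: pcurve p z].
Proof.
move=> op D0 sp V01 fV0; have [c c0 pV0] := sp 0 D0 V0 fV0.
rewrite pcurve0 in pV0.
have c1 : c * c^* = 1.
  by have := hdot_plucker V0 V0; rewrite V01 det1 pV0 hdotZl hdotZr op // bin0 !mulr1.
have frameP z : contr_frame V0 (c *: pcurve p z) = pcurve (fun k => contr_frame V0 (c *: p k)) z.
  apply: (pcurve_linear (g := fun q => contr_frame V0 (c *: q))) => [q r|a q]; first by rewrite scalerDr contr_frameD.
  by rewrite scalerA mulrC -scalerA contr_frameZ.
(* Only the constant coefficient of the curve meets [plucker V0], so the curve never leaves the
   affine chart centred at [V0]. *)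
have hd z : hdot (c *: pcurve p z) (plucker V0) = 1.
  rewrite pV0 hdotZl hdotZr mulrA c1 mul1r -(pcurve0 p) hdot_pcurve //.
  by rewrite conjC0 mulr0 addr0 expr1n.
exists (fun k => contr_frame V0 (c *: p k)).
have main z : D z -> val (f z) = rowspan (contr_frame V0 (c *: pcurve p z)) /\
   plucker (contr_frame V0 (c *: pcurve p z)) = c *: pcurve p z.
  move=> Dz; have [V VV fV] := gr_basis (f z); have [d d0 pV] := sp z Dz V fV.
  (* Rescales one basis vector so that the Pluecker vector becomes exactly [c *: pcurve p z]. *)
  pose g : 'M[C]_2 := diag_mx (\row_i if i == 0 then c / d else 1).
  have dg : \det g = c / d by rewrite det_diag !big_ord_recl big_ord0 !mxE /= mulr1 mulr1.
  have pg : plucker (g *m V) = c *: pcurve p z by rewrite plucker_mul dg pV scalerA divfK.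
  have gu : g \in unitmx by rewrite unitmxE dg unitfE mulf_neq0 ?invr_neq0.
  have dg1 : \det ((g *m V) *m V0^t*) = 1 by rewrite -hdot_plucker pg hd.
  have dadj : \det (\adj ((g *m V) *m V0^t*)) = 1.
    have := congr1 determinant (mul_mx_adj ((g *m V) *m V0^t*)).
    by rewrite det_mulmx dg1 mul1r det1.
  rewrite -pg contr_frame_plucker; split; last by rewrite [LHS]plucker_mul dadj scale1r.
  by rewrite rowspan_mul ?unitmxE ?dadj ?unitr1 // rowspan_mul.
split.
- by rewrite -pV0 contr_frame_plucker V01 adj1 mul1mx.
- move=> k /andP[k0 k5]; rewrite contr_frame_orth // pV0 hdotZl hdotZr op //.
  by rewrite gtn_eqF // mul0r !mulr0 raddf0.
- by move=> z Dz; rewrite -frameP; have [] := main z Dz.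
- by exists c => // z Dz; rewrite -frameP; have [] := main z Dz.
Qed.

End BaseFrame.
(** * Complex derivatives *)

Section ComplexDerivative.
Variable R : realType.
Local Notation C := R[i].
Implicit Types (h g : C -> C) (z d : C).

(** Over the field [C] itself, derivation along 1 is complex differentiation. *)
Definition hasd h z d := is_derive (z : C^o) 1 (h : C^o -> C^o) d.

(** One statement for real and complex limits; over [C], [0 < eps] says that [eps] is a positive
    real. *)
Lemma dnbhs0_eps (K : numFieldType) (V : pseudoMetricNormedZmodType K) (f : K -> V) (l : V) :
  (f x @[x --> (0:K)^'] --> l)%classic <->
  forall eps : K, 0 < eps -> exists2 del : K, 0 < del &
    forall t, t != 0 -> `|t| < del -> `|l - f t| < eps.
Proof.
split=> [/cvgrPdist_lt h eps e0|h].
  have := h _ e0; rewrite near_withinE /= => /nbhs_ballP[del /= d0 dP].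
  exists del => // t t0 tdel; apply: dP => //.
  by rewrite /ball /= sub0r normrN.
apply/cvgrPdist_lt => eps e0; have [del d0 dP] := h _ e0.
rewrite near_withinE; apply/nbhs_ballP; exists del => // t.
by rewrite /ball /= sub0r normrN => tdel t0; apply: dP.
Qed.

Lemma dnbhs0_congr (K : numFieldType) (V : pseudoMetricNormedZmodType K) (f g : K -> V) (l : V) :
    (\forall t \near ((0 : K)^')%classic, f t = g t) ->
  (f x @[x --> (0:K)^'] --> l)%classic -> (g x @[x --> (0:K)^'] --> l)%classic.
Proof.
move=> fg /cvgrPdist_lt h; apply/cvgrPdist_lt => eps e0.
apply: filterS2 fg (h _ e0) => t fgt; by rewrite fgt.
Qed.

Lemma hasd_cvg h z d : hasd h z d <->
  (t^-1 * (h (t + z) - h z) @[t --> (0 : C^o)^'] --> (d : C^o))%classic.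
Proof.
have E : (fun t : C => t^-1 * (h (t + z) - h z)) =
   (fun t : C => t^-1 *: (((h : C^o -> C^o) \o shift (z : C^o)) (t *: (1 : C^o)) - h z)).
  by apply/funext => t; rewrite /= /shift /= /GRing.scale /= mulr1.
rewrite E; split=> [[hd hE]|hc].
  by rewrite -hE; apply: hd.
by split; [apply/cvg_ex; exists d | apply: cvg_lim].
Qed.

Lemma hasdP h z d : hasd h z d <->
  forall eps : C, 0 < eps -> exists2 del : C, 0 < del &
    forall t, t != 0 -> `|t| < del -> `|d - t^-1 * (h (t + z) - h z)| < eps.
Proof.
rewrite hasd_cvg.
exact: (dnbhs0_eps (V := C^o) (fun t => t^-1 * (h (t + z) - h z)) d).
Qed.

Lemma hasd_val h z d : hasd h z d -> 'D_1 (h : C^o -> C^o) (z : C^o) = d.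
Proof. by move=> hd; apply: derive_val. Qed.

Lemma hasd_cdiff h z d : hasd h z d -> cdiff h z.
Proof. by case. Qed.

Lemma cdiff_hasd h z : cdiff h z -> hasd h z ('D_1 (h : C^o -> C^o) (z : C^o)).
Proof. by move=> hd; split. Qed.

Lemma hasd_unique h z d e : hasd h z d -> hasd h z e -> d = e.
Proof. by move=> /hasd_val <- /hasd_val <-. Qed.

Lemma hasd_near h g z d :
  (\forall w \near (z : C^o), h w = g w) -> hasd h z d -> hasd g z d.
Proof.
move=> hg /hasdP hd; apply/hasdP => eps e0; have [del d0 dP] := hd _ e0.
have /nbhs_ballP[r /= r0 rP] := hg.
have hgz : h z = g z by apply: rP; apply: ballxx.
(* [C] is only partially ordered: the two radii are comparable because they are real. *)
have rr := gtr0_real r0; have dr := gtr0_real d0.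
exists (Num.min del r); first by rewrite comparable_lt_min ?d0 ?real_comparable.
move=> t t0; rewrite comparable_lt_min ?real_comparable // => /andP[td tr].
rewrite -hgz -rP; first exact: dP.
by rewrite /ball /= opprD addrCA subrr addr0 normrN.
Qed.

Lemma hasd_cst c z : hasd (fun=> c) z 0.
Proof. exact: is_derive_cst. Qed.
Lemma hasd_id z : hasd id z 1.
Proof. exact: is_derive_id. Qed.
Lemma hasdD h g z d e : hasd h z d -> hasd g z e -> hasd (fun w => h w + g w) z (d + e).
Proof. exact: is_deriveD. Qed.
Lemma hasdB h g z d e : hasd h z d -> hasd g z e -> hasd (fun w => h w - g w) z (d - e).
Proof. exact: is_deriveB. Qed.
Lemma hasdM h g z d e : hasd h z d -> hasd g z e ->
  hasd (fun w => h w * g w) z (d * g z + h z * e).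
Proof.
move=> hd ge.
have -> : d * g z + h z * e = h z *: (e : C^o) + g z *: (d : C^o).
  by rewrite addrC [d * _]mulrC.
exact: is_deriveM.
Qed.

Lemma hasd_continuous h z d : hasd h z d ->
  (h (t + z) @[t --> (0 : C^o)^'] --> (h z : C^o))%classic.
Proof.
move=> /hasd_cvg hd.
have tid : ((t : C^o) @[t --> (0 : C^o)^'] --> (0 : C^o))%classic.
  apply/(dnbhs0_eps (V := C^o) (fun t => t) 0) => eps e0.
  by exists eps => // t _; rewrite sub0r normrN.
have H : (t * (t^-1 * (h (t + z) - h z)) + h z @[t --> (0 : C^o)^'] --> (0 * d + h z : C^o))%classic.
  exact: (cvgD (cvgM tid hd) (cvg_cst (h z : C^o))).
rewrite mul0r add0r in H; apply: (dnbhs0_congr (V := C^o) _ H).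
near=> t; have t0 : t != 0 by near: t; exact: nbhs_dnbhs_neq.
by rewrite /= mulrA divff // mul1r subrK.
Unshelve. all: by end_near.
Qed.

Lemma hasd_near_neq0 h z d : hasd h z d -> h z != 0 ->
  \forall w \near (z : C^o), h w != 0.
Proof.
move=> hd h0.
have := hasd_continuous hd => /(cvgr_neq0 (V := C^o) _) /(_ h0).
rewrite near_withinE => /nbhs_ballP[r /= r0 rP].
apply/nbhs_ballP; exists r => // w; rewrite /ball /= => zw.
have [->//|wz] := eqVneq w z.
have := rP (w - z); rewrite subrK; apply; last by rewrite subr_eq0.
by rewrite /ball /= sub0r normrN distrC.
Qed.

Lemma hasdV h z d : h z != 0 -> hasd h z d -> hasd (fun w => (h w)^-1) z (- d / h z ^+ 2).
Proof.
move=> h0 hd; have hc := hasd_continuous hd; apply/hasd_cvg.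
have /hasd_cvg hd' := hd.
have H : ((t^-1 * (h (t + z) - h z)) * ((h (t + z))^-1 * - (h z)^-1) @[t --> (0 : C^o)^']
    --> (d * ((h z)^-1 * - (h z)^-1) : C^o))%classic.
  have H2 : ((h (t + z))^-1 @[t --> (0 : C^o)^'] --> ((h z)^-1 : C^o))%classic.
    exact: (cvgV (K := C) h0 hc).
  exact: (cvgM hd' (cvgM H2 (cvg_cst (- (h z)^-1 : C^o)))).
have E : d * ((h z)^-1 * - (h z)^-1) = - d / h z ^+ 2 by field.
rewrite E in H; apply: (dnbhs0_congr (V := C^o) _ H).
have hn0 : \forall t \near ((0 : C^o)^')%classic, h (t + z) != 0.
  exact: (cvgr_neq0 (V := C^o) _ hc h0).
near=> t; have ht : h (t + z) != 0 by near: t.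
have t0 : t != 0 by near: t; exact: nbhs_dnbhs_neq.
rewrite /=; field; rewrite h0 ht t0 //.
Unshelve. all: by end_near.
Qed.

Lemma hasdX h z d n : hasd h z d -> hasd (fun w => h w ^+ n) z (n%:R * h z ^+ n.-1 * d).
Proof.
move=> hd; elim: n => [|n IHn].
  by rewrite !mul0r; under eq_fun do rewrite expr0; apply: hasd_cst.
under eq_fun do rewrite exprS.
have := hasdM hd IHn; congr hasd.
case: n {IHn} => [|n]; first by rewrite /=; ring.
by rewrite /= exprS; ring.
Qed.

Lemma hasd_sum (I : finType) (F : I -> C -> C) (dF : I -> C) z :
  (forall i, hasd (F i) z (dF i)) -> hasd (fun w => \sum_i F i w) z (\sum_i dF i).
Proof.
move=> hF; have -> : (fun w => \sum_i F i w) = \sum_i F i.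
  by apply/funext => w; rewrite fct_sumE.
elim/big_rec2: _ => [|i d f _ hd]; first exact: hasd_cst.
by apply: (hasdD (hF i)).
Qed.

Lemma hasd_horner (p : {poly C}) z : hasd (horner p) z p^`().[z].
Proof.
elim/poly_ind: p => [|p c hp].
  have -> : horner (0 : {poly C}) = fun=> 0 by apply/funext => w; rewrite horner0.
  by rewrite deriv0 horner0; apply: hasd_cst.
have -> : horner (p * 'X + c%:P) = fun w => p.[w] * w + c.
  by apply/funext => w; rewrite hornerMXaddC.
rewrite derivMXaddC.
have -> : (p + p^`() * 'X).[z] = p^`().[z] * z + p.[z] * 1 + 0.
  by rewrite hornerD hornerMX; ring.
exact: hasdD (hasdM hp (hasd_id z)) (hasd_cst c z).
Qed.

Lemma real_limit_eps (f : R -> R) (l a : R) :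
    (forall eps : R, 0 < eps -> exists2 del : R, 0 < del &
      forall s, s != 0 -> `|s| < del -> `|l - s^-1 * (f (s + a) - f a)| < eps) ->
  derive1 f a = l.
Proof.
move=> h; apply: cvg_lim => //.
exact/(dnbhs0_eps (V := R^o) (fun s => s^-1 * (f (s + a) - f a)) l).
Qed.

Lemma Re_le_norm (z : C) : `|complex.Re z| <= complex.Re `|z|.
Proof.
case: z => x y; rewrite normc_def /=.
by rewrite -sqrtr_sqr ler_wsqrtr // lerDl sqr_ge0.
Qed.

Lemma Im_le_norm (z : C) : `|complex.Im z| <= complex.Re `|z|.
Proof.
case: z => x y; rewrite normc_def /=.
by rewrite -sqrtr_sqr ler_wsqrtr // lerDr sqr_ge0.
Qed.

End ComplexDerivative.

(** * Real directional derivatives of holomorphic frames *)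

Section RealDirections.
Variable R : realType.
Local Notation C := R[i].
Local Open Scope complex_scope.
Implicit Types (h g : C -> C) (z d u v : C).

Lemma normC_Re z : `|z| = (complex.Re `|z|)%:C.
Proof. by rewrite normc_def. Qed.

Lemma complexReM u v : complex.Re (u * v) = complex.Re u * complex.Re v - complex.Im u * complex.Im v.
Proof. by case: u => a b; case: v. Qed.

Lemma complexImM u v : complex.Im (u * v) = complex.Re u * complex.Im v + complex.Im u * complex.Re v.
Proof. by case: u => a b; case: v. Qed.

Lemma Re_realM (a : R) z : complex.Re (a%:C * z) = a * complex.Re z.
Proof. by rewrite complexReM /= mul0r subr0. Qed.

Lemma Im_realM (a : R) z : complex.Im (a%:C * z) = a * complex.Im z.
Proof. by rewrite complexImM /= mul0r addr0. Qed.

(** The quotient along [z + s u] is [u] times the complex quotient for the increment [s u]. The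
    bound divides by [nu + 1], which is never 0; the terms [s + 0] and [0%:C] are those that appear
    when [derive1] at 0 is unfolded. *)
Lemma direction_quotient h z d u : hasd h z d ->
  forall eps : R, 0 < eps -> exists2 del : R, 0 < del &
    forall s : R, s != 0 -> `|s| < del ->
      complex.Re `|u * d - (s^-1)%:C * (h (z + (s + 0)%:C * u) - h (z + 0%:C * u))| < eps.
Proof.
move=> /hasdP hd eps e0.
set nu := complex.Re `|u|; have nu0 : 0 <= nu by rewrite -lecR -normC_Re normr_ge0.
have n1 : 0 < nu + 1 by rewrite ltr_wpDl.
have e1 : 0 < (eps / (nu + 1))%:C by rewrite ltcR divr_gt0.
have [del d0 dP] := hd _ e1.
have dE : del = (complex.Re del)%:C.
  by have := d0; case: (del) => x y; rewrite ltcE /= => /andP[/eqP -> _].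
have rd0 : 0 < complex.Re del by rewrite -ltcR -dE.
exists (complex.Re del / (nu + 1)); first by rewrite divr_gt0.
move=> s s0 sdel; rewrite addr0 mul0r addr0.
have sC0 : (s%:C : C) != 0 by rewrite -(rmorph0 (real_complex R)) (inj_eq (@complexI _)).
have [->|u0] := eqVneq u 0; first by rewrite mulr0 addr0 subrr mulr0 mul0r subr0 normr0.
have -> : u * d - (s^-1)%:C * (h (z + s%:C * u) - h z)
    = u * (d - (s%:C * u)^-1 * (h (s%:C * u + z) - h z)).
  by rewrite [z + _]addrC fmorphV; field; rewrite sC0 u0.
rewrite normrM [`|u|]normC_Re -/nu.
have su : `|s%:C * u| < del.
  rewrite normrM [`|u|]normC_Re -/nu normc_def /= expr0n addr0 sqrtr_sqr.
  rewrite -rmorphM dE ltcR (le_lt_trans (y := `|s| * (nu + 1))) //.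
    by rewrite ler_wpM2l // lerDl.
  by rewrite -ltr_pdivlMr.
have su0 : s%:C * u != 0 by rewrite mulf_neq0.
have := dP _ su0 su; rewrite normC_Re ltcR => lt.
rewrite Re_realM.
apply: (le_lt_trans (y := nu * (eps / (nu + 1)))); first by rewrite ler_wpM2l // ltW.
by rewrite mulrA ltr_pdivrMr // mulrC ltr_pM2l // ltrDl.
Qed.

Lemma ddirR_Re h z d u : hasd h z d -> ddirR (fun w => complex.Re (h w)) u z = complex.Re (u * d).
Proof.
move=> hd; apply: real_limit_eps => eps e0.
have [del d0 dP] := direction_quotient u hd e0; exists del => // s s0 sd.
apply: le_lt_trans (dP s s0 sd); apply: le_trans (Re_le_norm _).
by rewrite raddfB /= [complex.Re ((s^-1)%:C * _)]Re_realM raddfB.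
Qed.

Lemma ddirR_Im h z d u : hasd h z d -> ddirR (fun w => complex.Im (h w)) u z = complex.Im (u * d).
Proof.
move=> hd; apply: real_limit_eps => eps e0.
have [del d0 dP] := direction_quotient u hd e0; exists del => // s s0 sd.
apply: le_lt_trans (dP s s0 sd); apply: le_trans (Im_le_norm _).
by rewrite raddfB /= [complex.Im ((s^-1)%:C * _)]Im_realM raddfB.
Qed.

Lemma ddirR_near (f g : C -> R) u z :
  (\forall w \near (z : C^o), f w = g w) -> ddirR f u z = ddirR g u z.
Proof.
move=> /nbhs_ballP[r /= r0 fg]; rewrite /ddirR !derive1E; apply: near_eq_derive.
have rE : r = (complex.Re r)%:C.
  by have := r0; case: (r) => x y; rewrite ltcE /= => /andP[/eqP -> _].
have rr0 : 0 < complex.Re r by rewrite -ltcR -rE.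
set nu := complex.Re `|u|; have nu0 : 0 <= nu by rewrite -lecR -normC_Re normr_ge0.
have n1 : 0 < nu + 1 by rewrite ltr_wpDl.
apply/nbhs_ballP; exists (complex.Re r / (nu + 1)); first by rewrite /= divr_gt0.
move=> s; rewrite /ball /= sub0r normrN => sr; apply: fg.
rewrite /ball /= opprD addrA subrr add0r normrN normrM.
rewrite [`|u|]normC_Re -/nu normc_def /= expr0n addr0 sqrtr_sqr.
rewrite -rmorphM rE ltcR (le_lt_trans (y := `|s| * (nu + 1))) //.
  by rewrite ler_wpM2l // lerDl.
by rewrite -ltr_pdivlMr.
Qed.

Variable m : nat.
Implicit Types (F G : C -> 'M[C]_(2, m)) (D : 'M[C]_(2, m)).

Definition hasdM2 F z D := forall i j, hasd (fun w => F w i j) z (D i j).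

Lemma hasdM2_cderiv F z D : hasdM2 F z D -> cderiv F z = D.
Proof. by move=> h; apply/matrixP => i j; rewrite mxE (hasd_val (h i j)). Qed.

Lemma hasdM2_ddir F z D u : hasdM2 F z D -> ddir F u z = u *: D.
Proof.
move=> h; apply/matrixP => i j; rewrite !mxE (ddirR_Re _ (h i j)) (ddirR_Im _ (h i j)).
by case: (u * D i j).
Qed.

Lemma hasdM2_near F G z D :
  (\forall w \near (z : C^o), F w = G w) -> hasdM2 F z D -> hasdM2 G z D.
Proof. by move=> FG h i j; apply: hasd_near (h i j); apply: filterS FG => w ->. Qed.

Lemma hasdM2Z c F z D : hasdM2 F z D -> hasdM2 (fun w => c *: F w) z (c *: D).
Proof.
move=> h i j; have := hasdM (hasd_cst c z) (h i j).
have -> : (fun w => (c *: F w) i j) = (fun w => c * F w i j).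
  by apply/funext => w; rewrite mxE.
by rewrite mul0r add0r mxE.
Qed.

(** The inner derivative must be known on a neighbourhood before it is differentiated again; for a
    holomorphic frame the result is complex bilinear in [u] and [v]. *)
Lemma ddir2 F G z D u v :
    (\forall w \near (z : C^o), hasdM2 F w (G w)) -> hasdM2 G z D ->
  ddir (ddir F v) u z = (u * v) *: D.
Proof.
move=> FG GD; rewrite -scalerA -(hasdM2_ddir u (hasdM2Z v GD)).
apply/matrixP => i j; rewrite !mxE.
by congr (_ +i* _); apply: ddirR_near; apply: filterS FG => w /(hasdM2_ddir v) ->; rewrite mxE.
Qed.

Lemma frame_hasd (f : C -> gr R m) z F : frame_near f z F ->
  \forall w \near (z : C^o), val (f w) = rowspan (F w) /\ hasdM2 F w (cderiv F w).
Proof.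
apply: filterS => w [-> Fd]; split=> // i j; rewrite mxE.
exact: cdiff_hasd.
Qed.

Lemma frame_hasd_at (f : C -> gr R m) z F : frame_near f z F ->
  val (f z) = rowspan (F z) /\ hasdM2 F z (cderiv F z).
Proof. by move=> /frame_hasd /nbhs_singleton. Qed.

End RealDirections.
(** * Rigidity of the Pluecker curve *)

Section Calabi.
Variable K : numClosedFieldType.
Implicit Types (z w : K).

(* The Kaehler potential [\sum_i |P_i z|^2], polarized in its two arguments. *)
Variables (I : finType) (P : I -> {poly K}) (n : nat).
Local Notation Pc i := (map_poly Num.conj (P i)).
Let N z w := \sum_i (P i).[z] * (Pc i).[w].
Let Nz z w := \sum_i (P i)^`().[z] * (Pc i).[w].
Let Nw z w := \sum_i (P i).[z] * (Pc i)^`().[w].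
Let Nzw z w := \sum_i (P i)^`().[z] * (Pc i)^`().[w].

Hypothesis curvature : forall z w,
  (1 + z * w) ^+ 2 * (Nzw z w * N z w - Nz z w * Nw z w) = n.+1%:R * N z w ^+ 2.
Hypothesis no_common_zero : forall z, exists i, (P i).[z] != 0.

Lemma conj_horner (p : {poly K}) w : (map_poly Num.conj p).[w] = (p.[w^*])^*.
Proof. by rewrite -{1}(conjCK w) horner_map. Qed.

Let deriv_sum (F : I -> {poly K}) : (\sum_i F i)^`() = \sum_i (F i)^`().
Proof. exact: (big_morph _ (@derivD _) (@deriv0 _)). Qed.

Let N_gt0 z : 0 < N z z^*.
Proof.
have [i Pi] := no_common_zero z; rewrite /N (bigD1 i) //=.
apply: ltr_pwDl; first by rewrite conj_horner conjCK mul_conjC_gt0.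
by apply: sumr_ge0 => j _; rewrite conj_horner conjCK mul_conjC_ge0.
Qed.

Let affine_poly w : exists2 u : {poly K}, forall x, u.[x] = 1 + w * x
  & forall x, u^`().[x] = w.
Proof.
exists (1 + w *: 'X) => x; first by rewrite hornerD hornerZ hornerC hornerX.
by rewrite derivD derivC derivZ derivX add0r hornerZ hornerC mulr1.
Qed.

(** The curvature equation says that [log N] and [n.+1] times [log (1 + z w)] have the same mixed
    derivative. So [Nw / N - n.+1 z / (1 + z w)], which is [L / M], does not depend on [z]: its
    derivative is a Wronskian, to which [poly_wronskian0] applies. The value is then compared with
    that at [z = 0]. *)
Let first_order z w :
  ((1 + z * w) * Nw z w - n.+1%:R * z * N z w) * N 0 w = Nw 0 w * ((1 + z * w) * N z w).
Proof.
pose Np : {poly K} := \sum_i (Pc i).[w] *: P i.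
pose Bp : {poly K} := \sum_i (Pc i)^`().[w] *: P i.
have NpE x : Np.[x] = N x w.
  by rewrite horner_sum; apply: eq_bigr => i _; rewrite hornerZ mulrC.
have BpE x : Bp.[x] = Nw x w.
  by rewrite horner_sum; apply: eq_bigr => i _; rewrite hornerZ mulrC.
have dNpE x : Np^`().[x] = Nz x w.
  by rewrite deriv_sum horner_sum; apply: eq_bigr => i _; rewrite derivZ hornerZ mulrC.
have dBpE x : Bp^`().[x] = Nzw x w.
  by rewrite deriv_sum horner_sum; apply: eq_bigr => i _; rewrite derivZ hornerZ mulrC.
have [u uE duE] := affine_poly w.
pose L : {poly K} := u * Bp - n.+1%:R *: 'X * Np.
pose M : {poly K} := u * Np.
have M0 : M != 0.
  rewrite mulf_neq0 //.
    by apply/eqP => /(congr1 (horner^~ 0)); rewrite uE mulr0 addr0 horner0 => /eqP; rewrite oner_eq0.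
  apply/eqP => /(congr1 (horner^~ w^*)); rewrite NpE horner0 => h.
  by have := N_gt0 w^*; rewrite conjCK h ltxx.
have [c LM] : exists c, L = c *: M.
  apply: poly_wronskian0 => //; apply: poly_eq_fun => x.
  rewrite /L /M !(derivB, derivM, derivZ, derivX) !(hornerD, hornerN, hornerM, hornerZ, hornerX, hornerC) uE duE NpE BpE dNpE dBpE.
  have := curvature x w; rewrite expr2 => E; apply/eqP; rewrite -subr_eq0; apply/eqP.
  rewrite -[RHS](subrr (n.+1%:R * N x w ^+ 2)) -{1}E; ring.
have := congr1 (horner^~ z) LM; have := congr1 (horner^~ 0) LM.
rewrite /L /M !(hornerD, hornerN, hornerM, hornerZ, hornerX, hornerC) !uE !NpE !BpE.
rewrite !mulr0 !addr0 !mul1r mul0r subr0 => -> E0; rewrite [z * w]mulrC E0; ring.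
Qed.

(** Integrating once more, in [w], gives [prod]. By it and the positivity of [N] at conjugate
    arguments, the polynomial [N z 0] has no zero; over an algebraically closed field it is
    constant, and so is [N 0 w] by symmetry. *)
Lemma calabi_rigidity : exists2 k : K, 0 < k &
  forall z w, \sum_i (P i).[z] * ((P i).[w])^* = k * (1 + z * w^*) ^+ n.+1.
Proof.
have N00 : 0 < N 0 0 by have := N_gt0 0; rewrite conjC0.
have prod z w : N z w * N 0 0 = N z 0 * ((1 + z * w) ^+ n.+1 * N 0 w).
  pose p x : {poly K} := \sum_i (P i).[x] *: Pc i.
  have pE x y : (p x).[y] = N x y.
    by rewrite horner_sum; apply: eq_bigr => i _; rewrite hornerZ.
  have dpE x y : (p x)^`().[y] = Nw x y.
    by rewrite deriv_sum horner_sum; apply: eq_bigr => i _; rewrite derivZ hornerZ.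
  have [u uE duE] := affine_poly z.
  pose q : {poly K} := u ^+ n.+1 * p 0.
  have q0 : q != 0.
    apply/eqP => /(congr1 (horner^~ 0)).
    rewrite hornerM horner_exp uE mulr0 addr0 expr1n mul1r pE horner0 => h.
    by rewrite h ltxx in N00.
  have [c pq] : exists c, p z = c *: q.
    apply: poly_wronskian0 => //; apply: poly_eq_fun => x.
    rewrite /q derivM deriv_exp !(hornerD, hornerM, hornerMn, horner_exp) !pE !dpE uE duE.
    have := first_order z x; rewrite /= !exprS => E; apply/eqP; rewrite -subr_eq0; apply/eqP.
    rewrite -[RHS](mulr0 ((1 + z * x) ^+ n)) -[in RHS](subrr (Nw 0 x * ((1 + z * x) * N z x))).
    rewrite -{1}E -mulr_natr; ring.
  have := congr1 (horner^~ w) pq; have := congr1 (horner^~ 0) pq.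
  rewrite !hornerZ !hornerM !horner_exp !uE !pE mulr0 addr0 expr1n mul1r => -> ->; ring.
exists (N 0 0) => // z w.
pose g : {poly K} := \sum_i (Pc i).[0] *: P i.
have gE x : g.[x] = N x 0.
  by rewrite horner_sum; apply: eq_bigr => i _; rewrite hornerZ mulrC.
have Nconj x y : N x y = (N y^* x^*)^*.
  rewrite /N rmorph_sum; apply: eq_bigr => i _.
  by rewrite rmorphM /= !conj_horner !conjCK mulrC.
have gn0 x : g.[x] != 0.
  apply/eqP; rewrite gE => h; have := prod x x^*; rewrite h mul0r => /eqP.
  by rewrite mulf_eq0 (gt_eqF (N_gt0 x)) (gt_eqF N00).
have /size_poly1P[c _ gc] : size g == 1%N.
  by apply: contraT => /closed_rootP[x /rootP/eqP]; rewrite (negPf (gn0 x)).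
have N0 x : N x 0 = N 0 0 by rewrite -!gE gc !hornerC.
have N0' y : N 0 y = N 0 0 by rewrite Nconj conjC0 N0 [RHS]Nconj conjC0.
have -> : \sum_i (P i).[z] * ((P i).[w])^* = N z w^*.
  by apply: eq_bigr => i _; rewrite conj_horner conjCK.
apply: (mulIf (lt0r_neq0 N00)).
by rewrite prod N0 N0'; ring.
Qed.

End Calabi.

(** * The induced metric through the Pluecker curve *)

Section PluckerMetric.
Variable R : realType.
Local Notation C := R[i].
Variable m : nat.
Implicit Types (f : C -> gr R m) (P : pair_idx m -> {poly C}).

Definition plucker_spans f P := forall z V, rowspan V = val (f z) ->
  exists2 c : C, c != 0 & forall p, plucker V p = c * (P p).[z].

Definition horner_ffun P (z : C) : {ffun pair_idx m -> C} := [ffun p => (P p).[z]].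

Lemma dpluckerZ (V X : 'M[C]_(2, m)) u : dplucker V (u *: X) = u *: dplucker V X.
Proof.
apply/ffunP => p; rewrite [RHS]ffunE.
by rewrite /dplucker !linearZ /= wedgeZl wedgeZr -scalerDr ffunE.
Qed.

Lemma hasd_plucker (F : C -> 'M[C]_(2, m)) z D : hasdM2 F z D ->
  forall p, hasd (fun w => plucker (F w) p) z (dplucker (F z) D p).
Proof.
move=> FD p.
have -> : dplucker (F z) D p =
   (D 0 (val p).1 * F z 1 (val p).2 + F z 0 (val p).1 * D 1 (val p).2)
 - (D 0 (val p).2 * F z 1 (val p).1 + F z 0 (val p).2 * D 1 (val p).1).
  by rewrite !ffunE !mxE; ring.
have -> : (fun w => plucker (F w) p) = (fun w =>
    F w 0 (val p).1 * F w 1 (val p).2 - F w 0 (val p).2 * F w 1 (val p).1).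
  by apply/funext => w; rewrite ffunE !mxE.
by apply: hasdB; apply: hasdM; apply: FD.
Qed.

(** The Fubini-Study form sees neither the radial part [c1 *: p] of a variation nor the scale of
    [p]. *)
Lemma fubini_study_scale (c c1 u v : C) (p d : {ffun pair_idx m -> C}) :
    c != 0 -> p != 0 ->
  fubini_study (c *: p) (u *: (c1 *: p + c *: d)) (v *: (c1 *: p + c *: d))
    = u * v^* * fubini_study p d d.
Proof.
move=> c0 p0; rewrite /fubini_study !(hdotZl, hdotZr, hdotDl, hdotDr).
have cc0 : c^* != 0 by rewrite conjC_eq0.
have n0 : hdot p p != 0 by apply: contra_neq p0 => /hdot_eq0.
by field; rewrite c0 cc0 n0.
Qed.

(** The Pluecker vector of a holomorphic frame is [k w] times [P w]. Here [k] is a quotient by a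
    coordinate that does not vanish at [z], so it is holomorphic and its derivative only adds a
    radial term. *)
Lemma induced_plucker f P z F u v :
    plucker_spans f P -> (exists p, (P p).[z] != 0) -> frame_near f z F ->
  Defs.induced F z u v = complex.Re (u * v^* * fubini_study (horner_ffun P z)
    (horner_ffun (fun p => (P p)^`()) z) (horner_ffun (fun p => (P p)^`()) z)).
Proof.
move=> fP [p0 p0z] fF; have fF' := frame_hasd fF.
have [fz FD] := frame_hasd_at fF; set D := cderiv F z in FD.
have [c c0 cE] := fP z (F z) (esym fz).
have pd := hasd_plucker FD.
have P'd := hasd_horner (P p0) z.
pose k w := plucker (F w) p0 * ((P p0).[w])^-1.
have [c1 kd] : exists c1, hasd k z c1.
  by eexists; apply: hasdM (pd p0) (hasdV p0z P'd).
have kz : k z = c by rewrite /k cE mulfK.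
have near_k : \forall w \near (z : C^o), forall p, plucker (F w) p = k w * (P p).[w].
  have nz : \forall w \near (z : C^o), (P p0).[w] != 0.
    exact: hasd_near_neq0 P'd p0z.
  apply: filterS2 fF' nz => w [fw _] Pw p.
  have [e e0 eE] := fP w (F w) (esym fw).
  by rewrite /k !eE mulfK.
have hE Q w p : horner_ffun Q w p = (Q p).[w] by rewrite ffunE.
have dE : dplucker (F z) D = c1 *: horner_ffun P z + c *: horner_ffun (fun p => (P p)^`()) z.
  apply/ffunP => p; rewrite [RHS]ffunE [X in _ = X + _]ffunZE [X in _ = _ + X]ffunZE !hE.
  have h1 : hasd (fun w => plucker (F w) p) z (c1 * (P p).[z] + k z * (P p)^`().[z]).
    apply: hasd_near (hasdM kd (hasd_horner (P p) z)).
    by apply: filterS near_k => w ->.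
  by rewrite (hasd_unique (pd p) h1) kz.
have pE : plucker (F z) = c *: horner_ffun P z.
  by apply/ffunP => p; rewrite ffunZE hE cE.
have P0 : horner_ffun P z != 0.
  by apply: contraNneq p0z => /(congr1 (fun h : {ffun _} => h p0)); rewrite hE ffunE => ->.
rewrite /Defs.induced /gmetric !(hasdM2_ddir _ FD) !dpluckerZ dE pE.
by rewrite fubini_study_scale.
Qed.

End PluckerMetric.
Section VeroneseMetric.
Variable R : realType.
Local Notation C := R[i].
Variable m : nat.
Implicit Types (f : C -> gr R m) (P : pair_idx m -> {poly C}).

Definition veronese_poly P := forall z w,
  \sum_p (P p).[z] * ((P p).[w])^* = (1 + z * w^*) ^+ 4.

Lemma conjE (x y : R) : (x +i* y)%C^* = (x -i* y)%C.
Proof. by []. Qed.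

Lemma sqnormE (z : C) : z * z^* = (complex.Re z ^+ 2 + complex.Im z ^+ 2)%:C%C.
Proof.
case: z => x y; rewrite conjE; apply/eqP; rewrite eq_complex /=; apply/andP; split.
  by rewrite mulrN opprK !expr2.
by rewrite mulrN [y * x]mulrC addrC subrr.
Qed.

Lemma bipoly_polyM (p q : {poly C}) : bipoly (fun z w => p.[z] * q.[w]).
Proof.
by apply: bipolyM; [apply: bipoly_fst | apply: bipoly_snd]; apply: polyfun_horner.
Qed.

End VeroneseMetric.

(** * The logarithm of the metric density along a real line *)

Section RealDerivative.
Variable R : realType.
Variables x y a b : R.
Let q (s : R) := 1 + (x + s * a) ^+ 2 + (y + s * b) ^+ 2.

Let q_gt0 s : 0 < q s.
Proof. by rewrite /q -addrA ltr_pwDl ?addr_ge0 ?sqr_ge0. Qed.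

Let dq (s : R) : is_derive s (1 : R) q (2 * a * (x + s * a) + 2 * b * (y + s * b)).
Proof.
pose p : {poly R} := 1 + (x%:P + a *: 'X) ^+ 2 + (y%:P + b *: 'X) ^+ 2.
have -> : q = horner p.
  by apply/funext => r; rewrite /p !hornerE /= /q !expr2; ring.
have -> : 2 * a * (x + s * a) + 2 * b * (y + s * b) = p^`().[s].
  rewrite /p !expr2 !(derivD, derivM, derivZ, derivX, derivC).
  by rewrite !(hornerD, hornerM, hornerZ, hornerX, hornerC); ring.
exact: is_derive_poly.
Qed.

Lemma derive_ln_potential :
  derive1 (fun s : R => ln (4 / (1 + ((x + s * a) ^+ 2 + (y + s * b) ^+ 2)) ^+ 2)) 0
    = - 4 * (x * a + y * b) / (1 + (x ^+ 2 + y ^+ 2)).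
Proof.
have -> : (fun s : R => ln (4 / (1 + ((x + s * a) ^+ 2 + (y + s * b) ^+ 2)) ^+ 2))
   = fun s => ln 4 - 2 * ln (q s).
  apply/funext => s; rewrite addrA -/(q s).
  by rewrite ln_div ?posrE ?exprn_gt0 ?ltr0n // lnXn // mulr_natl.
rewrite derive1E.
have H : is_derive (0 : R) (1 : R) (@ln R \o q) ((q 0)^-1 * (2 * a * (x + 0 * a) + 2 * b * (y + 0 * b))).
  exact: (is_derive1_comp (is_derive1_ln (q_gt0 0)) (dq 0)).
have -> : (fun s => ln 4 - 2 * ln (q s)) = cst (ln 4) - cst 2 * (@ln R \o q).
  by apply/funext => s.
have H2 : is_derive (0 : R) (1 : R) (cst (ln 4) - cst 2 * (@ln R \o q))
   (0 - (2 *: ((q 0)^-1 * (2 * a * (x + 0 * a) + 2 * b * (y + 0 * b))) + (@ln R \o q) 0 *: 0)).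
  exact: (is_deriveB (is_derive_cst _ _ _) (is_deriveM (is_derive_cst _ _ _) H)).
rewrite (derive_val (is_derive := H2)) /GRing.scale /= mulr0.
have : q 0 != 0 by rewrite gt_eqF.
have -> : q 0 = 1 + (x ^+ 2 + y ^+ 2) by rewrite /q !mul0r !addr0 addrA.
by move=> q0; field.
Qed.

Lemma derive2_ln_potential :
  derive1 (fun s : R => - 4 * ((x + s * a) * a + (y + s * b) * b)
      / (1 + ((x + s * a) ^+ 2 + (y + s * b) ^+ 2))) 0
    = - 4 * (a ^+ 2 + b ^+ 2) / (1 + (x ^+ 2 + y ^+ 2))
      + 8 * (x * a + y * b) ^+ 2 / (1 + (x ^+ 2 + y ^+ 2)) ^+ 2.
Proof.
rewrite derive1E.
pose p : {poly R} := (- 4) *: (a *: (x%:P + a *: 'X) + b *: (y%:P + b *: 'X)).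
have -> : (fun s : R => - 4 * ((x + s * a) * a + (y + s * b) * b)
      / (1 + ((x + s * a) ^+ 2 + (y + s * b) ^+ 2))) = horner p * (fun s => (q s)^-1).
  apply/funext => s; rewrite /= /q addrA; congr (_ / _).
  by rewrite /p !(hornerD, hornerM, hornerZ, hornerX, hornerC); ring.
have dg : is_derive (0 : R) (1 : R) (horner p) (- 4 * (a ^+ 2 + b ^+ 2)).
  have -> : - 4 * (a ^+ 2 + b ^+ 2) = p^`().[0].
    rewrite /p !(derivD, derivM, derivZ, derivX, derivC).
    by rewrite !(hornerD, hornerM, hornerZ, hornerX, hornerC); ring.
  exact: is_derive_poly.
have p0 : p.[0] = - 4 * (x * a + y * b).
  by rewrite /p !(hornerD, hornerM, hornerZ, hornerX, hornerC); ring.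
have q0 : q 0 != 0 by rewrite gt_eqF.
have H := is_deriveM dg (is_deriveV q0 (dq 0)).
rewrite (derive_val (is_derive := H)) /GRing.scale /= p0.
move: q0; have -> : q 0 = 1 + (x ^+ 2 + y ^+ 2) by rewrite /q !mul0r !addr0 addrA.
by move=> q0; field.
Qed.

End RealDerivative.

(** * Metric and curvature of a normalized Pluecker curve *)

Section VeroneseCurvature.
Variable R : realType.
Local Notation C := R[i].
Variable m : nat.
Implicit Types (f : C -> gr R m) (P Q : pair_idx m -> {poly C}).

Local Notation deriv_ffun P := (horner_ffun (fun p => (P p)^`())).

Lemma hdot_horner P Q z w :
  hdot (horner_ffun P z) (horner_ffun Q w) = \sum_p (P p).[z] * ((Q p).[w])^*.
Proof. by apply: eq_bigr => p _; rewrite !ffunE. Qed.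

(** The second argument of the polarized norm is frozen in the constants [c p]; the norm itself is
    not holomorphic, its polarization is. *)
Lemma sum_deriv P (c : pair_idx m -> C) (g : C -> C) z d :
    (forall w, \sum_p (P p).[w] * c p = g w) -> hasd g z d ->
  \sum_p (P p)^`().[z] * c p = d.
Proof.
move=> gE gd; apply: hasd_unique gd.
have -> : g = fun w => \sum_p (P p).[w] * c p by apply/funext => w; rewrite gE.
apply: hasd_sum => p.
by have := hasdM (hasd_horner (P p) z) (hasd_cst (c p) z); rewrite mulr0 addr0.
Qed.

Lemma hasd_kernel (a z : C) n :
  hasd (fun w => (1 + w * a) ^+ n) z (n%:R * (1 + z * a) ^+ n.-1 * a).
Proof.
have := hasdX n (hasdD (hasd_cst 1 z) (hasdM (hasd_id z) (hasd_cst a z))).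
by rewrite mul1r mulr0 addr0 add0r.
Qed.

Lemma conj_kernel (z w : C) n : ((1 + z * w^*) ^+ n)^* = (1 + w * z^*) ^+ n.
Proof. by rewrite rmorphXn rmorphD rmorphM /= conjC1 conjCK mulrC. Qed.

Lemma conj_natMM (x y : C) n : (n%:R * x * y^*)^* = n%:R * x^* * y.
Proof. by rewrite rmorphM [in LHS]rmorphM /= conjC_nat conjCK. Qed.

Lemma veronese_norm P z w : veronese_poly P ->
  hdot (horner_ffun P z) (horner_ffun P w) = (1 + z * w^*) ^+ 4.
Proof. by move=> vP; rewrite hdot_horner vP. Qed.

Lemma veronese_deriv P z w : veronese_poly P ->
  hdot (deriv_ffun P z) (horner_ffun P w) = 4 * (1 + z * w^*) ^+ 3 * w^*.
Proof.
move=> vP; rewrite hdot_horner.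
exact: (sum_deriv (fun x => vP x w) (hasd_kernel w^* z 4)).
Qed.

Lemma veronese_deriv2 P z : veronese_poly P ->
  hdot (deriv_ffun P z) (deriv_ffun P z)
    = 12 * (1 + z * z^*) ^+ 2 * z * z^* + 4 * (1 + z * z^*) ^+ 3.
Proof.
move=> vP; rewrite hdot_horner.
have h w : \sum_p (P p).[w] * ((P p)^`().[z])^* = 4 * ((1 + w * z^*) ^+ 3 * w).
  rewrite -hdot_horner hdotC veronese_deriv // conj_natMM conj_kernel mulrA.
  by [].
have hd := hasdM (hasd_cst 4 z) (hasdM (hasd_kernel z^* z 3) (hasd_id z)).
by rewrite (sum_deriv h hd) /=; ring.
Qed.

Lemma conj_kernel_neq0 (z : C) : 1 + z * z^* != 0.
Proof. by rewrite gt_eqF // ltr_pwDl ?mul_conjC_ge0. Qed.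

Lemma fubini_study_veronese P z : veronese_poly P ->
  fubini_study (horner_ffun P z) (deriv_ffun P z) (deriv_ffun P z)
    = 4 / (1 + z * z^*) ^+ 2.
Proof.
move=> vP; rewrite /fubini_study [hdot (horner_ffun P z) (deriv_ffun P z)]hdotC.
rewrite veronese_deriv2 // veronese_deriv // veronese_norm //.
rewrite conj_natMM conj_kernel; have z0 := conj_kernel_neq0 z.
by field.
Qed.

Lemma veronese_nocz P z : veronese_poly P -> exists p, (P p).[z] != 0.
Proof.
move=> vP; apply/existsP; apply: contraT => /existsPn h.
have := vP z z; rewrite big1 => [/esym/eqP|p _].
  by rewrite expf_eq0 (negPf (conj_kernel_neq0 z)).
by rewrite (eqP (negPn (h p))) mul0r.
Qed.

Lemma potentialE (z : C) (r : R) :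
  r%:C%C / (1 + z * z^*) ^+ 2 = (r / (1 + complex.Re (z * z^*)) ^+ 2)%:C%C.
Proof.
have -> : z * z^* = (complex.Re (z * z^*))%:C%C by rewrite sqnormE.
by rewrite [RHS]rmorphM /= fmorphV rmorphXn rmorphD rmorph1.
Qed.

Lemma induced_veronese f P z F u v :
    plucker_spans f P -> veronese_poly P -> frame_near f z F ->
  Defs.induced F z u v
    = 4%:R / (1 + complex.Re (z * z^*)) ^+ 2 * complex.Re (u * v^*).
Proof.
move=> fP vP fF; rewrite (induced_plucker u v fP (veronese_nocz z vP) fF).
rewrite fubini_study_veronese // mulrC.
have -> : (4 : C) = (4 : R)%:C%C by rewrite rmorph_nat.
by rewrite potentialE Re_realM.
Qed.

(** The metric gives Calabi's equation only at conjugate arguments, and polarization extends it.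
    Dividing by the square root of the constant [k] then normalizes the curve. *)
Lemma veronese_of_metric f P :
    plucker_spans f P -> (forall z, exists p, (P p).[z] != 0) ->
    (forall z, exists2 F, frame_near f z F & forall u v,
       Defs.induced F z u v
         = 4%:R / (1 + complex.Re (z * z^*)) ^+ 2 * complex.Re (u * v^*)) ->
  exists2 Q, plucker_spans f Q & veronese_poly Q.
Proof.
move=> fP nocz metric.
have fs z : fubini_study (horner_ffun P z) (deriv_ffun P z) (deriv_ffun P z)
    = 4 / (1 + z * z^*) ^+ 2.
  have [F fF FE] := metric z.
  have -> : (4 : C) = (4 : R)%:C%C by rewrite rmorph_nat.
  rewrite potentialE; set k := 4 / _.
  have h u v := etrans (esym (induced_plucker u v fP (nocz z) fF)) (FE u v).
  (* [induced] is a real part; the pair of directions [i] and 1 shows that the imaginary part of the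
     form is 0. *)
  have h1 := h 1 1; have h2 := h (0 +i* 1)%C 1.
  move: h1 h2; rewrite conjC1 !mulr1 mul1r.
  rewrite -/k complexReM; case: (fubini_study _ _ _) => a b /= ->.
  by rewrite mul0r mulr0 mul1r sub0r => /eqP; rewrite oppr_eq0 => /eqP ->.
have [k k0 kE] : exists2 k : C, 0 < k &
    forall z w, \sum_p (P p).[z] * ((P p).[w])^* = k * (1 + z * w^*) ^+ 4.
  (* The index is 3 because the exponent is counted as [n.+1]: constant and exponent are both 4. *)
  apply: (@calabi_rigidity C _ P 3) => // z w.
  pose F z w : C := (1 + z * w) ^+ 2 *
     ((\sum_p (P p)^`().[z] * (map_poly Num.conj (P p))^`().[w]) *
      (\sum_p (P p).[z] * (map_poly Num.conj (P p)).[w]) -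
      (\sum_p (P p)^`().[z] * (map_poly Num.conj (P p)).[w]) *
      (\sum_p (P p).[z] * (map_poly Num.conj (P p))^`().[w]))
     + - (4 * (\sum_p (P p).[z] * (map_poly Num.conj (P p)).[w]) ^+ 2).
  have bF : bipoly F.
    have bS (p q : pair_idx m -> {poly C}) : bipoly (fun z w => \sum_i (p i).[z] * (q i).[w]).
      by apply: bipoly_sum => i; apply: bipoly_polyM.
    apply: bipolyD; last first.
      by apply/bipolyN/bipolyM; [apply: bipoly_cst | apply: bipolyX].
    apply: bipolyM.
      apply: bipolyX; apply: bipolyD; first exact: bipoly_cst.
      by apply: bipolyM; [apply: bipoly_fst | apply: bipoly_snd]; apply: polyfun_id.
    by apply: bipolyD; [|apply: bipolyN]; apply: bipolyM.
  apply/eqP; rewrite -subr_eq0; apply/eqP.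
  apply: (polarization bF) => {}z; rewrite /F.
  have cE (p q : pair_idx m -> {poly C}) :
      \sum_i (p i).[z] * (map_poly Num.conj (q i)).[z^*]
      = hdot (horner_ffun p z) (horner_ffun q z).
    by rewrite hdot_horner; apply: eq_bigr => i _; rewrite conj_horner conjCK.
  have cE' (p q : pair_idx m -> {poly C}) :
      \sum_i (p i).[z] * (map_poly Num.conj (q i))^`().[z^*]
      = hdot (horner_ffun p z) (deriv_ffun q z).
    rewrite hdot_horner; apply: eq_bigr => i _.
    by rewrite deriv_map conj_horner conjCK.
  rewrite !cE !cE'.
  have n0 : hdot (horner_ffun P z) (horner_ffun P z) != 0.
    have [p p0] := nocz z.
    by apply: contraNneq p0 => /hdot_eq0 /ffunP/(_ p); rewrite !ffunE => ->.
  have := fs z; rewrite /fubini_study => /eqP.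
  rewrite eqr_div ?expf_neq0 ?conj_kernel_neq0 // => /eqP E.
  apply/eqP; rewrite addr_eq0 opprK mulrC; apply/eqP; rewrite -E.
  by [].
have sk : sqrtC k * (sqrtC k)^* = k.
  by rewrite conj_Creal ?ger0_real ?sqrtC_ge0 ?ltW // -expr2 sqrtCK.
have sk0 : sqrtC k != 0 by rewrite sqrtC_eq0 gt_eqF.
exists (fun p => (sqrtC k)^-1 *: P p).
  move=> z V fV; have [c c0 cE] := fP z V fV; exists (c * sqrtC k); first exact: mulf_neq0.
  by move=> p; rewrite hornerZ cE mulrA mulfK.
move=> z w; apply: (mulfI (lt0r_neq0 k0)); rewrite -kE mulr_sumr; apply: eq_bigr => p _.
rewrite !hornerZ rmorphM fmorphV /= -{1}sk.
have sk1 : (sqrtC k)^* != 0 by rewrite conjC_eq0.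
by field; rewrite sk0 sk1.
Qed.

Lemma ddirR_ln_potential (z u : C) :
  ddirR (fun w : C => ln (4 / (1 + complex.Re (w * w^*)) ^+ 2)) u z
    = - 4 * (complex.Re z * complex.Re u + complex.Im z * complex.Im u)
        / (1 + (complex.Re z ^+ 2 + complex.Im z ^+ 2)).
Proof.
rewrite -derive_ln_potential /ddirR; congr (derive1 _ 0); apply/funext => s.
rewrite sqnormE; case: z => x y; case: u => a b /=.
by rewrite !mul0r subr0 addr0.
Qed.

Lemma ddirR2_ln_potential (z u : C) :
  ddirR (ddirR (fun w : C => ln (4 / (1 + complex.Re (w * w^*)) ^+ 2)) u) u z
    = - 4 * (complex.Re u ^+ 2 + complex.Im u ^+ 2)
        / (1 + (complex.Re z ^+ 2 + complex.Im z ^+ 2))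
      + 8 * (complex.Re z * complex.Re u + complex.Im z * complex.Im u) ^+ 2
        / (1 + (complex.Re z ^+ 2 + complex.Im z ^+ 2)) ^+ 2.
Proof.
rewrite -derive2_ln_potential {1}/ddirR; congr (derive1 _ 0); apply/funext => s.
rewrite ddirR_ln_potential; case: z => x y; case: u => a b /=.
by rewrite !mul0r subr0 addr0.
Qed.

Lemma gauss_veronese f P z F :
  plucker_spans f P -> veronese_poly P -> frame_near f z F -> gauss_curvature F z = 1.
Proof.
move=> fP vP fF.
pose H (w : C) : R := ln (4 / (1 + complex.Re (w * w^*)) ^+ 2).
(* A second derivative depends on the first one near [z], so the equality is needed around every
   nearby point; [near_join] provides it. *)
have lap (h : C -> R) u : (\forall w \near (z : C^o), h w = H w) ->
    ddirR (ddirR h u) u z = ddirR (ddirR H u) u z.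
  move=> hh; apply: ddirR_near; have := near_join hh; apply: filterS => w.
  exact: ddirR_near.
rewrite /gauss_curvature /laplacian (induced_veronese _ _ fP vP fF).
set h := fun w : C => ln _.
have hH : \forall w \near (z : C^o), h w = H w.
  have := near_join fF; apply: filterS => w fFw.
  by rewrite /h (induced_veronese _ _ fP vP fFw) conjC1 !mulr1.
move: h hH => h /lap lapH.
rewrite !lapH.
rewrite !ddirR2_ln_potential.
rewrite sqnormE.
rewrite conjC1 !mulr1.
set x := complex.Re z; set y := complex.Im z.
have r0 : 1 + (x ^+ 2 + y ^+ 2) != 0 by rewrite gt_eqF // ltr_pwDl ?addr_ge0 ?sqr_ge0.
have -> : complex.Re ('i : C) = 0 by rewrite -complexiE.
have -> : complex.Im ('i : C) = 1 by rewrite -complexiE.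
rewrite [complex.Re 1]/= [complex.Im 1]/= [complex.Re (_%:C)%C]/=.
by field.
Qed.

End VeroneseCurvature.

(** * Coefficients of the sphere in a centred coordinate *)

Section BaseData.
Variable R : realType.
Local Notation C := R[i].
Variable m : nat.
Implicit Types (f : C -> gr R m) (P : pair_idx m -> {poly C}) (A : nat -> 'M[C]_(2, m)).

Lemma horner_ffunE P z p : horner_ffun P z p = (P p).[z].
Proof. by rewrite ffunE. Qed.

Definition vcoef P k : {ffun pair_idx m -> C} := [ffun p => (P p)`_k].

Lemma veronese_poly_coef P k l : veronese_poly P ->
  hdot (vcoef P k) (vcoef P l) = (k == l)%:R * 'C(4, k)%:R.
Proof.
move=> vP; rewrite -(veronese_coef vP).
by apply: eq_bigr => p _; rewrite !ffunE.
Qed.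

Lemma veronese_size P p : veronese_poly P -> (size (P p) <= 5)%N.
Proof.
move=> vP; apply/leq_sizeP => k k5.
have := veronese_poly_coef k k vP; rewrite bin_small // mulr0.
by move=> /hdot_eq0 /ffunP/(_ p); rewrite !ffunE.
Qed.

Lemma pcurve_vcoef P z : veronese_poly P -> pcurve (vcoef P) z = horner_ffun P z.
Proof.
move=> vP; apply/ffunP => p; rewrite sum_ffunE ffunE.
rewrite (horner_coef_wide _ (veronese_size p vP)); apply: eq_bigr => k _.
by rewrite ffunZE ffunE mulrC.
Qed.

(** A Cauchy product: the coefficient of [z^k] in the Pluecker vector of [pcurve A], once [A k] is 0
    for [k >= 5]. *)
Definition wedge_coef A k : {ffun pair_idx m -> C} :=
  \sum_(i < k.+1) wedge (row 0 (A i)) (row 1 (A (k - i)%N)).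

Lemma pcurveE_mx A z i j : pcurve A z i j = \sum_(k < 5) z ^+ k * A k i j.
Proof. by rewrite summxE; apply: eq_bigr => k _; rewrite mxE. Qed.

Lemma wedge_coef_poly A : (forall k, (5 <= k)%N -> A k = 0) ->
  exists Q : pair_idx m -> {poly C},
    (forall z p, plucker (pcurve A z) p = (Q p).[z]) /\
    (forall k, vcoef Q k = wedge_coef A k).
Proof.
move=> A5; pose e i j : {poly C} := \poly_(k < 5) A k i j.
have eE i j z : (e i j).[z] = pcurve A z i j.
  by rewrite horner_poly pcurveE_mx; apply: eq_bigr => k _; rewrite mulrC.
have ec i j k : (e i j)`_k = A k i j.
  by rewrite coef_poly; case: ltnP => // /A5 ->; rewrite mxE.
exists (fun p => e 0 (val p).1 * e 1 (val p).2 - e 0 (val p).2 * e 1 (val p).1).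
split=> [z p|k]; first by rewrite !ffunE !mxE hornerD hornerN !hornerM !eE.
apply/ffunP => p; rewrite ffunE sum_ffunE coefB !coefM -sumrB.
by apply: eq_bigr => i _; rewrite !ffunE !mxE !ec.
Qed.

(* The coefficients of the affine frame [V0 + z A_1 + z^2 A_2 + ...] at the point
   with orthonormal basis [V0]; z is the coordinate centred at that point. *)
Definition base_coefs (V0 : 'M[C]_(2, m)) A :=
  [/\ V0 *m V0^t* = 1%:M, A 0%N = V0, forall k, (0 < k)%N -> A k *m V0^t* = 0,
      forall k, (5 <= k)%N -> A k = 0
    & forall k l, hdot (wedge_coef A k) (wedge_coef A l) = (k == l)%:R * 'C(4, k)%:R].

(** [h] is a denominator, at whose zeros [f] is not controlled. The Pluecker polynomials of the
    frame and of [P] agree up to the unit [c] off these zeros, hence everywhere. *)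
Lemma base_coefs_exist f P (h : C -> C) (V0 : 'M[C]_(2, m)) :
    veronese_poly P -> polyfun h -> h 0 != 0 ->
    (forall z, h z != 0 -> forall V, rowspan V = val (f z) ->
       exists2 c : C, c != 0 & forall p, plucker V p = c * (P p).[z]) ->
    V0 *m V0^t* = 1%:M -> rowspan V0 = val (f 0) ->
  exists2 A, base_coefs V0 A &
    forall z, h z != 0 -> val (f z) = rowspan (pcurve A z).
Proof.
move=> vP hpoly h0 sp V01 fV0.
have [||A [A0 AV fA [c c1 pA]]] := @base_frame R m f (vcoef P) (fun z => h z != 0) V0 _ h0 _ V01 fV0.
- by move=> k l _ _; apply: veronese_poly_coef.
- move=> z hz V fV; have [c c0 cE] := sp z hz V fV; exists c => //.
  by rewrite pcurve_vcoef //; apply/ffunP => p; rewrite ffunZE horner_ffunE cE.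
pose A' k := if (k < 5)%N then A k else 0.
have pA' z : pcurve A' z = pcurve A z by apply: eq_bigr => k _; rewrite /A' ltn_ord.
have A'5 k : (5 <= k)%N -> A' k = 0 by rewrite /A' leqNgt => /negPf ->.
exists A'; last by move=> z hz; rewrite pA' fA.
have [Q [QE Qc]] := wedge_coef_poly A'5.
have QP p : Q p = c *: P p.
  apply: poly_eq_fun.
  apply: (polyfun_eq_cofinite (polyfun_horner _) (polyfun_horner _) hpoly h0) => z hz.
  by rewrite -QE pA' pA // pcurve_vcoef // ffunZE horner_ffunE hornerZ.
have Wc k : wedge_coef A' k = c *: vcoef P k.
  by rewrite -Qc; apply/ffunP => p; rewrite ffunZE !ffunE QP coefZ.
split=> // [k k0|k l]; last first.
  by rewrite !Wc hdotZl hdotZr veronese_poly_coef // mulrA c1 mul1r.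
by rewrite /A'; case: ltnP => k5; [rewrite AV ?k0 | rewrite mul0mx].
Qed.

(** The rotation of the sphere that takes [z0] to 0. *)
Definition mobius (z0 z : C) := (z - z0) / (1 + z * z0^*).

Lemma conj_monomial (a b c d : C) i j :
  (a ^+ i * b ^+ j) * (c ^+ i * d ^+ j)^* = (b * d^*) ^+ j * (a * c^*) ^+ i.
Proof.
rewrite rmorphM [X in _ * (X * _)]rmorphXn [X in _ * (_ * X)]rmorphXn /= !exprMn.
by ring.
Qed.

(** Rotations of the sphere act unitarily on binary quartics. [Q] is [P] composed with the inverse
    rotation [mu], multiplied by the fourth power of the denominator and divided by [n0 ^+ 2]. *)
Lemma mobius_coefs f P (z0 : C) (V0 : 'M[C]_(2, m)) :
    plucker_spans f P -> veronese_poly P ->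
    V0 *m V0^t* = 1%:M -> rowspan V0 = val (f z0) ->
  exists2 A, base_coefs V0 A &
    forall z, 1 + z * z0^* != 0 -> val (f z) = rowspan (pcurve A (mobius z0 z)).
Proof.
move=> fP vP V01 fV0; have N0 := conj_kernel_neq0 z0.
pose n0 := 1 + z0 * z0^*; rewrite -/n0 in N0.
pose mu w := (w + z0) / (1 - z0^* * w).
pose Q p : {poly C} := n0^-1 ^+ 2 *:
  \sum_(k < 5) (P p)`_k *: (('X + z0%:P) ^+ k * (1 - z0^* *: 'X) ^+ (4 - k)).
have QE p w : (Q p).[w] = n0^-1 ^+ 2 *
   \sum_(k < 5) (P p)`_k * ((w + z0) ^+ k * (1 - z0^* * w) ^+ (4 - k)).
  rewrite hornerZ horner_sum; congr (_ * _); apply: eq_bigr => k _.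
  by rewrite hornerZ hornerM !horner_exp !hornerE.
have QmuE p w : 1 - z0^* * w != 0 -> (Q p).[w] = n0^-1 ^+ 2 * (1 - z0^* * w) ^+ 4 * (P p).[mu w].
  move=> w0; rewrite QE -mulrA; congr (_ * _).
  rewrite (horner_coef_wide _ (veronese_size p vP)) mulr_sumr; apply: eq_bigr => k _.
  have E : (1 - z0^* * w) ^+ 4 = (1 - z0^* * w) ^+ (4 - k) * (1 - z0^* * w) ^+ k.
    by rewrite -exprD subnK // -ltnS.
  have wk : (1 - z0^* * w) ^+ k != 0 by rewrite expf_neq0.
  rewrite E /mu expr_div_n; move: ((1 - _) ^+ k) wk ((1 - _) ^+ (4 - k)) => x x0 y.
  by field.
have n0r : n0^* = n0 by rewrite rmorphD rmorphM /= conjC1 conjCK mulrC.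
have vQ : veronese_poly Q.
  move=> z w.
  have -> : \sum_p (Q p).[z] * ((Q p).[w])^* = n0^-1 ^+ 4 *
      \sum_(k < 5) \sum_(l < 5) ((z + z0) ^+ k * (1 - z0^* * z) ^+ (4 - k)) *
         ((w + z0) ^+ l * (1 - z0^* * w) ^+ (4 - l))^* * hdot (vcoef P k) (vcoef P l).
    rewrite mulr_sumr.
    transitivity (\sum_p \sum_(k < 5) \sum_(l < 5) n0^-1 ^+ 4 *
       (((z + z0) ^+ k * (1 - z0^* * z) ^+ (4 - k)) *
         ((w + z0) ^+ l * (1 - z0^* * w) ^+ (4 - l))^* * ((P p)`_k * ((P p)`_l)^*))).
      apply: eq_bigr => p _; rewrite !QE rmorphM rmorphXn fmorphV /= n0r rmorph_sum /=.
      rewrite mulrACA -exprD big_distrlr /= mulr_sumr; apply: eq_bigr => k _.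
      rewrite mulr_sumr; apply: eq_bigr => l _; congr (_ * _).
      by rewrite [in LHS]rmorphM /= mulrACA mulrC.
    rewrite exchange_big; apply: eq_bigr => k _; rewrite exchange_big mulr_sumr.
    apply: eq_bigr => l _; rewrite mulr_sumr mulr_sumr; apply: eq_bigr => p _.
    by rewrite !ffunE.
  have -> : \sum_(k < 5) \sum_(l < 5) ((z + z0) ^+ k * (1 - z0^* * z) ^+ (4 - k)) *
         ((w + z0) ^+ l * (1 - z0^* * w) ^+ (4 - l))^* * hdot (vcoef P k) (vcoef P l)
      = ((1 - z0^* * z) * (1 - z0^* * w)^* + (z + z0) * (w + z0)^*) ^+ 4.
    rewrite exprDn; apply: eq_bigr => k _; rewrite (bigD1 k) //= big1 => [|l lk].
      rewrite addr0 veronese_poly_coef // eqxx mul1r -[RHS]mulr_natr; congr (_ * _).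
      exact: conj_monomial.
    have kl : (k == l :> nat) = false by rewrite eq_sym; apply: negPf lk.
    by rewrite veronese_poly_coef // kl mul0r mulr0.
  (* Invariance of the Hermitian form: the base on the left is [n0] times [1 + z * w^*], divided by
     [n0]. *)
  rewrite -exprMn; congr (_ ^+ 4); rewrite !rmorphD rmorphN rmorphM /= conjC1 conjCK.
  by rewrite /n0; field.
have D0 : 1 - z0^* * 0 != 0 by rewrite mulr0 subr0 oner_neq0.
have mu0 : mu 0 = z0 by rewrite /mu mulr0 subr0 add0r divr1.
have hp : polyfun (fun w => 1 - z0^* * w).
  by apply: polyfunD; [exact: polyfun_cst | apply/polyfunN/polyfunM; [exact: polyfun_cst | exact: polyfun_id]].
have [||A bA fA] := base_coefs_exist (f := f \o mu) vQ hp D0 _ V01.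
- move=> w w0 V fV; have [c c0 cE] := fP _ _ fV.
  exists (c * n0 ^+ 2 / (1 - z0^* * w) ^+ 4).
    by rewrite !mulf_neq0 ?invr_neq0 ?expf_neq0.
  by move=> p; rewrite cE QmuE //; field; rewrite w0 N0.
- by rewrite /= mu0.
exists A => // z zn; have zE : 1 - z0^* * mobius z0 z = n0 / (1 + z * z0^*).
  by rewrite /mobius /n0; field.
have w0 : 1 - z0^* * mobius z0 z != 0 by rewrite zE mulf_neq0 ?invr_neq0.
rewrite -fA //=; congr (val (f _)); rewrite /mu zE /mobius /n0.
by field; rewrite zn N0.
Qed.

End BaseData.
(** * The second fundamental form *)

Section MatrixProduct.
Variable R : realType.
Local Notation C := R[i].
Variable m : nat.
Implicit Types X Y Z V : 'M[C]_(2, m).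

(** The Hermitian trace form; at an orthonormal basis its real part is the metric, by
    [gmetric_onb]. *)
Definition mdot X Y : C := dot (row 0 X) (row 0 Y) + dot (row 1 X) (row 1 Y).

Lemma mdotDl X Y Z : mdot (X + Y) Z = mdot X Z + mdot Y Z.
Proof. by rewrite /mdot !linearD /= !dotDl addrACA. Qed.
Lemma mdotZl c X Y : mdot (c *: X) Y = c * mdot X Y.
Proof. by rewrite /mdot !linearZ /= !dotZl mulrDr. Qed.
Lemma mdotC X Y : mdot Y X = (mdot X Y)^*.
Proof. by rewrite /mdot rmorphD /= -!dotC. Qed.
Lemma mdotZr c X Y : mdot Y (c *: X) = c^* * mdot Y X.
Proof. by rewrite mdotC mdotZl rmorphM /= -!mdotC. Qed.
Lemma mdotNl X Y : mdot (- X) Y = - mdot X Y.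
Proof. by rewrite -scaleN1r mdotZl mulN1r. Qed.
Lemma mdot_eq0 X : complex.Re (mdot X X) = 0 -> X = 0.
Proof.
move=> h; have n0 : mdot X X = 0.
  have : 0 <= mdot X X by rewrite addr_ge0 ?dot_ge0.
  by move: h; case: (mdot X X) => x y /= ->; rewrite lecE /= => /andP[/eqP -> _].
have : (dot (row 0 X) (row 0 X) == 0) && (dot (row 1 X) (row 1 X) == 0).
  by rewrite -paddr_eq0 ?dot_ge0 // -/(mdot X X) n0.
move=> /andP[/eqP/dot_eq0 h0 /eqP/dot_eq0 h1].
by apply/row_matrixP => i; rewrite row0; case: (ord2P i) => ->.
Qed.

Lemma orth_rowsP X V : X *m V^t* = 0 <-> forall i j, dot (row i X) (row j V) = 0.
Proof.
split=> [h i j|h]; first by rewrite -mulmx_ctE h mxE.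
by apply/matrixP => i j; rewrite mulmx_ctE h mxE.
Qed.

Lemma onb_rowsP V : V *m V^t* = 1%:M -> forall i j, dot (row i V) (row j V) = (i == j)%:R.
Proof. by move=> h i j; rewrite -mulmx_ctE h mxE. Qed.

Lemma hdot_dplucker2 V X W Y : hdot (dplucker V X) (dplucker W Y) =
  dot (row 0 X) (row 0 Y) * dot (row 1 V) (row 1 W)
  - dot (row 0 X) (row 1 W) * dot (row 1 V) (row 0 Y)
  + (dot (row 0 X) (row 0 W) * dot (row 1 V) (row 1 Y)
  - dot (row 0 X) (row 1 Y) * dot (row 1 V) (row 0 W))
  + (dot (row 0 V) (row 0 Y) * dot (row 1 X) (row 1 W)
  - dot (row 0 V) (row 1 W) * dot (row 1 X) (row 0 Y)
  + (dot (row 0 V) (row 0 W) * dot (row 1 X) (row 1 Y)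
  - dot (row 0 V) (row 1 Y) * dot (row 1 X) (row 0 W))).
Proof. by rewrite /dplucker hdotDl !hdotDr !hdot_wedge. Qed.

Lemma hdot_dplucker V X W : hdot (dplucker V X) (plucker W) =
  dot (row 0 X) (row 0 W) * dot (row 1 V) (row 1 W)
  - dot (row 0 X) (row 1 W) * dot (row 1 V) (row 0 W)
  + (dot (row 0 V) (row 0 W) * dot (row 1 X) (row 1 W)
  - dot (row 0 V) (row 1 W) * dot (row 1 X) (row 0 W)).
Proof. by rewrite /dplucker hdotDl !hdot_wedge. Qed.

Lemma hdot_dplucker_r V X W : hdot (plucker W) (dplucker V X) =
  dot (row 0 W) (row 0 X) * dot (row 1 W) (row 1 V)
  - dot (row 0 W) (row 1 V) * dot (row 1 W) (row 0 X)
  + (dot (row 0 W) (row 0 V) * dot (row 1 W) (row 1 X)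
  - dot (row 0 W) (row 1 X) * dot (row 1 W) (row 0 V)).
Proof. by rewrite /dplucker hdotDr !hdot_wedge. Qed.

Lemma gmetric_onb V X Y : V *m V^t* = 1%:M -> X *m V^t* = 0 -> Y *m V^t* = 0 ->
  gmetric V X Y = complex.Re (mdot X Y).
Proof.
move=> /onb_rowsP V1 /orth_rowsP XV /orth_rowsP YV.
have VX i j : dot (row i V) (row j X) = 0 by rewrite dotC XV conjC0.
have VY i j : dot (row i V) (row j Y) = 0 by rewrite dotC YV conjC0.
rewrite /gmetric /fubini_study hdot_dplucker2 hdot_dplucker hdot_dplucker_r hdot_wedge.
rewrite ?V1 ?XV ?YV ?VX ?VY /= !(mulr0, mul0r, subr0, sub0r, mulr1, mul1r, addr0, oppr0).
by rewrite expr1n divr1 add0r.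
Qed.

Lemma derive1_even (g : R -> R) : (forall s, g (- s) = g s) -> derive1 g 0 = 0.
Proof.
move=> ge; rewrite /derive1; set q := fun h : R => _.
(* If the quotient diverges, its limit is the default value 0; otherwise the limit equals its own
   opposite. *)
have [cq|/dvgP -> //] := pselect (cvg (q h @[h --> (0 : R)^'])%classic).
have /cvg_ex[l ql] := cq; rewrite (cvg_lim _ ql) //.
have qN : (q h @[h --> (0 : R)^'] --> (- l : R^o))%classic.
  apply/(dnbhs0_eps (V := R^o)) => eps e0.
  have /(dnbhs0_eps (V := R^o) q l)/(_ _ e0)[del d0 dP] := ql.
  exists del => // t t0 td; have := dP (- t); rewrite oppr_eq0 normrN => /(_ t0 td).
  have -> : q (- t) = - q t by rewrite /q !addr0 ge invrN scaleNr.
  by rewrite opprK -[- l - q t]opprD normrN.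
have lN : l = - l := cvg_unique (@norm_hausdorff _ R^o) ql qN.
have l0 : (l : R) + l = 0 by rewrite {2}lN subrr.
by apply: (@mulIf R 2); rewrite ?pnatr_eq0 // mul0r mulr_natr mulr2n.
Qed.

(* Reflecting in the point [V] is an isometry fixing it, so at the centre of the
   chart the metric coefficients are even along every line. *)
Lemma dgmetric_onb V X Y Z : V *m V^t* = 1%:M ->
  X *m V^t* = 0 -> Y *m V^t* = 0 -> Z *m V^t* = 0 -> dgmetric V X Y Z = 0.
Proof.
move=> /onb_rowsP V1 /orth_rowsP XV /orth_rowsP YV /orth_rowsP ZV.
have VX i j : dot (row i V) (row j X) = 0 by rewrite dotC XV conjC0.
have VY i j : dot (row i V) (row j Y) = 0 by rewrite dotC YV conjC0.
have VZ i j : dot (row i V) (row j Z) = 0 by rewrite dotC ZV conjC0.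
apply: derive1_even => s; rewrite rmorphN scaleNr /gmetric.
have cs : (s%:C%C : C)^* = s%:C%C by rewrite conjE oppr0.
pose U (t : C) := V + t *: X.
have UU t i j : t^* = t -> dot (row i (U t)) (row j (U t)) = (i == j)%:R + t ^+ 2 * dot (row i X) (row j X).
  move=> tc; rewrite /U !linearD !linearZ /= !(dotDl, dotDr, dotZl, dotZr) tc V1 VX XV.
  by rewrite !mulr0 addr0 add0r mulrA expr2.
have UY t i j : dot (row i (U t)) (row j Y) = t * dot (row i X) (row j Y).
  by rewrite /U !linearD !linearZ /= !(dotDl, dotZl) VY add0r.
have UZ t i j : dot (row i (U t)) (row j Z) = t * dot (row i X) (row j Z).
  by rewrite /U !linearD !linearZ /= !(dotDl, dotZl) VZ add0r.
have YU t i j : t^* = t -> dot (row i Y) (row j (U t)) = t * dot (row i Y) (row j X).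
  by move=> tc; rewrite /U !linearD !linearZ /= !(dotDr, dotZr) YV add0r tc.
have ZU t i j : t^* = t -> dot (row i Z) (row j (U t)) = t * dot (row i Z) (row j X).
  by move=> tc; rewrite /U !linearD !linearZ /= !(dotDr, dotZr) ZV add0r tc.
have -> : V - s%:C%C *: X = U (- s%:C%C) by rewrite /U scaleNr.
rewrite -/(U s%:C%C); move: (s%:C%C) cs => t tc.
clearbody U.
have [n nE] : exists n, n = - t by exists (- t).
have ntc : n^* = n by rewrite nE rmorphN /= tc.
have n2 : n ^+ 2 = t ^+ 2 by rewrite nE sqrrN.
rewrite -nE.
have Epp : hdot (plucker (U n)) (plucker (U n)) = hdot (plucker (U t)) (plucker (U t)).
  by rewrite !hdot_wedge !(UU _ _ _ tc) !(UU _ _ _ ntc) n2.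
have Eyz : hdot (dplucker (U n) Y) (dplucker (U n) Z)
    = hdot (dplucker (U t) Y) (dplucker (U t) Z).
  rewrite !hdot_dplucker2 !(UU _ _ _ tc) !(UU _ _ _ ntc) !UZ.
  by rewrite !(YU _ _ _ tc) !(YU _ _ _ ntc); rewrite ?n2 nE; ring.
have Eyp : hdot (dplucker (U n) Y) (plucker (U n))
    = - hdot (dplucker (U t) Y) (plucker (U t)).
  rewrite !hdot_dplucker !(UU _ _ _ tc) !(UU _ _ _ ntc) n2.
  by rewrite !(YU _ _ _ tc) !(YU _ _ _ ntc); rewrite ?n2 nE; ring.
have Epz : hdot (plucker (U n)) (dplucker (U n) Z)
    = - hdot (plucker (U t)) (dplucker (U t) Z).
  rewrite !hdot_dplucker_r !(UU _ _ _ tc) !(UU _ _ _ ntc) !UZ n2 nE.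
  by ring.
by rewrite /fubini_study Epp Eyz Eyp Epz mulrNN.
Qed.

End MatrixProduct.

(** * Scalar products of the frame coefficients *)

Section BaseDots.
Variable R : realType.
Local Notation C := R[i].
Variable m : nat.
Implicit Types A : nat -> 'M[C]_(2, m).

(* The part of [wedge_coef A k.+1] orthogonal to the base point. *)
Definition Dw A k : {ffun pair_idx m -> C} :=
  \sum_(i < k) wedge (row 0 (A i.+1)) (row 1 (A (k - i)%N)).

Lemma wedge_coefS A k : wedge_coef A k.+1 =
  wedge (row 0 (A 0%N)) (row 1 (A k.+1)) +
  (Dw A k + wedge (row 0 (A k.+1)) (row 1 (A 0%N))).
Proof.
rewrite /wedge_coef big_ord_recl subn0; congr (_ + _).
rewrite big_ord_recr /= subnn; congr (_ + _).
Qed.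

Lemma hdot_sumr (I : finType) n (F : 'I_n -> {ffun I -> C}) p :
  hdot p (\sum_i F i) = \sum_i hdot p (F i).
Proof. by rewrite hdotC hdot_suml rmorph_sum; apply: eq_bigr => i _; rewrite [RHS]hdotC. Qed.

Lemma base_orth V0 A i j k : base_coefs V0 A -> (0 < k)%N ->
  dot (row i (A k)) (row j V0) = 0.
Proof. by move=> [_ _ AV _ _] k0; apply: ((orth_rowsP _ _).1 (AV k k0)). Qed.

Lemma base_orthC V0 A i j k : base_coefs V0 A -> (0 < k)%N ->
  dot (row j V0) (row i (A k)) = 0.
Proof. by move=> bA k0; apply/dotC0/base_orth. Qed.

Lemma hdot_Dw_base V0 A i x k : base_coefs V0 A -> hdot (wedge (row i V0) x) (Dw A k) = 0.
Proof.
move=> bA; rewrite hdot_sumr big1 // => j _; rewrite hdot_wedge.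
by rewrite !(base_orthC _ _ bA) // ?subn_gt0 // !mul0r subrr.
Qed.

Lemma hdot_three (I : finType) (x y z x' y' z' : {ffun I -> C}) :
    hdot x y' = 0 -> hdot x z' = 0 -> hdot y x' = 0 -> hdot y z' = 0 ->
    hdot z x' = 0 -> hdot z y' = 0 ->
  hdot (x + (y + z)) (x' + (y' + z')) = hdot x x' + hdot y y' + hdot z z'.
Proof.
by move=> *; rewrite !(hdotDl, hdotDr); do !(match goal with H : hdot _ _ = 0 |- _ => rewrite H; clear H end);
  rewrite !(addr0, add0r) addrA.
Qed.

(** [wedge_coef A k.+1] has three parts, two of which involve a row of [V0], and the parts of
    different kind are orthogonal because the higher rows are orthogonal to [V0]. Thus the
    orthogonality of the Pluecker coefficients becomes a system for the rows. Beware of the shift: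
    [Dw A k] has degree [k.+1]. *)
Lemma base_dot V0 A k l : base_coefs V0 A ->
  dot (row 0 (A k.+1)) (row 0 (A l.+1)) + dot (row 1 (A k.+1)) (row 1 (A l.+1))
  + hdot (Dw A k) (Dw A l) = (k == l)%:R * 'C(4, k.+1)%:R.
Proof.
move=> bA; have [V1 A0 _ _ /(_ k.+1 l.+1)] := bA.
rewrite eqSS !wedge_coefS A0 => <-.
have V1' := onb_rowsP V1.
have sw p (x : 'rV[C]_m) i j : hdot (wedge x (row i V0)) (Dw A j) = 0 /\ p = p :> nat.
  by split=> //; rewrite wedgeC hdotNl (hdot_Dw_base _ _ _ bA) oppr0.
have o i j q : dot (row i (A q.+1)) (row j V0) = 0 by apply: base_orth bA _.
have o' i j q : dot (row j V0) (row i (A q.+1)) = 0 by apply: base_orthC bA _.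
have V01 : dot (row 0 V0) (row 1 V0) = 0 by rewrite V1'.
have V10 : dot (row 1 V0) (row 0 V0) = 0 by rewrite V1'.
have e0 : dot (row 0 V0) (row 0 V0) = 1 by rewrite V1'.
have e1 : dot (row 1 V0) (row 1 V0) = 1 by rewrite V1'.
rewrite hdot_three.
- by rewrite !hdot_wedge ?e0 ?e1 ?o ?o'; ring.
- exact: hdot_Dw_base bA.
- by rewrite hdot_wedge o' V01 !mul0r subrr.
- by rewrite hdotC (hdot_Dw_base _ _ _ bA) conjC0.
- by rewrite hdotC (sw 0%N _ _ _).1 conjC0.
- by rewrite hdot_wedge o V10 mul0r mulr0 subrr.
- exact: (sw 0%N _ _ _).1.
Qed.

End BaseDots.

(** * The second-order jet of the sphere, and S *)

Section SecondFundamentalForm.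
Variable R : realType.
Local Notation C := R[i].
Variable m : nat.
Implicit Types (f : C -> gr R m) (A : nat -> 'M[C]_(2, m)) (F : C -> 'M[C]_(2, m)).

Definition dmobius (z0 z : C) := (1 + z0 * z0^*) / (1 + z * z0^*) ^+ 2.

Lemma hasd_den (z0 z : C) : hasd (fun w => 1 + w * z0^*) z z0^*.
Proof.
have := hasdD (hasd_cst 1 z) (hasdM (hasd_id z) (hasd_cst z0^* z)).
by rewrite mul1r mulr0 addr0 add0r.
Qed.

Lemma hasd_mobius (z0 z : C) : 1 + z * z0^* != 0 -> hasd (mobius z0) z (dmobius z0 z).
Proof.
move=> z1; have := hasdM (hasdB (hasd_id z) (hasd_cst z0 z)) (hasdV (h := fun w => 1 + w * z0^*) z1 (hasd_den z0 z)).
by congr hasd; rewrite /dmobius; field.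
Qed.

Lemma mobius_id (z0 : C) : mobius z0 z0 = 0.
Proof. by rewrite /mobius subrr mul0r. Qed.

Lemma dmobius_id (z0 : C) : dmobius z0 z0 = (1 + z0 * z0^*)^-1.
Proof. by rewrite /dmobius; have z1 := conj_kernel_neq0 z0; field. Qed.

Definition dcurve A (w : C) : 'M[C]_(2, m) :=
  A 1%N + (2 * w) *: A 2%N + (3 * w ^+ 2) *: A 3%N + (4 * w ^+ 3) *: A 4%N.

Lemma hasdM2_pcurve A (h : C -> C) z d :
  hasd h z d -> hasdM2 (fun w => pcurve A (h w)) z (d *: dcurve A (h z)).
Proof.
move=> hd i j; have -> : (fun w => pcurve A (h w) i j) = (fun w => \sum_(k < 5) h w ^+ k * A k i j).
  by apply/funext => w; rewrite pcurveE_mx.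
have := hasd_sum (fun k : 'I_5 => hasdM (hasdX k hd) (hasd_cst (A k i j) z)).
congr hasd; rewrite !big_ord_recr big_ord0 !mxE /=; ring.
Qed.

Lemma hasdM2_dcurve A (h g : C -> C) z d e : hasd h z d -> h z = 0 -> hasd g z e ->
  hasdM2 (fun w => g w *: dcurve A (h w)) z (e *: A 1%N + (2 * g z * d) *: A 2%N).
Proof.
move=> hd h0 gd i j.
have -> : (fun w => (g w *: dcurve A (h w)) i j) = (fun w => g w *
    (A 1%N i j + 2 * h w * A 2%N i j + 3 * h w ^+ 2 * A 3%N i j + 4 * h w ^+ 3 * A 4%N i j)).
  by apply/funext => w; rewrite !mxE.
have hc c := hasd_cst c z.
have := hasdM gd (hasdD (hasdD (hasdD (hc (A 1%N i j)) (hasdM (hasdM (hc 2) hd) (hc (A 2%N i j))))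
  (hasdM (hasdM (hc 3) (hasdX 2 hd)) (hc (A 3%N i j)))) (hasdM (hasdM (hc 4) (hasdX 3 hd)) (hc (A 4%N i j)))).
by congr hasd; rewrite !mxE h0 /=; ring.
Qed.

Variables (f : C -> gr R m) (z0 : C) (V0 : 'M[C]_(2, m)) (A : nat -> 'M[C]_(2, m)).
Hypothesis bA : base_coefs V0 A.
Hypothesis fA : forall z, 1 + z * z0^* != 0 -> val (f z) = rowspan (pcurve A (mobius z0 z)).

Let B z := pcurve A (mobius z0 z).
Let r := (1 + z0 * z0^*)^-1.

Lemma near_chart : \forall z \near (z0 : C^o), 1 + z * z0^* != 0.
Proof. exact: hasd_near_neq0 (hasd_den z0 z0) (conj_kernel_neq0 z0). Qed.

Lemma base_orth_mul w : pcurve A w *m V0^t* = 1%:M.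
Proof.
have [V1 A0 AV _ _] := bA.
by rewrite pcurveE !mulmxDl -!scalemxAl A0 V1 !AV // !scaler0 !addr0.
Qed.

Lemma base_chart_frame : chart_frame f z0 B.
Proof.
have [V1 A0 _ _ _] := bA.
split; last first.
  apply: filterS near_chart => z _; rewrite {2}/B mobius_id pcurve0 A0; exact: base_orth_mul.
apply: filterS near_chart => z z1; split; first exact: fA.
by move=> i j; apply: hasd_cdiff (hasdM2_pcurve A (hasd_mobius z1) i j).
Qed.

Lemma base_frame_at : B z0 = V0.
Proof. by have [_ A0 _ _ _] := bA; rewrite /B mobius_id pcurve0. Qed.

(** A plane has at most one basis [V] with [V *m V0^t* = 1]. *)
Lemma chart_frame_base F : chart_frame f z0 F -> F z0 = V0 ->
  \forall z \near (z0 : C^o), B z = F z.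
Proof.
move=> [fF FV] F0; apply: filterS3 near_chart fF FV => z z1 [fz _].
rewrite F0 => Fz; have /rowspan_sub[g gE] : (rowspan (F z) <= rowspan (B z))%VS.
  by rewrite -fz fA.
by move: Fz; rewrite gE -mulmxA base_orth_mul mulmx1 => ->; rewrite mul1mx.
Qed.

(** [r] is the derivative of [mobius z0] at [z0]. The coefficient [c] stays unspecified: [A 1] is
    tangent and drops out of the normal part. *)
Lemma chart_frame_jet F : chart_frame f z0 F -> F z0 = V0 ->
  (forall u, ddir F u z0 = (u * r) *: A 1%N) /\
  exists c, forall u v, ddir (ddir F v) u z0 = (u * v) *: (c *: A 1%N + (2 * r ^+ 2) *: A 2%N).
Proof.
move=> cF F0; have BF := chart_frame_base cF F0.
have FD : \forall z \near (z0 : C^o), hasdM2 F z (dmobius z0 z *: dcurve A (mobius z0 z)).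
  apply: filterS2 near_chart (near_join BF) => z z1 BFz.
  exact: hasdM2_near BFz (hasdM2_pcurve A (hasd_mobius z1)).
split=> [u|].
  have := nbhs_singleton FD => /(hasdM2_ddir u) ->.
  by rewrite scalerA dmobius_id mobius_id /dcurve !expr0n /= !mulr0 !scale0r !addr0.
have z1 := conj_kernel_neq0 z0.
have [e de] : exists e, hasd (dmobius z0) z0 e.
  eexists; apply: hasdM (hasd_cst _ _) (hasdV _ (hasdX 2 (hasd_den z0 z0))).
  by rewrite expf_neq0.
exists e => u v.
have := hasdM2_dcurve A (hasd_mobius z1) (mobius_id z0) de.
rewrite dmobius_id -/r -mulrA -expr2 => H.
exact: ddir2 FD H.
Qed.

Let V1 : V0 *m V0^t* = 1%:M. Proof. by have [] := bA. Qed.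
Let AV k : (0 < k)%N -> A k *m V0^t* = 0. Proof. by have [_ _ h _ _] := bA; apply: h. Qed.

Let rr : r^* = r.
Proof. by rewrite /r fmorphV rmorphD rmorphM /= conjC1 conjCK mulrC. Qed.
Let r0 : r != 0. Proof. by rewrite invr_neq0 // conj_kernel_neq0. Qed.

Let conj_scale u v : (2 * (u * v) * r ^+ 2)^* = 2 * (u^* * v^*) * r ^+ 2.
Proof.
have conjCM (a b : C) : (a * b)^* = a^* * b^* by exact: rmorphM.
have r2 : (r ^+ 2)^* = r ^+ 2 by rewrite rmorphXn /= rr.
by rewrite conjCM r2 conjCM (conjCM u) conjC_nat.
Qed.

Lemma base_norm1 : mdot (A 1%N) (A 1%N) = 4.
Proof.
by have := base_dot 0 0 bA; rewrite /Dw big_ord0 hdot0l addr0 mul1r bin1.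
Qed.

Lemma base_norm21 : mdot (A 2%N) (A 1%N) = 0.
Proof. by have := base_dot 1 0 bA; rewrite {2}/Dw big_ord0 hdot0r addr0 mul0r. Qed.

(** [Dw A 1] is [a_1 /\ b_1], and 6 is the middle binomial coefficient of the fourth power: this is
    the source of the relation between S and [tau]. *)
Lemma base_norm2 : mdot (A 2%N) (A 2%N)
  = 6 - hdot (wedge (row 0 (A 1%N)) (row 1 (A 1%N))) (wedge (row 0 (A 1%N)) (row 1 (A 1%N))).
Proof.
have := base_dot 1 1 bA; rewrite /Dw !big_ord1 mul1r => E.
by rewrite -[LHS](addrK (hdot (wedge (row 0 (A 1%N)) (row 1 (A 1%N))) (wedge (row 0 (A 1%N)) (row 1 (A 1%N))))) E.
Qed.

(** The tangent plane is a complex line, so real orthogonality to all its vectors is Hermitian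
    orthogonality to [A 1]. *)
Lemma normal_base F X : chart_frame f z0 F -> F z0 = V0 ->
  normal_vector F z0 X <-> X *m V0^t* = 0 /\ mdot X (A 1%N) = 0.
Proof.
move=> cF F0; have [jet _] := chart_frame_jet cF F0.
have A1t w : (w *: A 1%N) *m V0^t* = 0 by rewrite -scalemxAl AV // scaler0.
rewrite /normal_vector /chart_tangent F0; split=> [[XV h]|[XV h]]; split=> //; last first.
  by move=> w; rewrite jet gmetric_onb // mdotZr h mulr0.
have h' c : complex.Re (c * mdot X (A 1%N)) = 0.
  have := h (c^* / r); rewrite jet gmetric_onb // divfK // mdotZr conjCK.
  by [].
by move: (mdot X (A 1%N)) (h' 1) (h' (0 -i* 1)%C) => [x y]; rewrite /= !mul1r !mul0r subr0 sub0r mulN1r opprK => -> ->.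
Qed.

(** The Christoffel terms vanish at the centre by [dgmetric_onb], which leaves the normal part of
    the second derivative. It is unique because the difference of two candidates is normal and
    orthogonal to itself. *)
Lemma is_sff_base F u v b : chart_frame f z0 F -> F z0 = V0 ->
  is_sff F z0 u v b <-> b = (2 * (u * v) * r ^+ 2) *: A 2%N.
Proof.
move=> cF F0; have [jet [c jet2]] := chart_frame_jet cF F0.
have A2n w : normal_vector F z0 (w *: A 2%N).
  by apply/(normal_base _ cF F0); rewrite -scalemxAl AV // scaler0 mdotZl base_norm21 mulr0.
have hess X : normal_vector F z0 X ->
    hessian F z0 u v X = gmetric (F z0) ((2 * (u * v) * r ^+ 2) *: A 2%N) X.
  move=> /(normal_base X cF F0)[XV XA].
  have A1t w : (w *: A 1%N) *m V0^t* = 0 by rewrite -scalemxAl AV // scaler0.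
  have A2t w : (w *: A 2%N) *m V0^t* = 0 by rewrite -scalemxAl AV // scaler0.
  rewrite /hessian /christoffel !jet jet2 F0 !dgmetric_onb // addr0 subrr mul0r addr0.
  rewrite !gmetric_onb //; last by rewrite -scalemxAl mulmxDl A1t A2t addr0 scaler0.
  rewrite !(mdotZl, mdotDl) [mdot (A 1%N) X]mdotC XA conjC0 mulr0 add0r.
  by congr (complex.Re _); ring.
split=> [[bn bX]|->]; last by split=> // X /hess.
have [bV bA1] := (normal_base b cF F0).1 bn.
set b0 := _ *: A 2%N in hess *.
have [b0V b0A1] := (normal_base b0 cF F0).1 (A2n _).
have dn : normal_vector F z0 (b - b0).
  apply/(normal_base _ cF F0); rewrite mulmxBl bV b0V subrr mdotDl mdotNl bA1 b0A1.
  by rewrite subrr.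
apply/eqP; rewrite -subr_eq0; apply/eqP/mdot_eq0.
have dV : (b - b0) *m V0^t* = 0 by rewrite mulmxBl bV b0V subrr.
have := bX _ dn; rewrite (hess _ dn) F0 !gmetric_onb // => E.
by rewrite mdotDl mdotNl raddfB /= E subrr.
Qed.

(** Each of the four terms is [4 |e_i|^2 |e_j|^2 r^4 |A 2|^2], and a unit vector satisfies
    [4 r^2 |e|^2 = 1]; so each term is a quarter of [|A 2|^2]. *)
Lemma sff_sqnorm_base F s : chart_frame f z0 F -> F z0 = V0 ->
  (exists (e : 'I_2 -> C) (B : 'I_2 -> 'I_2 -> 'M[C]_(2, m)),
    [/\ forall i j, Defs.induced F z0 (e i) (e j) = (i == j)%:R,
        forall i j, is_sff F z0 (e i) (e j) (B i j)
      & s = \sum_i \sum_j gmetric (F z0) (B i j) (B i j)]) <->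
  s%:C%C = mdot (A 2%N) (A 2%N).
Proof.
move=> cF F0; have [jet _] := chart_frame_jet cF F0.
have A1t w : (w *: A 1%N) *m V0^t* = 0 by rewrite -scalemxAl AV // scaler0.
have A2t w : (w *: A 2%N) *m V0^t* = 0 by rewrite -scalemxAl AV // scaler0.
have indE u v : Defs.induced F z0 u v = complex.Re (u * v^* * (4 * r ^+ 2)).
  rewrite /Defs.induced !jet F0 gmetric_onb // mdotZl mdotZr base_norm1 rmorphM /= rr.
  by congr (complex.Re _); ring.
have r4 : 4 * r ^+ 2 = (complex.Re (4 * r ^+ 2))%:C%C.
  have : (4 * r ^+ 2)^* = 4 * r ^+ 2 by rewrite rmorphM rmorphXn /= rr conjC_nat.
  move: (4 * r ^+ 2) => -[x y]; rewrite conjE => -[] /eqP.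
  by rewrite eq_sym -subr_eq0 opprK -mulr2n mulrn_eq0 /= => /eqP ->.
have r40 : 4 * r ^+ 2 != 0 by rewrite mulf_neq0 ?pnatr_eq0 ?expf_neq0.
have A22 : mdot (A 2%N) (A 2%N) = (complex.Re (mdot (A 2%N) (A 2%N)))%:C%C.
  have := dot_conj (row 0 (A 2%N)); have := dot_conj (row 1 (A 2%N)) => h1 h0.
  have : (mdot (A 2%N) (A 2%N))^* = mdot (A 2%N) (A 2%N) by rewrite /mdot rmorphD /= h0 h1.
  move: (mdot _ _) => -[x y]; rewrite conjE => -[] /eqP.
  by rewrite eq_sym -subr_eq0 opprK -mulr2n mulrn_eq0 /= => /eqP ->.
have sumE (e : 'I_2 -> C) : (forall i, e i * (e i)^* * (4 * r ^+ 2) = 1) ->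
    \sum_i \sum_j gmetric (F z0) ((2 * (e i * e j) * r ^+ 2) *: A 2%N)
       ((2 * (e i * e j) * r ^+ 2) *: A 2%N) = complex.Re (mdot (A 2%N) (A 2%N)).
  move=> ee.
  have gE i j : gmetric (F z0) ((2 * (e i * e j) * r ^+ 2) *: A 2%N)
       ((2 * (e i * e j) * r ^+ 2) *: A 2%N) = complex.Re (mdot (A 2%N) (A 2%N)) / 4.
    rewrite F0 gmetric_onb // mdotZl mdotZr.
    have -> : 2 * (e i * e j) * r ^+ 2 * ((2 * (e i * e j) * r ^+ 2)^* * mdot (A 2%N) (A 2%N))
       = (e i * (e i)^* * (4 * r ^+ 2)) * (e j * (e j)^* * (4 * r ^+ 2)) / 4 * mdot (A 2%N) (A 2%N).
      by rewrite conj_scale; field.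
    rewrite !ee mul1r mul1r A22.
    have -> : (4 : C)^-1 = (4^-1 : R)%:C%C by rewrite fmorphV rmorph_nat.
    by rewrite Re_realM /= mulrC.
  under eq_bigr => i _ do under eq_bigr => j _ do rewrite gE.
  by rewrite !big_ord_recr !big_ord0 /=; field.
split=> [[e [N [ee NE ->]]]|sE].
  have ee1 i : e i * (e i)^* * (4 * r ^+ 2) = 1.
    have := ee i i; rewrite indE eqxx sqnormE r4 -rmorphM /= => ->.
    by rewrite rmorph1.
  rewrite [RHS]A22 -(sumE e ee1); congr (_%:C%C); apply: eq_bigr => i _; apply: eq_bigr => j _.
  by rewrite ((is_sff_base _ _ _ cF F0).1 (NE i j)).
(* The induced metric at [z0] has density [4 r^2], so [q] and [i q] are orthonormal. *)
pose q := (2 * r)^-1.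
have qq : q * q^* * (4 * r ^+ 2) = 1.
  by rewrite /q fmorphV rmorphM /= rr conjC_nat; field.
exists (fun i => if i == 0 then q else (0 +i* 1)%C * q).
exists (fun i j => (2 * ((if i == 0 then q else (0 +i* 1)%C * q) *
   (if j == 0 then q else (0 +i* 1)%C * q)) * r ^+ 2) *: A 2%N).
have iic : (0 +i* 1)%C^* = - (0 +i* 1)%C :> C by rewrite conjE; apply/eqP; rewrite eq_complex /= oppr0 !eqxx.
have ii : (0 +i* 1)%C * (0 +i* 1)%C = -1 :> C.
  by apply/eqP; rewrite eq_complex /= !mul0r mul1r mulr0 sub0r addr0 oppr0 !eqxx.
have qi : ((0 +i* 1)%C * q)^* = - (0 +i* 1)%C * q^* by rewrite rmorphM /= iic.
have qE : q * q^* = (4 * r ^+ 2)^-1 by apply: (mulIf r40); rewrite qq mulVf.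
split.
- move=> i j; rewrite indE.
  case: (ord2P i) => ->; case: (ord2P j) => -> /=; rewrite ?qi.
  + by rewrite qq.
  + have -> : q * (- (0 +i* 1)%C * q^*) * (4 * r ^+ 2)
       = - (0 +i* 1)%C * (q * q^* * (4 * r ^+ 2)) by ring.
    by rewrite qq mulr1 /= oppr0.
  + have -> : (0 +i* 1)%C * q * q^* * (4 * r ^+ 2)
       = (0 +i* 1)%C * (q * q^* * (4 * r ^+ 2)) by ring.
    by rewrite qq mulr1.
  + have -> : (0 +i* 1)%C * q * (- (0 +i* 1)%C * q^*) * (4 * r ^+ 2)
       = - ((0 +i* 1)%C * (0 +i* 1)%C) * (q * q^* * (4 * r ^+ 2)) by ring.
    by rewrite ii qq opprK mulr1.
- by move=> i j; apply/is_sff_base.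
rewrite sumE; first by rewrite -sE.
move=> i; case: (ord2P i) => -> /=; first exact: qq.
have -> : (0 +i* 1)%C * q * ((0 +i* 1)%C * q)^* * (4 * r ^+ 2)
       = - ((0 +i* 1)%C * (0 +i* 1)%C) * (q * q^* * (4 * r ^+ 2)) by rewrite qi; ring.
by rewrite ii qq opprK mulr1.
Qed.

End SecondFundamentalForm.
(** * Gram determinants of the frame and its derivative *)

Section FrameChange.
Variable R : realType.
Local Notation C := R[i].
Variable m : nat.
Implicit Types (f : C -> gr R m) (A : nat -> 'M[C]_(2, m)) (F G : C -> 'M[C]_(2, m)).

Lemma hasd_mulmx_cst F z (D : 'M[C]_(2, m)) (X : 'M[C]_(m, 2)) i j :
  hasdM2 F z D -> hasd (fun w => (F w *m X) i j) z ((D *m X) i j).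
Proof.
move=> FD; have -> : (fun w => (F w *m X) i j) = (fun w => \sum_l F w i l * X l j).
  by apply/funext => w; rewrite mxE.
have := hasd_sum (fun l => hasdM (FD i l) (hasd_cst (X l j) z)).
by congr hasd; rewrite mxE; apply: eq_bigr => l _; rewrite mulr0 addr0.
Qed.

(** As [G] is normalized by [V0], the transition matrix is [F w *m V0^t*], which is holomorphic with
    an explicit derivative. *)
Lemma frame_change F G z (D E V0 : 'M[C]_(2, m)) :
    hasdM2 F z D -> hasdM2 G z E ->
    (\forall w \near (z : C^o), rowspan (F w) = rowspan (G w) /\ G w *m V0^t* = 1%:M) ->
  F z = F z *m V0^t* *m G z /\ D = D *m V0^t* *m G z + F z *m V0^t* *m E.
Proof.
move=> FD GE FG.
have FgG : \forall w \near (z : C^o), F w *m V0^t* *m G w = F w.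
  apply: filterS FG => w [FwGw GV].
  have /rowspan_sub[g ->] : (rowspan (F w) <= rowspan (G w))%VS by rewrite FwGw.
  by rewrite -(mulmxA g) GV mulmx1.
split; first by rewrite (nbhs_singleton FgG).
apply/matrixP => i j; apply: hasd_unique (FD i j) _.
apply: (hasd_near (h := fun w => \sum_k (F w *m V0^t*) i k * G w k j)).
  by apply: filterS FgG => w wE; rewrite -[in RHS]wE mxE.
have := hasd_sum (fun k => hasdM (hasd_mulmx_cst (V0^t*) i k FD) (GE k j)).
by congr hasd; rewrite !mxE -big_split.
Qed.

Lemma col_mx_frame (g L : 'M[C]_2) (V W : 'M[C]_(2, m)) :
  col_mx (g *m V) (L *m V + g *m W) = block_mx g 0 L g *m col_mx V W.
Proof. by rewrite mul_block_col mul0mx addr0. Qed.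

(** Sesquilinear in two independent frames, so that the Gram determinant can be polarized. *)
Definition gram4 (V W V' W' : 'M[C]_(2, m)) : C :=
  \det (col_mx V W *m (col_mx V' W')^t*).

(** Frame and derivative change together by a block triangular matrix with both diagonal blocks
    equal to [g]. *)
Lemma gram4_frame (g L : 'M[C]_2) (V W : 'M[C]_(2, m)) :
  gram4 (g *m V) (L *m V + g *m W) (g *m V) (L *m V + g *m W)
   = (\det g * (\det g)^*) ^+ 2 * gram4 V W V W.
Proof.
rewrite /gram4 col_mx_frame ctM mulmxA -(mulmxA (block_mx _ _ _ _)) !det_mulmx.
rewrite det_ct det_lblock rmorphM /=; ring.
Qed.

(** The rows of [A 1] are the derivatives of the basis modulo the plane, so up to the scale of the
    coordinate this is [|a13 a24 - a14 a23|^2]. *)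
Definition tau A := hdot (wedge (row 0 (A 1%N)) (row 1 (A 1%N))) (wedge (row 0 (A 1%N)) (row 1 (A 1%N))).

Lemma tauE A : tau A = \det (A 1%N *m (A 1%N)^t*).
Proof. exact: hdot_plucker. Qed.

Lemma gram4_base (V0 : 'M[C]_(2, m)) A (r : C) : base_coefs V0 A ->
  gram4 V0 (r *: A 1%N) V0 (r *: A 1%N) = (r * r^*) ^+ 2 * tau A.
Proof.
move=> bA; have [V1 _ AV _ _] := bA.
have VA : V0 *m (A 1%N)^t* = 0 by rewrite -[LHS]ctK ctM ctK AV // trmx0 map_mx0.
rewrite /gram4 tr_col_mx map_row_mx mul_col_row V1.
have ctZ : (r *: A 1%N)^t* = r^* *: (A 1%N)^t* by rewrite linearZ map_mxZ.
rewrite ctZ -!scalemxAl -!scalemxAr AV // VA !scaler0 det_ublock det1 mul1r.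
by rewrite scalerA detZ tauE.
Qed.

(** A relation between the rows of [A 1] is a relation between the rows of every 4 x 4 minor, and a
    change of frame only multiplies the minors by a determinant. *)
Lemma wedge4_eq0_base (V0 : 'M[C]_(2, m)) A (r : C) (g L : 'M[C]_2) :
  tau A = 0 -> wedge4_eq0 (g *m V0) (L *m V0 + g *m (r *: A 1%N)).
Proof.
move=> /hdot_eq0 w0 s; rewrite col_mx_frame.
have -> : colsub s (block_mx g 0 L g *m col_mx V0 (r *: A 1%N))
    = block_mx g 0 L g *m colsub s (col_mx V0 (r *: A 1%N)).
  by apply/matrixP => i j; rewrite !mxE; apply: eq_bigr => k _; rewrite !mxE.
rewrite det_mulmx; apply/eqP; rewrite mulf_eq0; apply/orP; right.
have [c c0 cA] : exists2 c : 'rV[C]_2, c != 0 & c *m A 1%N = 0.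
  have cE (c : 'rV[C]_2) : c *m A 1%N = c 0 0 *: row 0 (A 1%N) + c 0 1 *: row 1 (A 1%N).
    by rewrite -[LHS](row_id 0) row_mulmx2.
  have [a0|a0] := eqVneq (row 0 (A 1%N)) 0.
    exists (delta_mx 0 0); last by rewrite cE a0 !mxE /= scaler0 scale0r add0r.
    by apply/eqP => /matrixP/(_ 0 0); rewrite !mxE /= => /eqP; rewrite oner_eq0.
  have [k kE] := wedge_eq0_collinear a0 w0.
  exists (\row_j if j == 0 then - k else 1).
    by apply/eqP => /matrixP/(_ 0 1); rewrite !mxE /= => /eqP; rewrite oner_eq0.
  by rewrite cE kE !mxE /= scaleNr scale1r addNr.
apply/det0P; exists (row_mx 0 c).
  by apply: contra_neq c0 => /(congr1 rsubmx); rewrite row_mxKr linear0.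
have -> : row_mx (0 : 'rV_2) c *m colsub s (col_mx V0 (r *: A 1%N))
    = colsub s (row_mx (0 : 'rV_2) c *m col_mx V0 (r *: A 1%N)).
  by apply/matrixP => i j; rewrite !mxE; apply: eq_bigr => k _; rewrite !mxE.
rewrite mul_row_col mul0mx add0r -scalemxAr cA scaler0.
by apply/matrixP => i j; rewrite !mxE.
Qed.

Lemma reducible_base f z0 (V0 : 'M[C]_(2, m)) A : base_coefs V0 A ->
    (forall z, 1 + z * z0^* != 0 -> val (f z) = rowspan (pcurve A (mobius z0 z))) ->
  tau A = 0 -> reducible_at f z0.
Proof.
move=> bA fA t0 F fF; have [fz FD] := frame_hasd_at fF.
have BD := hasdM2_pcurve A (hasd_mobius (conj_kernel_neq0 z0)).
have FB : \forall w \near (z0 : C^o), rowspan (F w) = rowspan (pcurve A (mobius z0 w)) /\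
    pcurve A (mobius z0 w) *m V0^t* = 1%:M.
  apply: filterS2 (near_chart z0) fF => w w1 [fw _].
  by rewrite -fA // fw; split=> //; apply: base_orth_mul bA _.
have [F0 DE] := frame_change FD BD FB.
have Dz : dmobius z0 z0 *: dcurve A (mobius z0 z0) = (1 + z0 * z0^*)^-1 *: A 1%N.
  by rewrite dmobius_id mobius_id /dcurve !expr0n /= !mulr0 !scale0r !addr0.
rewrite (base_frame_at z0 bA) in F0 DE.
have := wedge4_eq0_base V0 (1 + z0 * z0^*)^-1 (F z0 *m V0^t*) (cderiv F z0 *m V0^t*) t0.
by rewrite -F0 -Dz -DE.
Qed.

Lemma plucker_pcurve_norm (V0 : 'M[C]_(2, m)) A z w : base_coefs V0 A ->
  hdot (plucker (pcurve A z)) (plucker (pcurve A w)) = (1 + z * w^*) ^+ 4.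
Proof.
move=> [_ _ _ A5 AA]; have [Q [QE Qc]] := wedge_coef_poly A5.
have pQ x : plucker (pcurve A x) = horner_ffun Q x.
  by apply/ffunP => p; rewrite QE horner_ffunE.
have sQ p : (size (Q p) <= 5)%N.
  apply/leq_sizeP => k k5; have := AA k k; rewrite -Qc bin_small // mulr0.
  by move=> /hdot_eq0 /ffunP/(_ p); rewrite !ffunE.
have cQ x : horner_ffun Q x = pcurve (vcoef Q) x.
  apply/ffunP => p; rewrite sum_ffunE horner_ffunE (horner_coef_wide _ (sQ p)).
  by apply: eq_bigr => k _; rewrite ffunZE ffunE mulrC.
by rewrite !pQ !cQ hdot_pcurve // => k l _ _; rewrite !Qc AA.
Qed.

(* This recovers [tau] at an arbitrary point [z0] from the coefficients at [0]. *)
Lemma gram4_centre f z0 (V0 V1 : 'M[C]_(2, m)) A A' :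
    base_coefs V0 A -> (forall z, val (f z) = rowspan (pcurve A z)) ->
    base_coefs V1 A' ->
    (forall z, 1 + z * z0^* != 0 -> val (f z) = rowspan (pcurve A' (mobius z0 z))) ->
  gram4 (pcurve A z0) (dcurve A z0) (pcurve A z0) (dcurve A z0)
    = tau A' * (1 + z0 * z0^*) ^+ 4.
Proof.
move=> bA fA bA' fA'.
have FD := hasdM2_pcurve A (hasd_id z0); rewrite scale1r in FD.
have BD := hasdM2_pcurve A' (hasd_mobius (conj_kernel_neq0 z0)).
have FB : \forall w \near (z0 : C^o), rowspan (pcurve A w) = rowspan (pcurve A' (mobius z0 w)) /\
    pcurve A' (mobius z0 w) *m V1^t* = 1%:M.
  apply: filterS (near_chart z0) => w w1.
  by rewrite -fA' // -fA; split=> //; apply: base_orth_mul bA' _.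
have [F0 DE] := frame_change FD BD FB.
have Dz : dmobius z0 z0 *: dcurve A' (mobius z0 z0) = (1 + z0 * z0^*)^-1 *: A' 1%N.
  by rewrite dmobius_id mobius_id /dcurve !expr0n /= !mulr0 !scale0r !addr0.
rewrite (base_frame_at z0 bA') in F0 DE; rewrite Dz in DE.
have z1 := conj_kernel_neq0 z0.
have gg : \det (pcurve A z0 *m V1^t*) * (\det (pcurve A z0 *m V1^t*))^* = (1 + z0 * z0^*) ^+ 4.
  have := plucker_pcurve_norm z0 z0 bA.
  have -> : plucker (pcurve A z0) = \det (pcurve A z0 *m V1^t*) *: plucker V1.
    by rewrite -plucker_mul -F0.
  rewrite hdotZl hdotZr hdot_plucker.
  by have [-> _ _ _ _] := bA'; rewrite det1 mulr1.
(* The change of frame contributes the power 8 of [1 + |z0|^2]; the scale of [A' 1] will contribute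
   the power -4. *)
have -> : gram4 (pcurve A z0) (dcurve A z0) (pcurve A z0) (dcurve A z0)
    = ((1 + z0 * z0^*) ^+ 4) ^+ 2 * gram4 V1 ((1 + z0 * z0^*)^-1 *: A' 1%N)
        V1 ((1 + z0 * z0^*)^-1 *: A' 1%N).
  rewrite -gg -(gram4_frame _ (dcurve A z0 *m V1^t*)) -F0 -DE.
  by [].
rewrite (gram4_base _ bA').
have -> : ((1 + z0 * z0^*)^-1)^* = (1 + z0 * z0^*)^-1.
  by rewrite fmorphV rmorphD rmorphM /= conjC1 conjCK mulrC.
by move: (tau A') => t; field.
Qed.

End FrameChange.

(** * Determinants of order 3 and 4 *)

Section Determinants.
Variable S : comPzRingType.
Implicit Types a b c d e f g h i j k l n o p q : S.

Definition det3 a b c d e f g h i :=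
  a * (e * i - f * h) - b * (d * i - f * g) + c * (d * h - e * g).

Definition det4 a b c d e f g h i j k l n o p q :=
  a * det3 f g h j k l o p q - b * det3 e g h i k l n p q
  + c * det3 e f h i j l n o q - d * det3 e f g i j k n o p.

Lemma det3E a b c d e f g h i :
  \det (\matrix_(u < 3, v < 3) nth 0 (nth [::]
    [:: [:: a; b; c]; [:: d; e; f]; [:: g; h; i]] u) v) = det3 a b c d e f g h i.
Proof.
rewrite (expand_det_row _ 0) !big_ord_recl big_ord0 /cofactor !det2E !mxE /=.
by rewrite /bump /= /det3; ring.
Qed.

Lemma det4E a b c d e f g h i j k l n o p q :
  \det (\matrix_(u < 4, v < 4) nth 0 (nth [::]
    [:: [:: a; b; c; d]; [:: e; f; g; h]; [:: i; j; k; l]; [:: n; o; p; q]] u) v)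
  = det4 a b c d e f g h i j k l n o p q.
Proof.
rewrite (expand_det_row _ 0) !big_ord_recl big_ord0 /cofactor !mxE /=.
pose M3 (x : seq (seq S)) : 'M[S]_3 := \matrix_(u < 3, v < 3) nth 0 (nth [::] x u) v.
have E (M : 'M[S]_3) x : (forall u v, M u v = nth 0 (nth [::] x u) v) -> \det M = \det (M3 x).
  by move=> h0; congr (\det _); apply/matrixP => u v; rewrite h0 mxE.
rewrite (E (@row' _ 4 3 _ (@col' _ 4 4 _ _)) [:: [:: f; g; h]; [:: j; k; l]; [:: o; p; q]]); last first.
  by case=> [[|[|[|//]]] ?]; case=> [[|[|[|//]]] ?]; rewrite !mxE.
rewrite (E (@row' _ 4 3 _ (@col' _ 4 4 _ _)) [:: [:: e; g; h]; [:: i; k; l]; [:: n; p; q]]); last first.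
  by case=> [[|[|[|//]]] ?]; case=> [[|[|[|//]]] ?]; rewrite !mxE.
rewrite (E (@row' _ 4 3 _ (@col' _ 4 4 _ _)) [:: [:: e; f; h]; [:: i; j; l]; [:: n; o; q]]); last first.
  by case=> [[|[|[|//]]] ?]; case=> [[|[|[|//]]] ?]; rewrite !mxE.
rewrite (E (@row' _ 4 3 _ (@col' _ 4 4 _ _)) [:: [:: e; f; g]; [:: i; j; k]; [:: n; o; p]]); last first.
  by case=> [[|[|[|//]]] ?]; case=> [[|[|[|//]]] ?]; rewrite !mxE.
rewrite /M3 !det3E /bump /= /det4; ring.
Qed.

(* Row operations: the first two rows minus [x] times the last two are [1 0 0 0] and
   [0 1 0 0] up to terms of order [x^2]. *)
Lemma det4_row_op x a b c d e f g h i j k l n o p q :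
  det4 (1 + (x * i - x ^+ 2 * a)) (x * j - x ^+ 2 * b) (x * k - x ^+ 2 * c) (x * l - x ^+ 2 * d)
       (x * n - x ^+ 2 * e) (1 + (x * o - x ^+ 2 * f)) (x * p - x ^+ 2 * g) (x * q - x ^+ 2 * h)
       i j k l n o p q
  = k * q - l * p + x ^+ 2 * (- (det3 a c d i k l n p q) - det3 f g h j k l o p q
      + x ^+ 2 * det4 a b c d e f g h i j k l n o p q).
Proof. rewrite /det4 /det3; ring. Qed.

End Determinants.

(** * Polarizing the Gram determinant *)

Section Gram.
Variable R : realType.
Local Notation C := R[i].
Variable m : nat.

Lemma bipoly_prod (K : numFieldType) (I : finType) (F : I -> K -> K -> K) :
  (forall i, bipoly (F i)) -> bipoly (fun z w => \prod_i F i z w).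
Proof.
move=> hF a b c d; have /choice[p pE] i := hF i a b c d.
by exists (\prod_i p i) => s; rewrite horner_prod; apply: eq_bigr.
Qed.

Lemma bipoly_det (K : numFieldType) n (M : K -> K -> 'M[K]_n) :
  (forall i j, bipoly (fun z w => M z w i j)) -> bipoly (fun z w => \det (M z w)).
Proof.
move=> hM; apply: bipoly_sum => s; apply: bipolyM; first exact: bipoly_cst.
by apply: bipoly_prod => i.
Qed.

Lemma polyfun_conj (K : numClosedFieldType) (f : K -> K) :
  polyfun f -> polyfun (fun w => (f w^*)^*).
Proof.
by move=> [p pE]; exists (map_poly Num.conj p) => w; rewrite conj_horner pE.
Qed.

Lemma polyfun_pcurve (A : nat -> 'M[C]_(2, m)) i j : polyfun (fun z => pcurve A z i j).
Proof.
have [p pE] : polyfun (fun z => \sum_(k < 5) z ^+ k * A k i j).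
  apply: polyfun_sum => k; apply: polyfunM; last exact: polyfun_cst.
  by apply: polyfunX; apply: polyfun_id.
by exists p => z; rewrite pcurveE_mx pE.
Qed.

Lemma polyfun_dcurve (A : nat -> 'M[C]_(2, m)) i j : polyfun (fun z => dcurve A z i j).
Proof.
exists ((A 1%N i j)%:P + (2 * A 2%N i j) *: 'X + (3 * A 3%N i j) *: 'X^2 + (4 * A 4%N i j) *: 'X^3).
move=> z; rewrite !mxE !(hornerD, hornerZ, hornerC, hornerX, hornerXn).
by ring.
Qed.

(** In [F] the second frame is taken at the conjugate of [w], which makes the conjugated entries
    polynomial in [w]. *)
Lemma gram4_polarized (A : nat -> 'M[C]_(2, m)) t :
    (forall z, gram4 (pcurve A z) (dcurve A z) (pcurve A z) (dcurve A z)
       = t * (1 + z * z^*) ^+ 4) ->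
  forall z w, gram4 (pcurve A z) (dcurve A z) (pcurve A w) (dcurve A w)
       = t * (1 + z * w^*) ^+ 4.
Proof.
move=> h z w; apply/eqP; rewrite -subr_eq0; apply/eqP.
pose F z w := gram4 (pcurve A z) (dcurve A z) (pcurve A w^*) (dcurve A w^*)
   + - (t * (1 + z * w) ^+ 4).
have hF : bipoly F.
  apply: bipolyD; last first.
    apply/bipolyN/bipolyM; first exact: bipoly_cst.
    apply: bipolyX; apply: bipolyD; first exact: bipoly_cst.
    by apply: bipolyM; [apply: bipoly_fst | apply: bipoly_snd]; apply: polyfun_id.
  apply: bipoly_det => i j.
  have E (x y : C) : (col_mx (pcurve A x) (dcurve A x) *m
      (col_mx (pcurve A y^*) (dcurve A y^*))^t*) i j =
    \sum_l col_mx (pcurve A x) (dcurve A x) i l * (col_mx (pcurve A y^*) (dcurve A y^*) j l)^*.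
    by rewrite mxE; apply: eq_bigr => l _; rewrite !mxE.
  have hc k l : polyfun (fun x => col_mx (pcurve A x) (dcurve A x) k l).
    case: (split_ordP k) => k' ->.
      have [p pE] := polyfun_pcurve A k' l; exists p => x; rewrite col_mxEu; exact: pE.
    have [p pE] := polyfun_dcurve A k' l; exists p => x; rewrite col_mxEd; exact: pE.
  have B : bipoly (fun x y => \sum_l col_mx (pcurve A x) (dcurve A x) i l *
       (col_mx (pcurve A y^*) (dcurve A y^*) j l)^*).
    apply: bipoly_sum => l; apply: bipolyM; first exact/bipoly_fst/hc.
    by apply: bipoly_snd; apply: (polyfun_conj (hc j l)).
  by move=> a b c d; have [p pE] := B a b c d; exists p => s; rewrite E pE.
have F0 x : F x x^* = 0 by rewrite /F conjCK h subrr.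
by have := polarization hF F0 z w^*; rewrite /F conjCK.
Qed.

Lemma gram4E (V W V' W' : 'M[C]_(2, m)) : gram4 V W V' W' =
  det4 (dot (row 0 V) (row 0 V')) (dot (row 0 V) (row 1 V'))
       (dot (row 0 V) (row 0 W')) (dot (row 0 V) (row 1 W'))
       (dot (row 1 V) (row 0 V')) (dot (row 1 V) (row 1 V'))
       (dot (row 1 V) (row 0 W')) (dot (row 1 V) (row 1 W'))
       (dot (row 0 W) (row 0 V')) (dot (row 0 W) (row 1 V'))
       (dot (row 0 W) (row 0 W')) (dot (row 0 W) (row 1 W'))
       (dot (row 1 W) (row 0 V')) (dot (row 1 W) (row 1 V'))
       (dot (row 1 W) (row 0 W')) (dot (row 1 W) (row 1 W')).
Proof.
rewrite -det4E /gram4; congr (\det _).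
have rE (X Y : 'M[C]_(2, m)) (i : 'I_(2 + 2)) :
    row i (col_mx X Y) = nth 0 [:: row 0 X; row 1 X; row 0 Y; row 1 Y] i.
  case: (split_ordP i) => k ->.
    by rewrite rowKu; case: (ord2P k) => ->.
  by rewrite rowKd; case: (ord2P k) => ->.
apply/matrixP => i j; rewrite mulmx_ctE !rE [RHS]mxE.
by case: i => [[|[|[|[|//]]]] ?]; case: j => [[|[|[|[|//]]]] ?].
Qed.

End Gram.

(** * Low-order terms of the Gram determinant *)

Section OsculatingGram.
Variable R : realType.
Local Notation C := R[i].
Variable m : nat.
Variables (V0 : 'M[C]_(2, m)) (A : nat -> 'M[C]_(2, m)) (t : C).
Hypothesis bA : base_coefs V0 A.
Hypothesis tr : t^* = t.
Hypothesis gram : forall z w, gram4 (pcurve A z) (dcurve A z) (pcurve A w) (dcurve A w)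
  = t * (1 + z * w^*) ^+ 4.

Let a (k : nat) := row 0 (A k).
Let b (k : nat) := row 1 (A k).
Let a_ k : row 0 (A k) = a k. Proof. by []. Qed.
Let b_ k : row 1 (A k) = b k. Proof. by []. Qed.

(** Chosen for [pcurve_tcurve]: subtracting [z] times the derivative leaves the frame constant up to
    order 2, which is the row operation of [det4_row_op]. *)
Let tcurve (z : C) : 'M[C]_(2, m) := A 2%N + (2 * z) *: A 3%N + (3 * z ^+ 2) *: A 4%N.

Let pcurve_tcurve z : pcurve A z = V0 + z *: dcurve A z - z ^+ 2 *: tcurve z.
Proof.
have [_ A0 _ _ _] := bA.
apply/matrixP => i j; rewrite pcurveE_mx !big_ord_recr big_ord0 /= !mxE A0; ring.
Qed.

Let orthD i j z : dot (row i V0) (row j (dcurve A z)) = 0.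
Proof.
rewrite /dcurve !linearD !linearZ /= !(dotDr, dotZr).
by rewrite !(base_orthC _ _ bA) // !mulr0 !addr0.
Qed.

Let orthV i j z : dot (row i V0) (row j (pcurve A z)) = (i == j)%:R.
Proof.
have [/onb_rowsP V1 _ _ _ _] := bA.
rewrite pcurve_tcurve linearB linearD !linearZ /= !(dotDr, dotNr, dotZr) V1 orthD.
rewrite /tcurve !linearD !linearZ /= !(dotDr, dotZr) !(base_orthC _ _ bA) //.
by rewrite !(mulr0, addr0, oppr0).
Qed.

Let dot_pcurve i z y : dot (row i (pcurve A z)) y =
  dot (row i V0) y + (z * dot (row i (dcurve A z)) y - z ^+ 2 * dot (row i (tcurve z)) y).
Proof.
by rewrite pcurve_tcurve linearB linearD !linearZ /= !(dotDl, dotNl, dotZl) addrA.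
Qed.

Let polyfun_dotD i y : polyfun (fun z => dot (row i (dcurve A z)) y).
Proof.
apply: polyfun_sum => j; apply: polyfunM; last exact: polyfun_cst.
by have [p pE] := polyfun_dcurve A i j; exists p => z; rewrite mxE pE.
Qed.

Let polyfun_dotT i y : polyfun (fun z => dot (row i (tcurve z)) y).
Proof.
exists ((dot (row i (A 2%N)) y)%:P + (2 * dot (row i (A 3%N)) y) *: 'X
   + (3 * dot (row i (A 4%N)) y) *: 'X^2) => z.
rewrite /tcurve !linearD !linearZ /= !(dotDl, dotZl).
by rewrite !(hornerD, hornerZ, hornerC, hornerX, hornerXn); ring.
Qed.

Let hdot_dcurve X z (h := fun i j => hdot (wedge (a i) (b j)) X) :
  hdot (plucker (dcurve A z)) X =
    h 1%N 1%N + (2 * (h 1%N 2%N + h 2%N 1%N)) * z + (3 * h 1%N 3%N + 4 * h 2%N 2%N + 3 * h 3%N 1%N) * z ^+ 2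
    + (4 * h 1%N 4%N + 6 * h 2%N 3%N + 6 * h 3%N 2%N + 4 * h 4%N 1%N) * z ^+ 3
    + (8 * h 2%N 4%N + 9 * h 3%N 3%N + 8 * h 4%N 2%N) * z ^+ 4
    + (12 * (h 3%N 4%N + h 4%N 3%N)) * z ^+ 5 + 16 * h 4%N 4%N * z ^+ 6.
Proof.
rewrite /plucker /dcurve !linearD !linearZ /= !a_ !b_.
have lin (u1 u2 u3 u4 x : 'rV[C]_m) c2 c3 c4 :
    hdot (wedge (u1 + c2 *: u2 + c3 *: u3 + c4 *: u4) x) X =
    hdot (wedge u1 x) X + c2 * hdot (wedge u2 x) X + c3 * hdot (wedge u3 x) X
     + c4 * hdot (wedge u4 x) X.
  by rewrite !wedgeDl !wedgeZl !hdotDl !hdotZl.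
have linr (u1 u2 u3 u4 x : 'rV[C]_m) c2 c3 c4 :
    hdot (wedge x (u1 + c2 *: u2 + c3 *: u3 + c4 *: u4)) X =
    hdot (wedge x u1) X + c2 * hdot (wedge x u2) X + c3 * hdot (wedge x u3) X
     + c4 * hdot (wedge x u4) X.
  by rewrite !wedgeDr !wedgeZr !hdotDl !hdotZl.
rewrite lin !linr -/(h 1%N 1%N) -/(h 1%N 2%N) -/(h 1%N 3%N) -/(h 1%N 4%N).
rewrite -/(h 2%N 1%N) -/(h 2%N 2%N) -/(h 2%N 3%N) -/(h 2%N 4%N) -/(h 3%N 1%N) -/(h 3%N 2%N) -/(h 3%N 3%N) -/(h 3%N 4%N).
rewrite -/(h 4%N 1%N) -/(h 4%N 2%N) -/(h 4%N 3%N) -/(h 4%N 4%N); clearbody h; ring.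
Qed.

(** After the row operation the 4 x 4 determinant is the 2 x 2 Gram determinant of the derivatives
    plus [z^2 H z]. For every [w], the terms of order 0 and 1 in [z] therefore come from the 2 x 2
    determinant alone. *)
Let jets w :
  hdot (wedge (a 1%N) (b 1%N)) (plucker (dcurve A w)) = t /\
  2 * (hdot (wedge (a 1%N) (b 2%N)) (plucker (dcurve A w))
       + hdot (wedge (a 2%N) (b 1%N)) (plucker (dcurve A w))) = 4 * t * w^*.
Proof.
set X := plucker (dcurve A w).
pose T i j k z := dot (row i (tcurve z)) (row j (if k : bool then pcurve A w else dcurve A w)).
pose D i j k z := dot (row i (dcurve A z)) (row j (if k : bool then pcurve A w else dcurve A w)).
pose H z := - det3 (T 0 0 true z) (T 0 0 false z) (T 0 1 false z)
                   (D 0 0 true z) (D 0 0 false z) (D 0 1 false z)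
                   (D 1 0 true z) (D 1 0 false z) (D 1 1 false z)
            - det3 (T 1 1 true z) (T 1 0 false z) (T 1 1 false z)
                   (D 0 1 true z) (D 0 0 false z) (D 0 1 false z)
                   (D 1 1 true z) (D 1 0 false z) (D 1 1 false z)
            + z ^+ 2 * det4 (T 0 0 true z) (T 0 1 true z) (T 0 0 false z) (T 0 1 false z)
                   (T 1 0 true z) (T 1 1 true z) (T 1 0 false z) (T 1 1 false z)
                   (D 0 0 true z) (D 0 1 true z) (D 0 0 false z) (D 0 1 false z)
                   (D 1 0 true z) (D 1 1 true z) (D 1 0 false z) (D 1 1 false z).
have Hp : polyfun H.
  have Tp i j k : polyfun (T i j k) by apply: polyfun_dotT.
  have Dp i j k : polyfun (D i j k) by apply: polyfun_dotD.
  clearbody T D; rewrite /H /det4 /det3.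
  by do ?[exact: Tp | exact: Dp | exact: polyfun_id | apply: polyfunD | apply: polyfunN
         | apply: polyfunM | apply: polyfunX ].
have HE z : hdot (plucker (dcurve A z)) X + z ^+ 2 * H z = t * (1 + z * w^*) ^+ 4.
  rewrite -gram gram4E !(dot_pcurve _ z) !orthV !orthD /= !add0r det4_row_op.
  by rewrite /X /plucker hdot_wedge.
clearbody H.
pose h i j := hdot (wedge (a i) (b j)) X.
have hX := hdot_dcurve X.
(* All the terms of order at least 2, from both sides, divided by [z^2]. *)
pose K z := (3 * h 1%N 3%N + 4 * h 2%N 2%N + 3 * h 3%N 1%N)
    + (4 * h 1%N 4%N + 6 * h 2%N 3%N + 6 * h 3%N 2%N + 4 * h 4%N 1%N) * z
    + (8 * h 2%N 4%N + 9 * h 3%N 3%N + 8 * h 4%N 2%N) * z ^+ 2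
    + (12 * (h 3%N 4%N + h 4%N 3%N)) * z ^+ 3 + 16 * h 4%N 4%N * z ^+ 4 + H z
    - t * (6 * w^* ^+ 2 + 4 * w^* ^+ 3 * z + w^* ^+ 4 * z ^+ 2).
have Kp : polyfun K.
  by do ?[exact: polyfun_cst | exact: polyfun_id | exact: Hp | apply: polyfunD
         | apply: polyfunN | apply: polyfunM | apply: polyfunX].
apply: (poly_mod2_coef Kp) => z.
have := HE z; rewrite hX -/(h 1%N 1%N) -/(h 1%N 2%N) -/(h 2%N 1%N) -/(h 1%N 3%N) -/(h 2%N 2%N) -/(h 3%N 1%N).
rewrite -/(h 1%N 4%N) -/(h 2%N 3%N) -/(h 3%N 2%N) -/(h 4%N 1%N) -/(h 2%N 4%N) -/(h 3%N 3%N) -/(h 4%N 2%N).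
rewrite -/(h 3%N 4%N) -/(h 4%N 3%N) -/(h 4%N 4%N) /K => E.
clearbody h; apply/eqP; rewrite -subr_eq0; apply/eqP.
rewrite -[RHS](subrr (t * (1 + z * w^*) ^+ 4)) -{1}E; ring.
Qed.

Let coef7 (c0 c1 c2 c3 c4 c5 c6 d0 d1 : C) :
    (forall w, c0 + c1 * w + c2 * w ^+ 2 + c3 * w ^+ 3 + c4 * w ^+ 4 + c5 * w ^+ 5 + c6 * w ^+ 6
       = d0 + d1 * w) ->
  [/\ c0 = d0, c1 = d1, c2 = 0 & c4 = 0].
Proof.
move=> h; pose c k := nth 0 [:: c0; c1; c2; c3; c4; c5; c6] k.
pose d k := nth 0 [:: d0; d1] k.
have E : forall s : C, \sum_(k < 7) c k * s ^+ k = \sum_(k < 7) d k * s ^+ k.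
  move=> s; rewrite !big_ord_recr !big_ord0 /c /d /= !mul0r.
  by rewrite expr0 !mulr1 expr1 add0r h; ring.
by split; [apply: (poly_sum_coef E (k := 0)) | apply: (poly_sum_coef E (k := 1)) |
  apply: (poly_sum_coef E (k := 2)) | apply: (poly_sum_coef E (k := 4))].
Qed.

Let D2 := wedge (a 1%N) (b 1%N).
Let D3 := wedge (a 1%N) (b 2%N) + wedge (a 2%N) (b 1%N).
Let q2 := 3 *: wedge (a 1%N) (b 3%N) + 4 *: wedge (a 2%N) (b 2%N) + 3 *: wedge (a 3%N) (b 1%N).
Let q4 := 8 *: wedge (a 2%N) (b 4%N) + 9 *: wedge (a 3%N) (b 3%N) + 8 *: wedge (a 4%N) (b 2%N).

Let hdot3 (k1 k2 k3 : C) (p q r X : {ffun pair_idx m -> C}) :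
  hdot (k1 *: p + k2 *: q + k3 *: r) X = k1 * hdot p X + k2 * hdot q X + k3 * hdot r X.
Proof. by rewrite !hdotDl !hdotZl. Qed.

Let coef_D X d0 d1 : (forall w, hdot (plucker (dcurve A w)) X = d0 + d1 * w) ->
  [/\ hdot D2 X = d0, 2 * hdot D3 X = d1, hdot q2 X = 0 & hdot q4 X = 0].
Proof.
move=> h.
have h' w := etrans (esym (hdot_dcurve X w)) (h w).
have [e1 e2 e3 e4] := coef7 h'.
split; first exact: e1.
- by rewrite -e2; congr (2 * _); exact: hdotDl.
- exact: (etrans (hdot3 _ _ _ _ _ _ _) e3).
- exact: (etrans (hdot3 _ _ _ _ _ _ _) e4).
Qed.

(** By [jets], the Pluecker vector of the derivative at [w] has the constant product [t] with [D2]
    and the product [2 t w] with [D3]. Compare coefficients in [w]; [q2] and [q4] are the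
    coefficients of [w^2] and [w^4]. *)
Lemma osculating_orth :
  [/\ hdot D3 D2 = 0, hdot q2 D2 = 0, hdot q4 D2 = 0, hdot D3 D3 = t & hdot q2 D3 = 0].
Proof.
have two : (2 : C) != 0 by rewrite pnatr_eq0.
have h2 w : hdot (plucker (dcurve A w)) D2 = t + 0 * w.
  by rewrite hdotC (jets w).1 tr mul0r addr0.
have h3 w : hdot (plucker (dcurve A w)) D3 = 0 + 2 * t * w.
  have E : 2 * hdot D3 (plucker (dcurve A w)) = 4 * t * w^*.
    by rewrite -(jets w).2; congr (_ * _); apply: hdotDl.
  have E' : hdot D3 (plucker (dcurve A w)) = 2 * t * w^*.
    by apply: (mulfI two); rewrite E; ring.
  by rewrite hdotC E' [LHS]rmorphM /= conjCK rmorphM /= tr conjC_nat add0r.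
have [_ /eqP] := coef_D h2; rewrite mulf_eq0 (negPf two) /= => /eqP E1 E2 E3.
have [_ E4 E5 _] := coef_D h3.
split=> //; exact: (mulfI two E4).
Qed.

End OsculatingGram.
(** * Classification of the coefficients *)

Section LinearCombination.
Variable S : pzRingType.
Implicit Types x y z : S.

(** Used with [eq_add] and [eq_scale] to check certificates: a combination of known equations is
    assembled, and [ring] or [field] verifies that it is the goal. *)
Lemma eq_of_sub x y z w : z = w -> x - y = z - w -> x = y.
Proof. by move=> -> /eqP; rewrite subrr subr_eq0 => /eqP. Qed.

Lemma eq_add x y z w : x = y -> z = w -> x + z = y + w.
Proof. by move=> -> ->. Qed.

Lemma eq_scale c x y : x = y -> c * x = c * y.
Proof. by move=> ->. Qed.

End LinearCombination.

(** * Excluding a coefficient of degree 4 *)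

Section GramMinors.
Variable R : realType.
Local Notation C := R[i].
Variable m : nat.
Implicit Types u v x y : 'rV[C]_m.

Definition gram2 u v x y : C := dot u x * dot v y - dot u y * dot v x.

Lemma sqr0 (x : C) : x * x = 0 -> x = 0.
Proof. by move=> /eqP; rewrite mulf_eq0 orbb => /eqP. Qed.

(* The value of [gram4] for a frame [e1 + a z, e2 + b z], [e1] and [e2] orthonormal and
   orthogonal to [a z = \sum_k z^k a_k] and [b z = \sum_k z^k b_k]. *)
Definition gram_det (a1 a2 a3 a4 b1 b2 b3 b4 : 'rV[C]_m) (z w : C) :=
  let A z := z *: a1 + z ^+ 2 *: a2 + z ^+ 3 *: a3 + z ^+ 4 *: a4 in
  let B z := z *: b1 + z ^+ 2 *: b2 + z ^+ 3 *: b3 + z ^+ 4 *: b4 in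
  let A' z := a1 + (2 * z) *: a2 + (3 * z ^+ 2) *: a3 + (4 * z ^+ 3) *: a4 in
  let B' z := b1 + (2 * z) *: b2 + (3 * z ^+ 2) *: b3 + (4 * z ^+ 3) *: b4 in
  det4 (1 + dot (A z) (A w)) (dot (A z) (B w)) (dot (A z) (A' w)) (dot (A z) (B' w))
       (dot (B z) (A w)) (1 + dot (B z) (B w)) (dot (B z) (A' w)) (dot (B z) (B' w))
       (dot (A' z) (A w)) (dot (A' z) (B w)) (dot (A' z) (A' w)) (dot (A' z) (B' w))
       (dot (B' z) (A w)) (dot (B' z) (B w)) (dot (B' z) (A' w)) (dot (B' z) (B' w)).

(* The case [b4 = 0], [a4 <> 0] is contradictory.  The expressions of [b1], [b2] and
   [b3 = be a4] come from the vanishing of the coefficients of [z^5, ..., z^8] in the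
   Pluecker curve. *)
Section TopCoefficient.
Variables (a1 a2 a3 a4 b1 b2 : 'rV[C]_m) (be ga de t : C).
Hypothesis b1E : b1 = be *: a2 + ga *: a3 + de *: a4.
Hypothesis b2E : b2 = be *: a3 + ga *: a4.
Hypothesis t0 : t != 0.
Hypothesis a40 : a4 != 0.
(** The product with [Dw A 3], rewritten by [b1E], [b2E] and [b3 = be a4]. Below, [Hkl] is the
    orthogonality of the Pluecker coefficients [k] and [l], and the [Q] with two digits come from
    [osculating_orth]. *)
Let D4 x y := be * gram2 a1 a4 x y + ga * gram2 a2 a4 x y + de * gram2 a3 a4 x y.
Hypothesis H11 : dot a1 a1 + dot b1 b1 = 4.
Hypothesis H21 : dot a2 a1 + dot b2 b1 = 0.
Hypothesis H31 : dot a3 a1 + be * dot a4 b1 = 0.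
Hypothesis H41 : dot a4 a1 = 0.
Hypothesis H22 : dot a2 a2 + dot b2 b2 + t = 6.
Hypothesis H32 : dot a3 a2 + be * dot a4 b2 + (gram2 a1 b2 a1 b1 + gram2 a2 b1 a1 b1) = 0.
Hypothesis H42 : dot a4 a2 + D4 a1 b1 = 0.
Hypothesis H33 : dot a3 a3 + be * be^* * dot a4 a4 + t = 4.
Hypothesis H43 : dot a4 a3 + (D4 a1 b2 + D4 a2 b1) = 0.
Hypothesis H44 : dot a4 a4 + (be^* * D4 a1 a4 + ga^* * D4 a2 a4 + de^* * D4 a3 a4) = 1.
Hypothesis Q22 : 3 * D4 a1 b1 + gram2 a2 b2 a1 b1 = 0.
Hypothesis Q42 : be * gram2 a3 a4 a1 b1 = 0.
Hypothesis Q33 : gram2 a1 b2 a1 b2 + gram2 a1 b2 a2 b1 + (gram2 a2 b1 a1 b2 + gram2 a2 b1 a2 b1) = t.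
Hypothesis Q23 : 3 * D4 a1 b2 + gram2 a2 b2 a1 b2 + (3 * D4 a2 b1 + gram2 a2 b2 a2 b1) = 0.
Hypothesis Q0 : gram2 a1 b1 a1 b1 = t.
Hypothesis gram : gram_det a1 a2 a3 a4 b1 b2 (be *: a4) 0 1 1 = t * 2 ^+ 4.

Let n4 : dot a4 a4 != 0. Proof. by apply: contra_neq a40 => /dot_eq0. Qed.

Let z31_41 : dot a3 a1 = 0 /\ be * dot a4 b1 = 0.
Proof.
(* As [<a4,a1> = 0], [Q42] says [be <a3,a1> <a4,b1> = 0], which is the second term of [H31] times
   [<a3,a1>]. *)
have E : dot a3 a1 * dot a3 a1 = 0.
  apply: (eq_of_sub (eq_add (eq_scale (dot a3 a1) H31) (eq_scale (- 1) Q42))).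
  by rewrite /gram2 H41; ring.
have z31 := sqr0 E; split=> //.
by move: H31; rewrite z31 add0r.
Qed.
Let z31 := proj1 z31_41.
Let z13 := dotC0 z31.
Let z14 := dotC0 H41.

(** Most mixed products vanish in turn or are multiples of [p = <a4,b2>]. For [p <> 0] the norm of
    [a1] would be negative; for [p = 0] one gets [b1 = be a2] and [b2 = be a3], and the norms
    satisfy a quadratic equation without admissible root. *)
Lemma top_coef_be : be != 0 -> False.
Proof.
move=> be0; have z4b1 : dot a4 b1 = 0.
  by have [_ /eqP] := z31_41; rewrite mulf_eq0 (negPf be0) => /eqP.
have zb14 := dotC0 z4b1.
have D4z x : D4 x b1 = - (be * dot a1 b1 + ga * dot a2 b1 + de * dot a3 b1) * dot a4 x.
  by rewrite /D4 /gram2 z4b1; ring.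
have z42 : dot a4 a2 = 0 by move: H42; rewrite D4z H41 mulr0 addr0.
have z24 := dotC0 z42.
have zb2a1 : dot b2 a1 = 0 by rewrite b2E dotDl !dotZl z31 H41 !mulr0 addr0.
have z1b2 := dotC0 zb2a1.
have E21 : dot a2 a1 * dot b2 b1 = 0.
  by apply: (eq_of_sub Q22); rewrite D4z /gram2 H41 zb2a1; ring.
have z21 : dot a2 a1 = 0.
  apply: sqr0; apply: (eq_of_sub (eq_add (eq_scale (dot a2 a1) H21) (eq_scale (- 1) E21))); ring.
have z12 := dotC0 z21.
have zb21 : dot b2 b1 = 0 by move: H21; rewrite z21 add0r.
have zb12 := dotC0 zb21.
have z1b1 : dot a1 b1 = 0.
  by rewrite b1E !dotDr !dotZr z12 z13 z14 !mulr0 !addr0.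
have zb11 := dotC0 z1b1.
pose p := dot a4 b2.
have D4b2 : D4 a1 b2 + D4 a2 b1 = be * dot a1 a1 * p.
  by rewrite /D4 /gram2 ?H41 ?z1b1 ?z21 ?z31 ?z4b1 ?z42 -/p; ring.
have z43 : dot a4 a3 = - be * dot a1 a1 * p.
  by apply: (eq_of_sub H43); rewrite D4b2; ring.
have z32 : dot a3 a2 = - be * p.
  by apply: (eq_of_sub H32); rewrite /gram2 ?zb21 ?z1b1 ?zb2a1 ?z21 ?z1b2 ?zb11 -/p; ring.
have pE : (1 + be * be^* * dot a1 a1) * p = ga^* * dot a4 a4.
  have : p = be^* * dot a4 a3 + ga^* * dot a4 a4 by rewrite /p b2E dotDr !dotZr.
  by move=> E; apply: (eq_of_sub E); rewrite z43; ring.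
have z4b1' : be^* * dot a4 a2 + ga^* * dot a4 a3 + de^* * dot a4 a4 = 0.
  by rewrite -z4b1 b1E !dotDr !dotZr.
have b2a2 : dot b2 a2 = - be * be * p.
  by rewrite b2E dotDl !dotZl z42 z32; ring.
have key : 3 * be * dot a1 a1 * p = dot a2 b1 * dot b2 a2.
  apply: (eq_of_sub (eq_add Q23 (eq_scale (- 3) D4b2))).
  by rewrite /gram2 zb21 z21 zb2a1; ring.
(* If [p <> 0], then [|b1|^2 = -3 |a1|^2], so that [H11] gives [|a1|^2 = -2]. *)
have [p0|p0] := eqVneq p 0; last first.
  have k2 : 3 * dot a1 a1 = - be * dot a2 b1.
    apply: (mulfI be0); apply: (mulfI p0); apply: (eq_of_sub key); rewrite b2a2; ring.
  have a3b1 : dot a3 b1 = 0.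
    apply: (mulfI be0); rewrite mulr0 -zb21 b2E dotDl !dotZl z4b1; ring.
  have b11 : dot b1 b1 = - 3 * dot a1 a1.
    rewrite {1}b1E !dotDl !dotZl a3b1 z4b1.
    by apply: (eq_of_sub k2); ring.
  have n1 : dot a1 a1 = - 2.
    apply: (mulfI (_ : 2 != 0 :> C)); first by rewrite pnatr_eq0.
    by apply: (eq_of_sub (eq_scale (- 1) H11)); rewrite b11; ring.
  by have := dot_ge0 a1; rewrite n1 oppr_ge0 lern0.
have ga0 : ga = 0.
  apply/eqP; rewrite -conjC_eq0; move/eqP: pE.
  by rewrite p0 mulr0 eq_sym mulf_eq0 (negPf n4) orbF.
have zz43 : dot a4 a3 = 0 by rewrite z43 p0 mulr0.
have zz32 : dot a3 a2 = 0 by rewrite z32 p0 mulr0.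
have de0 : de = 0.
  apply/eqP; rewrite -conjC_eq0; move/eqP: z4b1'.
  by rewrite ga0 conjC0 mul0r addr0 z42 mulr0 add0r mulf_eq0 (negPf n4) orbF.
have b1' : b1 = be *: a2 by rewrite b1E ga0 de0 !scale0r !addr0.
have b2' : b2 = be *: a3 by rewrite b2E ga0 scale0r addr0.
have zz34 := dotC0 zz43; have zz23 := dotC0 zz32.
pose n1 := dot a1 a1; pose n2 := dot a2 a2; pose n3 := dot a3 a3; pose B := be * be^*.
pose x := B * n2.
have xB : B * n2 = x by [].
have h11 : n1 = 4 - x.
  by apply: (eq_of_sub H11); rewrite b1' dotZl dotZr /x /B /n1 /n2; ring.
have h22 : n2 + B * n3 + t = 6.
  by apply: (eq_of_sub H22); rewrite b2' dotZl dotZr /B /n2 /n3; ring.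
have h33 : n3 + B * dot a4 a4 + t = 4 by apply: (eq_of_sub H33); rewrite /B /n3; ring.
have h44 : dot a4 a4 * (1 + B * n1) = 1.
  apply: (eq_of_sub H44); rewrite /D4 /gram2 ga0 de0 !conjC0 z14 z42 z24 /B /n1.
  by ring.
have q0 : n1 * x = t.
  by apply: (eq_of_sub Q0); rewrite /gram2 b1' !(dotZl, dotZr) z12 z21 /x /B /n1 /n2; ring.
have q33 : n1 * (B * n3) = t.
  apply: (eq_of_sub Q33); rewrite /gram2 b1' b2' !(dotZl, dotZr) z12 z21 z13 z31 zz23 zz32 /B /n1 /n3.
  by ring.
have n10 : n1 != 0 by apply: contraNneq t0 => n10; rewrite -q0 n10 mul0r.
have Bn3 : B * n3 = x by apply: (mulfI n10); rewrite q33 q0.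
have B0 : B != 0 by rewrite mulf_neq0 ?conjC_eq0.
have n32 : n3 = n2 by apply: (mulfI B0).
have n2E : n2 = x ^+ 2 - 5 * x + 6.
  apply: (eq_of_sub (eq_add h22 (eq_add q0 (eq_scale (- 1) Bn3)))); rewrite h11; ring.
have E : (x - 3) * (x - 4) = 0.
  have h44' : B * dot a4 a4 * (n2 + x * n1) = x.
    by apply: (eq_of_sub (eq_scale x h44)); rewrite -xB; ring.
  have Bn4 : B * dot a4 a4 = x - 2.
    apply: (eq_of_sub (eq_add h33 q0)); rewrite n32 n2E h11; ring.
  by apply: (eq_of_sub (eq_scale (- 1) h44')); rewrite Bn4 n2E h11; ring.
(* [x = 3] gives [a2 = 0], hence [x = 0]; [x = 4] gives [a1 = 0], hence [t = 0]. *)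
move/eqP: E; rewrite mulf_eq0 !subr_eq0 => /orP[] /eqP xE.
  have n20 : n2 = 0 by rewrite n2E xE; ring.
  by move/eqP: xE; rewrite /x n20 mulr0 eq_sym pnatr_eq0.
by move: t0; rewrite -q0 h11 xE subrr mul0r eqxx.
Qed.

(** Both cases, [ga = 0] and [ga <> 0], end in one numerical solution for the norms, which the value
    of the whole Gram determinant at [z = w = 1] excludes. *)
Lemma top_coef_be0 : be = 0 -> False.
Proof.
move=> be0; have b1' : b1 = ga *: a3 + de *: a4 by rewrite b1E be0 scale0r add0r.
have b2' : b2 = ga *: a4 by rewrite b2E be0 scale0r add0r.
have z1b1 : dot a1 b1 = 0 by rewrite b1' dotDr !dotZr z13 z14 !mulr0 addr0.
have zb11 := dotC0 z1b1.
have E21 : dot a2 a1 * (ga * dot a4 b1) = 0.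
  apply: (mulfI (_ : 4 != 0 :> C)); first by rewrite pnatr_eq0.
  apply: (eq_of_sub Q22); rewrite /D4 /gram2 be0 b2' !dotZl H41 z31; ring.
have h21 : dot a2 a1 + ga * dot a4 b1 = 0 by rewrite -dotZl -b2'.
have z21 : dot a2 a1 = 0.
  apply: sqr0; apply: (eq_of_sub (eq_add (eq_scale (dot a2 a1) h21) (eq_scale (- 1) E21))).
  by ring.
have z12 := dotC0 z21.
have g4b1 : ga * dot a4 b1 = 0 by move: h21; rewrite z21 add0r.
pose n1 := dot a1 a1; pose n2 := dot a2 a2; pose n3 := dot a3 a3; pose n4' := dot a4 a4.
have [ga0|ga0] := eqVneq ga 0.
  have b1d : b1 = de *: a4 by rewrite b1' ga0 scale0r add0r.
  have b20 : b2 = 0 by rewrite b2' ga0 scale0r.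
  have z42 : dot a4 a2 = 0.
    by apply: (eq_of_sub H42); rewrite /D4 /gram2 be0 ga0 z31 H41; ring.
  have z24 := dotC0 z42.
  have z32 : dot a3 a2 = 0.
    by apply: (eq_of_sub H32); rewrite /gram2 be0 b20 !(dot0l, dot0r) z21 zb11; ring.
  have z23 := dotC0 z32.
  have z43 : dot a4 a3 = 0.
    apply: (eq_of_sub H43); rewrite /D4 /gram2 be0 ga0 b20 !(dot0l, dot0r) z32 z42; ring.
  have z34 := dotC0 z43.
  pose d := de * de^*; pose x := d * n4'.
  have h11 : n1 + x = 4 by rewrite -H11 b1d dotZl dotZr /x /d -mulrA.
  have h22 : n2 + t = 6 by rewrite -H22 b20 dot0l addr0.
  have h33 : n3 + t = 4 by apply: (eq_of_sub H33); rewrite be0 /n3; ring.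
  have h44 : n4' + d * n3 * n4' = 1.
    apply: (eq_of_sub H44); rewrite /D4 /gram2 be0 ga0 z34 z43 /n4' /d /n3; ring.
  have q0 : n1 * x = t.
    by apply: (eq_of_sub Q0); rewrite /gram2 b1d !(dotZl, dotZr) z14 H41 /x /d /n1 /n4'; ring.
  have q33 : n2 * x = t.
    apply: (eq_of_sub Q33); rewrite /gram2 b20 !(dot0l, dot0r) b1d !(dotZl, dotZr) z24 z42 /x /d /n2 /n4'.
    by ring.
  have x0 : x != 0 by apply: contraNneq t0 => x0; rewrite -q0 x0 mulr0.
  have n21 : n2 = n1 by apply: (mulIf x0); rewrite q0 q33.
  have E : (x - 1) * (x - 2) = 0.
    apply: (eq_of_sub (eq_add (eq_scale (1 + x) h11) (eq_scale (- 1) (eq_add h22 q0)))); rewrite n21; ring.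
  move/eqP: E; rewrite mulf_eq0 !subr_eq0 => /orP[] /eqP xE.
    have n1E : n1 = 3 by apply: (eq_of_sub h11); rewrite xE; ring.
    have n3E : n3 = 1 by apply: (eq_of_sub h33); rewrite -q0 n1E xE; ring.
    have : n4' = 0.
      by apply: (eq_of_sub (eq_add h44 (eq_scale (- 1) xE))); rewrite n3E /x; ring.
    by move/eqP; rewrite (negPf n4).
  have n1E : n1 = 2 by apply: (eq_of_sub h11); rewrite xE; ring.
  have tE : t = 4 by rewrite -q0 n1E xE; ring.
  have n3E : n3 = 0 by apply: (eq_of_sub h33); rewrite tE; ring.
  have a30 : a3 = 0 by apply: dot_eq0.
  have n4E : n4' = 1 by apply: (eq_of_sub h44); rewrite n3E; ring.
  have dE : de * de^* = 2 by rewrite -xE /x /d n4E mulr1.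
  (* The determinant identity reduces to [14 |de|^2 = 64], while [|de|^2 = 2]. *)
  move: gram; rewrite /gram_det be0 b20 a30 b1d !(scaler0, scale0r, addr0, expr1n, mulr1, scale1r).
  rewrite !(dotDl, dotDr, dotZl, dotZr) ?conjC_nat.
  rewrite z12 z21 z14 H41 z24 z42 -/n1 -/n2 -/n4' n4E n21 n1E tE /det4 /det3.
  move=> G; have : 14 * (de * de^*) = 64 :> C by apply: (eq_of_sub G); ring.
  rewrite dE => E'; have : (28 : C) = 64 by apply: (eq_of_sub E'); ring.
  by move/eqP; rewrite eqr_nat.
have z4b1 : dot a4 b1 = 0 by move/eqP: g4b1; rewrite mulf_eq0 (negPf ga0) => /eqP.
have z42 : dot a4 a2 = 0.
  by apply: (eq_of_sub H42); rewrite /D4 /gram2 be0 z31 H41 z21 z4b1; ring.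
have z24 := dotC0 z42.
have z43 : dot a4 a3 = 0.
  by apply: (eq_of_sub H43); rewrite /D4 /gram2 be0 z31 H41 z21 z4b1 z42; ring.
have z34 := dotC0 z43.
have de0 : de = 0.
  apply/eqP; rewrite -conjC_eq0; move/eqP: z4b1.
  by rewrite b1' dotDr !dotZr z43 mulr0 add0r mulf_eq0 (negPf n4) orbF.
have b1d : b1 = ga *: a3 by rewrite b1' de0 scale0r addr0.
have z32 : dot a3 a2 = 0.
  apply: (eq_of_sub H32); rewrite /gram2 be0 z21 z1b1 zb11 b1d b2' !(dotZl, dotZr) z43; ring.
have z23 := dotC0 z32.
pose g := ga * ga^*; pose s := g * n3; pose x := g * n4'.
have sE : g * n3 = s by [].
have xE : g * n4' = x by [].
have h11 : n1 + s = 4 by rewrite -H11 b1d dotZl dotZr /s /g -mulrA.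
have h22 : n2 + x + t = 6 by rewrite -H22 b2' dotZl dotZr /x /g -mulrA.
have h33 : n3 + t = 4 by apply: (eq_of_sub H33); rewrite be0 /n3; ring.
have h44 : n4' + n2 * x = 1.
  apply: (eq_of_sub H44); rewrite /D4 /gram2 be0 de0 z24 z42 conjC0 /x /g /n4' /n2; ring.
have q0 : n1 * s = t.
  by apply: (eq_of_sub Q0); rewrite /gram2 b1d !(dotZl, dotZr) z13 z31 /s /g /n1 /n3; ring.
have q33 : n1 * x + n2 * s = t.
  apply: (eq_of_sub Q33).
  rewrite /gram2 b1d b2' !(dotZl, dotZr) ?z12 ?z21 ?z23 ?z32 ?z43 ?z34 ?z13 ?z31 ?z14 ?z24 ?z42 ?H41 /x /s /g /n1 /n2 /n3 /n4'.
  by ring.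
have s0 : s != 0 by apply: contraNneq t0 => s0; rewrite -q0 s0 mulr0.
have n1E : n1 = 4 - s by apply: (eq_of_sub h11); ring.
have n3E : n3 = (s - 2) ^+ 2.
  by apply: (eq_of_sub (eq_add h33 q0)); rewrite n1E; ring.
have n2E : n2 = s ^+ 2 - 4 * s + 6 - x.
  by apply: (eq_of_sub (eq_add h22 q0)); rewrite n1E; ring.
have E : (s - 2) * (2 * x - s * (s - 1)) = 0.
  apply: (eq_of_sub (eq_add (eq_scale (- 1) q33) q0)); rewrite n1E n2E; ring.
have s2 : s - 2 != 0.
  apply: contraNneq s0 => s2; rewrite -sE n3E s2; apply/eqP; ring.
have x2 : 2 * x = s * (s - 1).
  by move/eqP: E; rewrite mulf_eq0 (negPf s2) subr_eq0 => /eqP.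
have h44s : x * (n3 + n2 * s) = s.
  have sn : s * n4' = x * n3 by rewrite /s /x; ring.
  by apply: (eq_of_sub (eq_add (eq_scale s h44) (eq_scale (- 1) sn))); ring.
have n2E2 : 2 * n2 = (s - 3) * (s - 4).
  by apply: (eq_of_sub (eq_scale (- 1) x2)); rewrite n2E; ring.
(* Eliminating [x] and [n2] leaves one equation in [s]. Since [s] is nonnegative and neither 0 nor
   2, it is 3. *)
have F4 : s * ((s - 3) * (s + 1) * (s - 2) ^+ 2) = 0.
  apply: (eq_of_sub (eq_add (eq_scale 4 h44s) (eq_add
    (eq_scale (- (2 * (n3 + n2 * s))) x2)
    (eq_scale (- (s * (s - 1) * s)) n2E2)))).
  by rewrite n3E; ring.
have s1 : s + 1 != 0.
  have : 0 <= s by rewrite mulr_ge0 ?mul_conjC_ge0 // dot_ge0.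
  by move=> s_ge0; rewrite gt_eqF // ltr_wpDl.
have s3 : s = 3.
  move/eqP: F4; rewrite mulf_eq0 (negPf s0) /= mulf_eq0 expf_eq0 (negPf s2) /= orbF.
  by rewrite mulf_eq0 (negPf s1) orbF subr_eq0 => /eqP.
have n3E' : n3 = 1 by rewrite n3E s3; ring.
have gE : ga * ga^* = 3 by rewrite -s3 -sE n3E' mulr1.
have n1E' : n1 = 1 by rewrite n1E s3; ring.
have tE : t = 3 by rewrite -q0 n1E' s3 mul1r.
have n2E' : n2 = 0.
  by apply: (mulfI (_ : 2 != 0 :> C)); [rewrite pnatr_eq0 | rewrite n2E2 s3; ring].
have n4E' : n4' = 1 by apply: (eq_of_sub h44); rewrite n2E'; ring.
have a20 : a2 = 0 by apply: dot_eq0.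
(* The determinant identity reduces to [|ga|^4 + 10 |ga|^2 = 48], while [|ga|^2 = 3]. *)
move: gram; rewrite /gram_det be0 b1d b2' a20 !(scaler0, scale0r, addr0, expr1n, mulr1, scale1r).
rewrite !(dotDl, dotDr, dotZl, dotZr) ?conjC_nat.
rewrite z13 z31 z14 H41 z34 z43 -/n1 -/n3 -/n4' n4E' n3E' n1E' tE /det4 /det3 => G.
have : (ga * ga^*) ^+ 2 + 10 * (ga * ga^*) = 48 :> C by apply: (eq_of_sub G); ring.
rewrite gE => E'; have : (39 : C) = 48 by apply: (eq_of_sub E'); ring.
by move/eqP; rewrite eqr_nat.
Qed.

End TopCoefficient.
End GramMinors.

(** * The Gram determinant when a_3 and b_2 are collinear *)

Section GramExpansion.
Variable R : realType.
Local Notation C := R[i].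
Variable m : nat.
Variables (a1 a2 b1 f : 'rV[C]_m) (al be T s n2 n r r' : C).
Hypotheses (n1T : dot a1 a1 = T) (m1s : dot b1 b1 = s) (n22 : dot a2 a2 = n2)
  (nf : dot f f = n) (ab : dot a2 b1 = r) (ba : dot b1 a2 = r').
Hypotheses (z12 : dot a1 a2 = 0) (z13 : dot a1 f = 0) (z1b : dot a1 b1 = 0)
  (z23 : dot a2 f = 0) (z3b : dot f b1 = 0).

(** Writing [a3] and [b2] as multiples of [f] allows either to vanish. This serves the
    classification, with [al = 1], and the family, where [a3] is 0 at [T = 2]. Under the
    orthogonality relations only powers of [z * w^*] occur. *)
Lemma gram_det_expand z w (n3 := al * al^* * n) (y := be * be^* * n)
    (g := be * al^* * n * r + al * be^* * n * r') :
  gram_det a1 a2 (al *: f) 0 b1 (be *: f) 0 0 z w =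
    T * s + 4 * (y * T + n2 * s - r * r') * (z * w^*)
    + (9 * (n3 * s) + 16 * (y * n2) - 12 * g + T * s * y + T * (n2 * s - r * r'))
      * (z * w^*) ^+ 2
    + (4 * T * (n3 * s + y * n2 - g) + 4 * y * (n2 * s - r * r')) * (z * w^*) ^+ 3
    + (n3 + T * y) * (n2 * s - r * r') * (z * w^*) ^+ 4.
Proof.
have z21 := dotC0 z12; have z31 := dotC0 z13; have zb1 := dotC0 z1b.
have z32 := dotC0 z23; have zb3 := dotC0 z3b.
pose u x1 x2 x3 := x1 *: a1 + x2 *: a2 + x3 *: f; pose v y1 y2 := y1 *: b1 + y2 *: f.
have uu x1 x2 x3 y1 y2 y3 :
    dot (u x1 x2 x3) (u y1 y2 y3) = x1 * y1^* * T + x2 * y2^* * n2 + x3 * y3^* * n.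
  rewrite /u !(dotDl, dotDr, dotZl, dotZr) n1T n22 nf z12 z13 z21 z23 z31 z32; ring.
have uv x1 x2 x3 y1 y2 : dot (u x1 x2 x3) (v y1 y2) = x2 * y1^* * r + x3 * y2^* * n.
  rewrite /u /v !(dotDl, dotDr, dotZl, dotZr) nf ab z1b z13 z23 z3b; ring.
have vu x1 x2 y1 y2 y3 : dot (v x1 x2) (u y1 y2 y3) = x1 * y2^* * r' + x2 * y3^* * n.
  rewrite /u /v !(dotDl, dotDr, dotZl, dotZr) nf ba zb1 z31 z32 zb3; ring.
have vv x1 x2 y1 y2 : dot (v x1 x2) (v y1 y2) = x1 * y1^* * s + x2 * y2^* * n.
  rewrite /v !(dotDl, dotDr, dotZl, dotZr) nf m1s zb3 z3b; ring.
have conjX (x : C) k : (x ^+ k)^* = x^* ^+ k by rewrite rmorphXn.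
have conjNX (x : C) k l : (k%:R * x ^+ l)^* = k%:R * x^* ^+ l.
  by rewrite rmorphM /= conjC_nat conjX.
have conjNM (x : C) k : (k%:R * x)^* = k%:R * x^* by rewrite rmorphM /= conjC_nat.
have conjXM (x c : C) k : (x ^+ k * c)^* = x^* ^+ k * c^* by rewrite rmorphM /= conjX.
have conjNXM (x c : C) k l : (k%:R * x ^+ l * c)^* = k%:R * x^* ^+ l * c^*.
  by rewrite rmorphM /= conjNX.
have conjN2 (x c : C) : (2 * x * c)^* = 2 * x^* * c^* by rewrite rmorphM /= conjNM.
have AE z' : z' *: a1 + z' ^+ 2 *: a2 + (z' ^+ 3 * al) *: f = u z' (z' ^+ 2) (z' ^+ 3 * al).
  by [].
have BE z' : z' *: b1 + (z' ^+ 2 * be) *: f = v z' (z' ^+ 2 * be) by [].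
have A'E z' : a1 + (2 * z') *: a2 + (3 * z' ^+ 2 * al) *: f = u 1 (2 * z') (3 * z' ^+ 2 * al).
  by rewrite /u scale1r.
have B'E z' : b1 + (2 * z' * be) *: f = v 1 (2 * z' * be) by rewrite /v scale1r.
clearbody u v; pose x := w^*; pose be' := be^*; pose al' := al^*.
transitivity (det4
  (1 + (z * x * T + z ^+ 2 * x ^+ 2 * n2 + z ^+ 3 * al * (x ^+ 3 * al') * n))
  (z ^+ 2 * x * r + z ^+ 3 * al * (x ^+ 2 * be') * n)
  (z * T + z ^+ 2 * (2 * x) * n2 + z ^+ 3 * al * (3 * x ^+ 2 * al') * n)
  (z ^+ 2 * r + z ^+ 3 * al * (2 * x * be') * n)
  (z * x ^+ 2 * r' + z ^+ 2 * be * (x ^+ 3 * al') * n)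
  (1 + (z * x * s + z ^+ 2 * be * (x ^+ 2 * be') * n))
  (z * (2 * x) * r' + z ^+ 2 * be * (3 * x ^+ 2 * al') * n)
  (z * s + z ^+ 2 * be * (2 * x * be') * n)
  (x * T + 2 * z * x ^+ 2 * n2 + 3 * z ^+ 2 * al * (x ^+ 3 * al') * n)
  (2 * z * x * r + 3 * z ^+ 2 * al * (x ^+ 2 * be') * n)
  (T + 2 * z * (2 * x) * n2 + 3 * z ^+ 2 * al * (3 * x ^+ 2 * al') * n)
  (2 * z * r + 3 * z ^+ 2 * al * (2 * x * be') * n)
  (x ^+ 2 * r' + 2 * z * be * (x ^+ 3 * al') * n)
  (x * s + 2 * z * be * (x ^+ 2 * be') * n)
  (2 * x * r' + 2 * z * be * (3 * x ^+ 2 * al') * n)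
  (s + 2 * z * be * (2 * x * be') * n)).
  rewrite /gram_det; congr (det4 _ _ _ _ _ _ _ _ _ _ _ _ _ _ _ _);
    rewrite !scaler0 !addr0 !scalerA ?AE ?BE ?A'E ?B'E ?(uu, uv, vu, vv);
    rewrite ?(conjXM, conjNXM, conjN2, conjNX, conjNM, conjX, conjC1); by rewrite ?(mul1r, mulr1).
rewrite /g /y /n3 -/x -/be' -/al'; move: x be' al' => x be' al'; rewrite /det4 /det3; ring.
Qed.

End GramExpansion.

(** * The normal form of the coefficients *)

Section NormalForm.
Variable R : realType.
Local Notation C := R[i].
Variable m : nat.
Implicit Types (a b f : 'rV[C]_m) (T : R).
Local Notation "x %:C" := (real_complex R x) : ring_scope.

(* The coefficients of [sphere_family T] with respect to an orthonormal system [f2, ..., f5],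
   the first row being divided by the unit scalar [th]. *)
Definition normal_form T a1 a2 a3 b1 b2 := 0 < T <= 3 /\ exists (th : C) (f : nat -> 'rV[C]_m),
  [/\ th * th^* = 1,
      forall i j, (i < 4)%N -> (j < 4)%N -> dot (f i) (f j) = (i == j)%:R,
      [/\ th *: a1 = (Num.sqrt T)%:C *: f 1%N,
          th *: a2 = (Num.sqrt ((3 - T) / (4 - T)) * `|T - 2|)%:C *: f 2%N
                     + (Num.sqrt (T / (4 - T)))%:C *: f 3%N
        & th *: a3 = `|T - 2|%:C *: f 0%N]
    & b1 = (Num.sqrt (4 - T))%:C *: f 2%N /\ b2 = (Num.sqrt (3 - T))%:C *: f 0%N].

Lemma sqrtC_sq (x : R) : 0 <= x -> (Num.sqrt x)%:C * (Num.sqrt x)%:C = x%:C.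
Proof. by move=> x0; rewrite -rmorphM /= -expr2 sqr_sqrtr. Qed.

Lemma conj_realC (x : R) : (x%:C)^* = x%:C :> C.
Proof. by apply/eqP; rewrite eq_complex /= oppr0 !eqxx. Qed.

(** [f2] is given, since [a3] may vanish (at [T = 2]) and so may [b2] (at [T = 3]). The rest is
    Gram-Schmidt: [f3] and [f4] are the directions of [a1] and [b1], and [f5] is that of [a2] after
    removing its component along [f4]. *)
Lemma normal_form_intro T a1 a2 a3 b1 b2 (th : C) f2 : 0 < T <= 3 -> th * th^* = 1 ->
  th *: a3 = `|T - 2|%:C *: f2 -> b2 = (Num.sqrt (3 - T))%:C *: f2 ->
  dot f2 f2 = 1 -> dot f2 a1 = 0 -> dot f2 a2 = 0 -> dot f2 b1 = 0 ->
  dot a1 a1 = T%:C -> dot b1 b1 = (4 - T)%:C -> dot a1 b1 = 0 -> dot a1 a2 = 0 ->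
  dot a2 a2 = (T ^+ 2 - 3 * T + 3)%:C ->
  th * dot a2 b1 = (Num.sqrt (3 - T) * `|T - 2|)%:C ->
  normal_form T a1 a2 a3 b1 b2.
Proof.
move=> T03; have [T0 T3] := andP T03; move=> thU a3E b2E f22 f21 f2a2 f2b1 n1 m1 a1b1 a12 n2 rE.
have s0 : 0 < 4 - T by rewrite subr_gt0 (le_lt_trans T3) // ltr_nat.
have y0 : 0 <= 3 - T by rewrite subr_ge0.
pose rt : C := (Num.sqrt T)%:C; pose rs : C := (Num.sqrt (4 - T))%:C.
have rt2 : rt * rt = T%:C by apply: sqrtC_sq; apply: ltW.
have rs2 : rs * rs = (4 - T)%:C by apply: sqrtC_sq; apply: ltW.
have rt0 : rt != 0 by rewrite fmorph_eq0 gt_eqF // sqrtr_gt0.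
have rs0 : rs != 0 by rewrite fmorph_eq0 gt_eqF // sqrtr_gt0.
have rtc : rt^* = rt by apply: conj_realC.
have rsc : rs^* = rs by apply: conj_realC.
pose q : C := (Num.sqrt (3 - T) * `|T - 2|)%:C.
have qc : q^* = q by apply: conj_realC.
have qq : q * q = ((3 - T) * (T - 2) ^+ 2)%:C.
  rewrite /q -rmorphM /= mulrACA -[X in X * _]expr2 sqr_sqrtr // -[X in _ * X]expr2.
  by rewrite real_normK // num_real.
pose f3 := (th / rt) *: a1; pose f4 := rs^-1 *: b1.
pose f5 := (rs / rt) *: (th *: a2 - (q / rs) *: f4).
have c4 : (Num.sqrt ((3 - T) / (4 - T)) * `|T - 2|)%:C = q / rs.
  by rewrite sqrtrM // sqrtrV ?ltW // mulrAC rmorphM /= fmorphV.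
have c5 : (Num.sqrt (T / (4 - T)))%:C = rt / rs.
  by rewrite sqrtrM ?(ltW T0) // sqrtrV ?ltW // rmorphM /= fmorphV.
have a21 := dotC0 a12; have b1a1 := dotC0 a1b1.
have f1f2 := dotC0 f21; have a2f2 := dotC0 f2a2; have b1f2 := dotC0 f2b1.
have rE' : th^* * dot b1 a2 = q by rewrite (dotC a2 b1) -rmorphM /= rE.
have f33 : dot f3 f3 = 1.
  rewrite /f3 dotZl dotZr rmorphM /= fmorphV /= rtc n1 -rt2.
  by apply: (eq_of_sub thU); field.
have f44 : dot f4 f4 = 1.
  by rewrite /f4 dotZl dotZr fmorphV /= rsc m1 -rs2; field.
have f34 : dot f3 f4 = 0 by rewrite /f3 /f4 dotZl dotZr a1b1 !mulr0.
have f35 : dot f3 f5 = 0.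
  by rewrite /f3 /f5 /f4 !(dotZl, dotZr, dotDr, dotNr) a12 a1b1 !(mulr0, subr0).
have f45 : dot f4 f5 = 0.
  rewrite /f5 /f4 !(dotZl, dotZr, dotDr, dotNr) m1 rE' !rmorphM /= !fmorphV /= rsc qc rtc -rs2.
  by field; rewrite ?rs0 ?rt0.
have f55 : dot f5 f5 = 1.
  (* The norm left to [f5]: [(T^2 - 3 T + 3) (4 - T) - (3 - T) (T - 2)^2 = T]. *)
  have n2s : dot a2 a2 * (rs * rs) - q * q = rt * rt.
    by rewrite n2 rs2 qq rt2 -!(rmorphM, rmorphB); congr (_%:C); ring.
  rewrite /f5 /f4 !(dotZl, dotZr, dotDl, dotDr, dotNl, dotNr).
  rewrite m1 !rmorphM /= !fmorphV /= rsc qc rtc -rs2.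
  have E1 : th * (th^* * dot a2 a2) = dot a2 a2 by rewrite mulrA thU mul1r.
  apply: (mulfI (mulf_neq0 rt0 rt0)).
  apply: (eq_of_sub (eq_add n2s (eq_add (eq_scale (rs * rs) E1) (eq_scale (- q) (eq_add rE rE'))))).
  by rewrite -/q; field; rewrite ?rs0 ?rt0.
split=> //; exists th, (nth 0 [:: f2; f3; f4; f5]); split=> //.
- have f32 : dot f3 f2 = 0 by rewrite /f3 dotZl f1f2 mulr0.
  have f42 : dot f4 f2 = 0 by rewrite /f4 dotZl b1f2 mulr0.
  have f52 : dot f5 f2 = 0.
    by rewrite /f5 /f4 !(dotZl, dotDl, dotNl) a2f2 b1f2 !(mulr0, subr0).
  have f43 := dotC0 f34; have f53 := dotC0 f35; have f54 := dotC0 f45.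
  have f23 := dotC0 f32; have f24 := dotC0 f42; have f25 := dotC0 f52.
  by case=> [|[|[|[|i]]]] // [|[|[|[|j]]]].
- split=> //=.
    by rewrite /f3 scalerA mulrCA mulfV // mulr1.
  rewrite c4 c5 /f5 scalerA.
  have -> : rt / rs * (rs / rt) = 1 by field; rewrite rs0 rt0.
  by rewrite scale1r addrC subrK.
- by split=> //=; rewrite /f4 scalerA mulfV // scale1r.
Qed.

End NormalForm.
(* The case [a4 = b4 = b3 = 0], [a3 <> 0]. *)
Section CubicCoefficients.
Variable R : realType.
Local Notation C := R[i].
Variable m : nat.
Variables (a1 a2 a3 b1 b2 : 'rV[C]_m) (be t : C).
Hypothesis b2E : b2 = be *: a3.
Hypothesis t0 : t != 0.
Hypothesis a30 : a3 != 0.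
Let D4 x y := be * gram2 a2 a3 x y + gram2 a3 b1 x y.
Hypothesis H11 : dot a1 a1 + dot b1 b1 = 4.
Hypothesis H21 : dot a2 a1 + dot b2 b1 = 0.
Hypothesis H31 : dot a3 a1 = 0.
Hypothesis H22 : dot a2 a2 + dot b2 b2 + t = 6.
Hypothesis H32 : dot a3 a2 = 0.
Hypothesis H33 : dot a3 a3 + t = 4.
Hypothesis Q32 : gram2 a1 b2 a1 b1 + gram2 a2 b1 a1 b1 = 0.
Hypothesis H42 : D4 a1 b1 = 0.
Hypothesis H43 : D4 a1 b2 + D4 a2 b1 = 0.
Hypothesis H44 : be^* * D4 a2 a3 + D4 a3 b1 = 1.
Hypothesis Q22 : 4 * be * gram2 a2 a3 a1 b1 + 3 * gram2 a3 b1 a1 b1 = 0.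
Hypothesis Q33 : gram2 a1 b2 a1 b2 + gram2 a1 b2 a2 b1 + (gram2 a2 b1 a1 b2 + gram2 a2 b1 a2 b1) = t.
Hypothesis Q0 : gram2 a1 b1 a1 b1 = t.
Hypothesis gram : forall z, gram_det a1 a2 a3 0 b1 b2 0 0 z 1 = t * (1 + z) ^+ 4.

Let c := dot a3 b1.
Let h := dot a1 b1.
Let r := dot a2 b1.
Let n3 := dot a3 a3.
Let n30 : n3 != 0. Proof. by apply: contra_neq a30 => /dot_eq0. Qed.
Let z13 := dotC0 H31.
Let z23 := dotC0 H32.
Let bc : dot b2 b1 = be * c. Proof. by rewrite b2E dotZl. Qed.
Let zb2a1 : dot b2 a1 = 0. Proof. by rewrite b2E dotZl H31 mulr0. Qed.
Let zb2a2 : dot b2 a2 = 0. Proof. by rewrite b2E dotZl H32 mulr0. Qed.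

(** [H42] combines two minors with weights 1 and 1, [Q22] with weights 4 and 3; so both minors
    vanish. *)
Let WE1 : gram2 a3 b1 a1 b1 = 0.
Proof. by apply: (eq_of_sub (eq_add (eq_scale (- 1) Q22) (eq_scale 4 H42))); rewrite /D4; ring. Qed.

Let ch : c * dot b1 a1 = 0.
Proof. by apply: (eq_of_sub (eq_scale (- 1) WE1)); rewrite /gram2 H31 -/c; ring. Qed.

Let z21_bec : dot a2 a1 = 0 /\ be * c = 0.
Proof.
have E : be * (dot a2 a1 * c) = 0.
  by apply: (eq_of_sub (eq_add H42 (eq_scale (- 1) WE1))); rewrite /D4 /gram2 H31 -/c; ring.
have z21 : dot a2 a1 = 0.
  apply: sqr0; apply: (eq_of_sub (eq_add (eq_scale (dot a2 a1) H21) (eq_scale (- 1) E))).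
  by rewrite bc; ring.
by split=> //; move: H21; rewrite z21 bc add0r.
Qed.
Let z21 := proj1 z21_bec.
Let z12 := dotC0 z21.

(** If [c <> 0], then [be], [<a1,b1>] and [<a2,b1>] vanish and [|b1|^2] is 1 or 2. The value 1
    forces [c = 0] through [H44], the value 2 forces [a3 = 0]. *)
Lemma cubic_c : c = 0.
Proof.
apply/eqP; apply: contraT => c0.
have be0 : be = 0.
  by have [_ /eqP] := z21_bec; rewrite mulf_eq0 (negPf c0) orbF => /eqP.
have hb : dot b1 a1 = 0 by move/eqP: ch; rewrite mulf_eq0 (negPf c0) => /eqP.
have ah := dotC0 hb.
have b20 : b2 = 0 by rewrite b2E be0 scale0r.
have rb : dot b1 a2 = 0.
  apply: (mulfI c0); apply: (eq_of_sub (eq_scale (- 1) H43)).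
  by rewrite /D4 /gram2 be0 b20 !dot0r H32 -/c; ring.
have ra := dotC0 rb.
have q0 : dot a1 a1 * dot b1 b1 = t by apply: (eq_of_sub Q0); rewrite /gram2 ah hb; ring.
have q33 : dot a2 a2 * dot b1 b1 = t.
  apply: (eq_of_sub Q33); rewrite /gram2 b20 !(dot0l, dot0r) ra rb; ring.
have m10 : dot b1 b1 != 0 by apply: contraNneq t0 => m10; rewrite -q0 m10 mulr0.
have n21 : dot a2 a2 = dot a1 a1 by apply: (mulIf m10); rewrite q0 q33.
have h22 : dot a1 a1 + t = 6 by rewrite -H22 b20 dot0l addr0 n21.
have E : (dot b1 b1 - 1) * (dot b1 b1 - 2) = 0.
  apply: (eq_of_sub (eq_add (eq_scale (1 + dot b1 b1) H11)
    (eq_scale (- 1) (eq_add h22 q0)))); ring.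
have h44 : n3 * dot b1 b1 - c * c^* = 1.
  apply: (eq_of_sub H44); rewrite /D4 /gram2 be0 conjC0 -/c -/n3 (dotC a3 b1) -/c; ring.
move/eqP: E; rewrite mulf_eq0 !subr_eq0 => /orP[] /eqP m1E.
  have n1E : dot a1 a1 = 3 by apply: (eq_of_sub H11); rewrite m1E; ring.
  have n3E : n3 = 1 by apply: (eq_of_sub H33); rewrite -q0 n1E m1E /n3; ring.
  have : c * c^* = 0 by apply: (eq_of_sub (eq_scale (- 1) h44)); rewrite n3E m1E; ring.
  by move/eqP; rewrite mul_conjC_eq0 (negPf c0).
have n1E : dot a1 a1 = 2 by apply: (eq_of_sub H11); rewrite m1E; ring.
have : n3 = 0 by apply: (eq_of_sub H33); rewrite -q0 n1E m1E /n3; ring.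
by move/eqP; rewrite (negPf n30).
Qed.

Let z3b : dot a3 b1 = 0 := cubic_c.
Let zb3 := dotC0 z3b.
Let zb2b1 : dot b2 b1 = 0. Proof. by rewrite b2E dotZl z3b mulr0. Qed.

(** If [h <> 0], then [<a2,b1>] and [be] vanish and [t] is 2 or 3; these values give [4 |h|^2 = -1]
    and [4 |h|^2 = 0]. *)
Lemma cubic_h : h = 0.
Proof.
apply/eqP; apply: contraT => h0.
have hc0 : dot b1 a1 != 0 by rewrite dotC conjC_eq0.
have ra : dot a2 b1 = 0.
  apply: (mulIf hc0); apply: (eq_of_sub (eq_scale (- 1) Q32)).
  by rewrite /gram2 zb2a1 zb2b1 z21; ring.
have rb := dotC0 ra.
have be0 : be = 0.
  apply/eqP; rewrite -conjC_eq0; apply/eqP; apply: (mulIf (mulf_neq0 n30 hc0)).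
  apply: (eq_of_sub (eq_scale (- 1) H43)).
  by rewrite /D4 /gram2 b2E !dotZr z21 H31 z3b ra H32 z23 -/n3; ring.
have b20 : b2 = 0 by rewrite b2E be0 scale0r.
have q0 : dot a1 a1 * dot b1 b1 - h * h^* = t.
  by rewrite -Q0 /gram2 (dotC a1 b1).
have h44 : n3 * dot b1 b1 = 1.
  by apply: (eq_of_sub H44); rewrite /D4 /gram2 be0 conjC0 z3b -/n3; ring.
have q33 : dot a2 a2 * dot b1 b1 = t.
  by apply: (eq_of_sub Q33); rewrite /gram2 b20 !(dot0l, dot0r) ra; ring.
have h22 : dot a2 a2 + t = 6 by rewrite -H22 b20 dot0l addr0.
have m1E : 2 * dot b1 b1 = t - 1.
  apply: (eq_of_sub (eq_add (eq_scale (- dot b1 b1) (eq_add h22 (eq_scale (- 1) H33)))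
    (eq_add q33 (eq_scale (- 1) h44)))); rewrite /n3; ring.
have E : (t - 2) * (t - 3) = 0.
  apply: (eq_of_sub (eq_add (eq_scale (- 2) h44) (eq_add (eq_scale n3 m1E)
    (eq_scale (t - 1) H33)))); rewrite /n3; ring.
have hh : 0 < h * h^* by rewrite mul_conjC_gt0.
move/eqP: E; rewrite mulf_eq0 !subr_eq0 => /orP[] /eqP tE.
  have E4 : 4 * (h * h^*) = - 1.
    apply: (eq_of_sub (eq_add (eq_scale (- 4) q0) (eq_add (eq_scale (4 * dot b1 b1) H11)
      (eq_scale (7 - 2 * dot b1 b1) m1E)))).
    by rewrite tE; ring.
  have : 0 < 4 * (h * h^*) by rewrite mulr_gt0.
  by rewrite E4 oppr_gt0 ltr10.
have E4 : 4 * (h * h^*) = 0.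
  apply: (eq_of_sub (eq_add (eq_scale (- 4) q0) (eq_add (eq_scale (4 * dot b1 b1) H11)
      (eq_scale (6 - 2 * dot b1 b1) m1E)))).
  by rewrite tE; ring.
have : 0 < 4 * (h * h^*) by rewrite mulr_gt0.
by rewrite E4 ltxx.
Qed.

Let zh : dot a1 b1 = 0 := cubic_h.
Let zhb := dotC0 zh.
Let T := dot a1 a1.
Let s := dot b1 b1.
Let n2 := dot a2 a2.
Let r' := dot b1 a2.
Let y := be * be^* * n3.

Let sE : s = 4 - T. Proof. by apply: (eq_of_sub H11); rewrite /s /T; ring. Qed.
Let tE : t = T * (4 - T).
Proof. by rewrite -sE -Q0 /gram2 zh zhb mul0r subr0. Qed.
Let n3E : n3 = (T - 2) ^+ 2.
Proof. by apply: (eq_of_sub H33); rewrite tE /n3; ring. Qed.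
Let yE : dot b2 b2 = y.
Proof. by rewrite b2E dotZl dotZr mulrA. Qed.
Let n2E : n2 = T ^+ 2 - 4 * T + 6 - y.
Proof. by apply: (eq_of_sub H22); rewrite yE tE /n2; ring. Qed.
Let T0 : T != 0. Proof. by apply: contraNneq t0 => T0; rewrite tE T0 mul0r. Qed.
Let minor : n2 * s - r * r' = t - y * T.
Proof.
apply: (eq_of_sub Q33); rewrite /gram2 yE zb2a1 zb2b1 zb2a2 -/n2 -/s -/r -/r' -/T b2E !dotZr.
by rewrite z13 z23 -/r zb3 z12; ring.
Qed.
Let h44 : n3 * s + y * n2 - n3 * (be * r + be^* * r') = 1.
Proof.
apply: (eq_of_sub H44); rewrite /D4 /gram2 z3b H32 z23 zb3 -/n3 -/s -/r -/n2 -/r' /y; ring.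
Qed.

(** At [w = 1] the determinant is a polynomial of degree 4 in [z]. Adding its values at 1 and -1,
    and at 2 and -2, isolates the coefficients of [z^2] and [z^4]. *)
Lemma cubic_gram :
  9 * n3 * s + 16 * y * n2 - 12 * (n3 * (be * r + be^* * r')) + T * s * y
    + T * (n2 * s - r * r') = 6 * t
  /\ (n3 + T * y) * (n2 * s - r * r') = t.
Proof.
have G z := gram_det_expand 1 be (erefl T) (erefl s) (erefl n2) (erefl n3) (erefl r) (erefl r')
   z12 z13 zh z23 z3b z 1.
have G' z : gram_det a1 a2 (1 *: a3) 0 b1 (be *: a3) 0 0 z 1 = t * (1 + z) ^+ 4.
  by rewrite scale1r -b2E.
have {G'}G z := etrans (esym (G' z)) (G z).
pose Q2 := 9 * n3 * s + 16 * y * n2 - 12 * (n3 * (be * r + be^* * r')) + T * s * y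
  + T * (n2 * s - r * r').
pose Q4 := (n3 + T * y) * (n2 * s - r * r').
have Q00 : T * s = t by rewrite tE sE.
have e1 : Q2 + Q4 = 7 * t.
  apply: (mulfI (_ : 2 != 0 :> C)); first by rewrite pnatr_eq0.
  have := eq_add (G 1) (G (-1)); rewrite !conjC1 Q00 -/y => E.
  by apply: (eq_of_sub (eq_scale (- 1) E)); rewrite /Q2 /Q4 /y Q00; ring.
have e2 : 4 * Q2 + 16 * Q4 = 40 * t.
  apply: (mulfI (_ : 2 != 0 :> C)); first by rewrite pnatr_eq0.
  have := eq_add (G 2) (G (-2)); rewrite !conjC1 Q00 -/y => E.
  by apply: (eq_of_sub (eq_scale (- 1) E)); rewrite /Q2 /Q4 /y Q00; ring.
have q4 : Q4 = t.
  apply: (mulfI (_ : 12 != 0 :> C)); first by rewrite pnatr_eq0.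
  by apply: (eq_of_sub (eq_add e2 (eq_scale (- 4) e1))); ring.
by split=> //; apply: (eq_of_sub (eq_add e1 (eq_scale (- 1) q4))); rewrite /Q2; ring.
Qed.

(** [E2], [h44] and [minor] give a quadratic equation for [y]. Its other root turns [E4] into
    [(T - 2)^3 T (T + 2) = 0], and [T = 2] would mean [a3 = 0]. *)
Lemma cubic_y : y = 3 - T.
Proof.
have [E2 E4] := cubic_gram.
have E : (y - (3 - T)) * (2 * y - (T ^+ 2 - 4 * T + 6)) = 0.
  apply: (mulfI (_ : 2 != 0 :> C)); first by rewrite pnatr_eq0.
  apply: (eq_of_sub (eq_scale (- 1) (eq_add E2 (eq_add (eq_scale (- 12) h44) (eq_scale (- T) minor))))).
  by rewrite tE sE n2E n3E; ring.
move/eqP: E; rewrite mulf_eq0 subr_eq0 => /orP[/eqP //|/eqP E].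
have Fv : (T - 2) ^+ 3 * (T * (T + 2)) = 0.
  rewrite minor in E4.
  have E5 : T * ((n3 + T * y) * (4 - T - y) - (4 - T)) = 0.
    by apply: (eq_of_sub E4); rewrite tE; ring.
  move/eqP: E5; rewrite mulf_eq0 (negPf T0) n3E => /eqP E5.
  apply: (eq_of_sub (eq_add (eq_scale (- 4) E5)
    (eq_scale (2 * (T * (4 - T) - (T - 2) ^+ 2 - T * y) - T * (T ^+ 2 - 4 * T + 6)) E))).
  by ring.
have T2 : T + 2 != 0.
  by rewrite gt_eqF // ltr_wpDl ?dot_ge0 // ltr0n.
move/eqP: Fv; rewrite mulf_eq0 expf_eq0 /= mulf_eq0 (negPf T0) (negPf T2) !orbF => /eqP T2'.
by move: n30; rewrite n3E T2' expr0n eqxx.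
Qed.

(** The parameter is [|a1|^2]. If [be = 0], that is [T = 3], the vector [a3] is already a unit
    vector and serves as [f2]; otherwise [f2] is the direction of [b2], and [th] is the phase of
    [be]. *)
Lemma cubic_normal_form : exists T' : R, t = (T' * (4 - T'))%:C%C /\ normal_form T' a1 a2 a3 b1 b2.
Proof.
have yT := cubic_y.
have TR : T = (complex.Re T)%:C%C by rewrite RRe_real // ger0_real ?dot_ge0.
pose T' := complex.Re T.
have Tgt : 0 < T by rewrite lt_def T0 dot_ge0.
have y_ge0 : 0 <= y by rewrite mulr_ge0 ?mul_conjC_ge0 // dot_ge0.
have T'b : 0 < T' <= 3.
  rewrite -ltcR -lecR -TR Tgt /=.
  by have -> : 3%:R%:C%C = 3 :> C; [rewrite rmorph_nat | rewrite -subr_ge0 -yT].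
have yR : y = (3 - T')%:C%C by rewrite yT TR rmorphB /= rmorph_nat.
have n2E' : n2 = T ^+ 2 - 3 * T + 3 by rewrite n2E yT; ring.
have rrE : r * r' = (3 - T) * (T - 2) ^+ 2.
  by apply: (eq_of_sub (eq_scale (- 1) minor)); rewrite n2E' sE yT tE; ring.
have T'E : (T' ^+ 2 - 3 * T' + 3)%:C%C = T ^+ 2 - 3 * T + 3 :> C.
  by rewrite rmorphD rmorphB rmorphXn rmorphM /= !rmorph_nat -TR.
have s'E : (4 - T')%:C%C = s by rewrite rmorphB /= rmorph_nat -TR sE.
exists T'; split; first by rewrite rmorphM /= s'E -TR tE sE.
pose pt : C := (`|T' - 2|)%:C%C; pose ry : C := (Num.sqrt (3 - T'))%:C%C.
have [_ T'3] := andP T'b.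
have ry2 : ry * ry = y by rewrite sqrtC_sq ?subr_ge0 // yR.
have pt2 : pt * pt = n3.
  rewrite /pt -rmorphM -expr2 real_normK ?num_real // n3E TR.
  by rewrite rmorphXn rmorphB /= rmorph_nat.
have ryc : ry^* = ry := conj_realC _; have ptc : pt^* = pt := conj_realC _.
have ptry : (Num.sqrt (3 - T') * `|T' - 2|)%:C%C = ry * pt by rewrite rmorphM.
have a2n : dot a2 a2 = (T' ^+ 2 - 3 * T' + 3)%:C%C by rewrite T'E -n2E'.
have b1n : dot b1 b1 = (4 - T')%:C%C by rewrite s'E.
have [be0|be0] := eqVneq be 0.
  have T3 : T' = 3.
    by apply/eqP; rewrite eq_sym -subr_eq0 -(inj_eq (@complexI R)) -yR /y be0 !mul0r.
  have T3' : T = 3 by rewrite TR -/T' T3 rmorph_nat.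
  have n31 : n3 = 1 by rewrite n3E T3'; ring.
  have r0 : r = 0.
    by apply/eqP; rewrite -mul_conjC_eq0 /r -dotC -/r -/r' rrE T3' subrr mul0r.
  apply: (@normal_form_intro R m T' a1 a2 a3 b1 b2 1 a3) => //.
  - by rewrite conjC1 mulr1.
  - rewrite scale1r T3; have -> : 3 - 2 = 1 :> R by ring.
    by rewrite normr1 scale1r.
  - by rewrite b2E be0 T3 subrr sqrtr0 !scale0r.
  - by rewrite mul1r -/r r0 T3 subrr sqrtr0 mul0r.
have y0 : y != 0 by rewrite !mulf_neq0 ?conjC_eq0.
have ry0 : ry != 0 by apply: contraNneq y0 => ry0; rewrite -ry2 ry0 mulr0.
(* [be r] has real part [y] by [h44] and modulus [y] by [rrE]. *)
have br : be * r = y.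
  have E1 : be * r + be^* * r' = 2 * y.
    apply: (mulfI n30); apply: (eq_of_sub (eq_scale (- 1) h44)).
    by rewrite n2E' sE yT n3E; ring.
  apply/eqP; rewrite -subr_eq0 -mul_conjC_eq0; apply/eqP.
  have yc : y^* = y by rewrite -ry2 rmorphM /= ryc.
  have -> : (be * r - y)^* = be^* * r' - y by rewrite rmorphB rmorphM /= yc /r' (dotC a2 b1).
  apply: (eq_of_sub (eq_add (eq_scale (be * be^*) rrE) (eq_scale (- y) E1))).
  by rewrite -n3E -yT /y; ring.
apply: (@normal_form_intro R m T' a1 a2 a3 b1 b2 (be * pt / ry) (ry^-1 *: b2)) => //.
- rewrite !rmorphM /= fmorphV /= ryc ptc.
  transitivity (be * be^* * (pt * pt) / (ry * ry)); first by field.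
  by rewrite pt2 ry2 -/y mulfV.
- rewrite b2E !scalerA; congr (_ *: _); rewrite -/pt; field.
  by [].
- by rewrite scalerA -/ry mulfV // scale1r.
- by rewrite dotZl dotZr fmorphV /= ryc yE -ry2; field.
- by rewrite dotZl zb2a1 mulr0.
- by rewrite dotZl zb2a2 mulr0.
- by rewrite dotZl zb2b1 mulr0.
- rewrite ptry; apply: (mulIf ry0); apply: (eq_of_sub (eq_add (eq_scale pt br) (eq_scale (- pt) ry2))).
  by rewrite -/r; field.
Qed.

End CubicCoefficients.

(** * Vanishing Pluecker coefficients beyond degree 4 *)

Section VectorIdentities.
Variable R : realType.
Local Notation C := R[i].
Variable m : nat.
Variables (V0 : 'M[C]_(2, m)) (A : nat -> 'M[C]_(2, m)) (t : C).
Hypothesis bA : base_coefs V0 A.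

Let a (k : nat) := row 0 (A k).
Let b (k : nat) := row 1 (A k).

Lemma row_coef_ge5 i k : (5 <= k)%N -> row i (A k) = 0.
Proof. by have [_ _ _ A5 _] := bA => k5; rewrite A5 // linear0. Qed.

Lemma Dw0 : Dw A 0 = 0.
Proof. by rewrite /Dw big_ord0. Qed.

Lemma Dw1 : Dw A 1 = wedge (a 1%N) (b 1%N).
Proof. by rewrite /Dw big_ord1. Qed.

Lemma Dw2 : Dw A 2 = wedge (a 1%N) (b 2%N) + wedge (a 2%N) (b 1%N).
Proof. by rewrite /Dw big_ord_recl big_ord1. Qed.

Lemma Dw3 : Dw A 3 = wedge (a 1%N) (b 3%N) + (wedge (a 2%N) (b 2%N) + wedge (a 3%N) (b 1%N)).
Proof. by rewrite /Dw 2!big_ord_recl big_ord1. Qed.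

(** The binomial coefficient is 0, so these vectors have norm 0. By the shift in [Dw], the lemmas
    [Dw4] to [Dw7] concern [z^5] to [z^8]. *)
Lemma Dw_ge4 k : (4 <= k)%N -> Dw A k = 0.
Proof.
move=> k4; apply: hdot_eq0.
have := base_dot k k bA; rewrite !row_coef_ge5 ?ltnS // !dot0l !add0r => ->.
by rewrite bin_small ?mulr0.
Qed.

Lemma Dw7 : wedge (a 4%N) (b 4%N) = 0.
Proof.
rewrite -(@Dw_ge4 7) // /Dw !big_ord_recl big_ord0 /=.
rewrite (@row_coef_ge5 1 7) // (@row_coef_ge5 1 6) // (@row_coef_ge5 1 5) //.
rewrite (@row_coef_ge5 0 7) // (@row_coef_ge5 0 6) // (@row_coef_ge5 0 5) //.
by rewrite !wedge0l !wedge0r !add0r !addr0.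
Qed.

Lemma Dw6 : wedge (a 3%N) (b 4%N) + wedge (a 4%N) (b 3%N) = 0.
Proof.
rewrite -(@Dw_ge4 6) // /Dw !big_ord_recl big_ord0 /=.
rewrite (@row_coef_ge5 1 6) // (@row_coef_ge5 1 5) //.
rewrite (@row_coef_ge5 0 6) // (@row_coef_ge5 0 5) //.
by rewrite !wedge0l !wedge0r !add0r !addr0.
Qed.

Lemma Dw5 : wedge (a 2%N) (b 4%N) + (wedge (a 3%N) (b 3%N) + wedge (a 4%N) (b 2%N)) = 0.
Proof.
rewrite -(@Dw_ge4 5) // /Dw !big_ord_recl big_ord0 /=.
rewrite (@row_coef_ge5 1 5) // (@row_coef_ge5 0 5) //.
by rewrite !wedge0l !wedge0r !add0r !addr0.
Qed.

Lemma Dw4 : wedge (a 1%N) (b 4%N)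
  + (wedge (a 2%N) (b 3%N) + (wedge (a 3%N) (b 2%N) + wedge (a 4%N) (b 1%N))) = 0.
Proof. by rewrite -(@Dw_ge4 4) // /Dw !big_ord_recl big_ord0 /= addr0. Qed.

Lemma gram_det_base z w : gram4 (pcurve A z) (dcurve A z) (pcurve A w) (dcurve A w) =
  gram_det (a 1%N) (a 2%N) (a 3%N) (a 4%N) (b 1%N) (b 2%N) (b 3%N) (b 4%N) z w.
Proof.
pose X i z := z *: row i (A 1%N) + z ^+ 2 *: row i (A 2%N) + z ^+ 3 *: row i (A 3%N)
  + z ^+ 4 *: row i (A 4%N).
pose Y i z := row i (A 1%N) + (2 * z) *: row i (A 2%N) + (3 * z ^+ 2) *: row i (A 3%N)
  + (4 * z ^+ 3) *: row i (A 4%N).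
have [/onb_rowsP V1 A0 _ _ _] := bA.
have pE i x : row i (pcurve A x) = row i V0 + X i x.
  rewrite /pcurve !big_ord_recr big_ord0 /= A0 add0r expr0 expr1 scale1r !linearD !linearZ /=.
  by rewrite /X !addrA.
have dE i x : row i (dcurve A x) = Y i x.
  by rewrite /dcurve !linearD !linearZ /=.
have VX i j x : dot (row i V0) (X j x) = 0.
  by rewrite /X !(dotDr, dotZr) !(base_orthC _ _ bA) // !mulr0 !addr0.
have VY i j x : dot (row i V0) (Y j x) = 0.
  by rewrite /Y !(dotDr, dotZr) !(base_orthC _ _ bA) // !mulr0 !addr0.
have dd (e e' x y : 'rV[C]_m) c : dot e e' = c -> dot e y = 0 -> dot e' x = 0 ->
    dot (e + x) (e' + y) = c + dot x y.
  by move=> E h1 /dotC0 h2; rewrite dotDl !dotDr E h1 h2 addr0 add0r.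
have d1 i x y : dot (row i V0 + X i x) (row i V0 + X i y) = 1 + dot (X i x) (X i y).
  by apply: dd => //; rewrite V1 eqxx.
have d01 x y : dot (row 0 V0 + X 0 x) (row 1 V0 + X 1 y) = dot (X 0 x) (X 1 y).
  by rewrite (dd _ _ _ _ 0) ?add0r // V1.
have d10 x y : dot (row 1 V0 + X 1 x) (row 0 V0 + X 0 y) = dot (X 1 x) (X 0 y).
  by rewrite (dd _ _ _ _ 0) ?add0r // V1.
have d2 i j x y : dot (row i V0 + X i x) (Y j y) = dot (X i x) (Y j y).
  by rewrite dotDl VY add0r.
have d3 i j x y : dot (Y i x) (row j V0 + X j y) = dot (Y i x) (X j y).
  by rewrite dotDr (dotC0 (VY _ _ _)) add0r.
have -> : gram_det (a 1%N) (a 2%N) (a 3%N) (a 4%N) (b 1%N) (b 2%N) (b 3%N) (b 4%N) z w =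
  det4 (1 + dot (X 0 z) (X 0 w)) (dot (X 0 z) (X 1 w)) (dot (X 0 z) (Y 0 w)) (dot (X 0 z) (Y 1 w))
       (dot (X 1 z) (X 0 w)) (1 + dot (X 1 z) (X 1 w)) (dot (X 1 z) (Y 0 w)) (dot (X 1 z) (Y 1 w))
       (dot (Y 0 z) (X 0 w)) (dot (Y 0 z) (X 1 w)) (dot (Y 0 z) (Y 0 w)) (dot (Y 0 z) (Y 1 w))
       (dot (Y 1 z) (X 0 w)) (dot (Y 1 z) (X 1 w)) (dot (Y 1 z) (Y 0 w)) (dot (Y 1 z) (Y 1 w)).
  by [].
clearbody X Y; rewrite gram4E; congr (det4 _ _ _ _ _ _ _ _ _ _ _ _ _ _ _ _); rewrite ?pE ?dE;
  by rewrite ?(d1, d01, d10, d2, d3).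
Qed.

End VectorIdentities.

(** * The equations between the coefficients *)

Section CoefficientEquations.
Variable R : realType.
Local Notation C := R[i].
Variable m : nat.
Variables (V0 : 'M[C]_(2, m)) (A : nat -> 'M[C]_(2, m)) (t : C).
Hypothesis bA : base_coefs V0 A.
Hypothesis tA : tau A = t.
Hypothesis t0 : t != 0.
Hypothesis gram : forall z w, gram4 (pcurve A z) (dcurve A z) (pcurve A w) (dcurve A w)
  = t * (1 + z * w^*) ^+ 4.

Let a1 := row 0 (A 1%N).
Let a2 := row 0 (A 2%N).
Let a3 := row 0 (A 3%N).
Let a4 := row 0 (A 4%N).
Let b1 := row 1 (A 1%N).
Let b2 := row 1 (A 2%N).
Let b3 := row 1 (A 3%N).
Let b4 := row 1 (A 4%N).
(** [G3] is the product with [Dw A 3]; [P2] is the product with the coefficient of [z^2] in the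
    Pluecker vector of the derivative. *)
Let G3 x y := gram2 a1 b3 x y + (gram2 a2 b2 x y + gram2 a3 b1 x y).
Let P2 x y := 3 * gram2 a1 b3 x y + 4 * gram2 a2 b2 x y + 3 * gram2 a3 b1 x y.

Let tr : t^* = t. Proof. by rewrite -tA /tau -hdotC. Qed.

Let h2l (I : finType) (p q x : {ffun I -> C}) : hdot (p + q) x = hdot p x + hdot q x.
Proof. exact: hdotDl. Qed.
Let h2r (I : finType) (p q x : {ffun I -> C}) : hdot x (p + q) = hdot x p + hdot x q.
Proof. exact: hdotDr. Qed.
Let h3l (I : finType) (p q r x : {ffun I -> C}) :
  hdot (p + (q + r)) x = hdot p x + (hdot q x + hdot r x).
Proof. by rewrite !hdotDl. Qed.
Let h3r (I : finType) (p q r x : {ffun I -> C}) :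
  hdot x (p + (q + r)) = hdot x p + (hdot x q + hdot x r).
Proof. by rewrite !hdotDr. Qed.
Let hW (u v x y : 'rV[C]_m) : hdot (wedge u v) (wedge x y) = gram2 u v x y.
Proof. exact: hdot_wedge. Qed.
Let hG3 x y : hdot (Dw A 3) (wedge x y) = G3 x y.
Proof. by rewrite Dw3 h3l !hW. Qed.

Let H11 : dot a1 a1 + dot b1 b1 = 4.
Proof. by have := base_dot 0 0 bA; rewrite Dw0 hdot0l addr0 mul1r. Qed.
Let H21 : dot a2 a1 + dot b2 b1 = 0.
Proof. by have := base_dot 1 0 bA; rewrite Dw0 hdot0r addr0 mul0r. Qed.
Let H31 : dot a3 a1 + dot b3 b1 = 0.
Proof. by have := base_dot 2 0 bA; rewrite Dw0 hdot0r addr0 mul0r. Qed.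
Let H41 : dot a4 a1 + dot b4 b1 = 0.
Proof. by have := base_dot 3 0 bA; rewrite Dw0 hdot0r addr0 mul0r. Qed.
Let Q0 : gram2 a1 b1 a1 b1 = t.
Proof. by rewrite -hW. Qed.
Let H22 : dot a2 a2 + dot b2 b2 + t = 6.
Proof. by have := base_dot 1 1 bA; rewrite Dw1 hW Q0 mul1r. Qed.
Let H32 : dot a3 a2 + dot b3 b2 + (gram2 a1 b2 a1 b1 + gram2 a2 b1 a1 b1) = 0.
Proof. by have := base_dot 2 1 bA; rewrite Dw1 Dw2 h2l !hW mul0r. Qed.
Let H42 : dot a4 a2 + dot b4 b2 + G3 a1 b1 = 0.
Proof. by have := base_dot 3 1 bA; rewrite Dw1 hG3 mul0r. Qed.
Let H43 : dot a4 a3 + dot b4 b3 + (G3 a1 b2 + G3 a2 b1) = 0.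
Proof. by have := base_dot 3 2 bA; rewrite Dw2 h2r !hG3 mul0r. Qed.
Let H44 : dot a4 a4 + dot b4 b4 + (G3 a1 b3 + (G3 a2 b2 + G3 a3 b1)) = 1.
Proof. by have := base_dot 3 3 bA; rewrite {2}Dw3 h3r !hG3 mul1r. Qed.

Let osc := osculating_orth bA tr gram.
Let Q32 : gram2 a1 b2 a1 b1 + gram2 a2 b1 a1 b1 = 0.
Proof. by have [E _ _ _ _] := osc; move: E; rewrite h2l !hW. Qed.
Let Q33 : gram2 a1 b2 a1 b2 + gram2 a1 b2 a2 b1 + (gram2 a2 b1 a1 b2 + gram2 a2 b1 a2 b1) = t.
Proof. by have [_ _ _ E _] := osc; move: E; rewrite h2l !h2r !hW. Qed.
Let q3 (c1 c2 c3 : C) (p q r x : {ffun pair_idx m -> C}) :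
  hdot (c1 *: p + c2 *: q + c3 *: r) x = c1 * hdot p x + c2 * hdot q x + c3 * hdot r x.
Proof. by rewrite !hdotDl !hdotZl. Qed.
Let Q22 : P2 a1 b1 = 0.
Proof. by have [_ E _ _ _] := osc; move: E; rewrite q3 !hW. Qed.
Let Q42 : 8 * gram2 a2 b4 a1 b1 + 9 * gram2 a3 b3 a1 b1 + 8 * gram2 a4 b2 a1 b1 = 0.
Proof. by have [_ _ E _ _] := osc; move: E; rewrite q3 !hW. Qed.
Let Q23 : P2 a1 b2 + P2 a2 b1 = 0.
Proof. by have [_ _ _ _ E] := osc; move: E; rewrite h2r !q3 !hW. Qed.
Let H33 : dot a3 a3 + dot b3 b3 + t = 4.
Proof.
by have := base_dot 2 2 bA; rewrite Dw2 h2l !h2r !hW mul1r Q33.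
Qed.
Let gdet z w : gram_det a1 a2 a3 a4 b1 b2 b3 b4 z w = t * (1 + z * w^*) ^+ 4.
Proof. by rewrite -gram (gram_det_base bA). Qed.

Let wD (u v w : 'rV[C]_m) c d : wedge u (c *: v + d *: w) = c *: wedge u v + d *: wedge u w.
Proof. by rewrite wedgeDr !wedgeZr. Qed.
Let wB (u v w : 'rV[C]_m) c : wedge u (v - c *: w) = wedge u v - c *: wedge u w.
Proof. by rewrite -scaleNr wedgeDr wedgeZr scaleNr. Qed.
Let sum2 (V : lmodType C) (c : C) (p q : V) : c *: p + q = 0 -> q - c *: - p = 0.
Proof. by rewrite scalerN opprK addrC. Qed.
Let sum3 (V : lmodType C) (c d : C) (p q r : V) :
  c *: p + (d *: q + r) = 0 -> r - c *: - p - d *: - q = 0.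
Proof. by rewrite !scalerN !opprK => E; rewrite -addrA addrC -addrA. Qed.

(** With [b4 = 0], the vanishing coefficients of [z^7], [z^6] and [z^5] say in turn that [b3],
    [b2 - be a3] and [b1 - be a2 - ga a3] are multiples of [a4], the situation already refuted. *)
Lemma top_coef_eq0 : b4 = 0 -> a4 = 0.
Proof.
move=> b40; apply/eqP; apply: contraT => a40.
have collinear u : wedge a4 u = 0 -> exists c, u = c *: a4 by apply: wedge_eq0_collinear.
have [be b3E] : exists be, b3 = be *: a4.
  by apply: collinear; have := Dw6 bA; rewrite -/a3 -/a4 -/b4 -/b3 b40 wedge0r add0r.
have [ga gaE] : exists ga, b2 - be *: a3 = ga *: a4.
  apply: collinear; have := Dw5 bA; rewrite -/a2 -/a3 -/a4 -/b4 -/b3 -/b2 b40 b3E wedge0r add0r.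
  by rewrite wedgeZr wB (wedgeC a4 a3); apply: sum2.
have b2E : b2 = be *: a3 + ga *: a4 by rewrite -gaE addrC subrK.
have [de deE] : exists de, b1 - be *: a2 - ga *: a3 = de *: a4.
  apply: collinear; have := Dw4 bA.
  rewrite -/a1 -/a2 -/a3 -/a4 -/b4 -/b3 -/b2 -/b1 b40 b3E b2E wedge0r add0r.
  rewrite (wedgeZr _ a4) wD (wedge_self a3) scaler0 (add0r (ga *: _)).
  by rewrite !wB (wedgeC a4 a2) (wedgeC a4 a3); apply: sum3.
have b1E : b1 = be *: a2 + ga *: a3 + de *: a4.
  by rewrite -deE -(addrA b1) -opprD [RHS]addrC subrK.
have GE x y : G3 x y = be * gram2 a1 a4 x y + ga * gram2 a2 a4 x y + de * gram2 a3 a4 x y.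
  by rewrite /G3 /gram2 b3E b2E b1E !(dotDl, dotZl); ring.
have GE4 : G3 a1 b3 + (G3 a2 b2 + G3 a3 b1) = be^* * G3 a1 a4 + ga^* * G3 a2 a4 + de^* * G3 a3 a4.
  transitivity (G3 a1 (be *: a4) + (G3 a2 (be *: a3 + ga *: a4)
    + G3 a3 (be *: a2 + ga *: a3 + de *: a4))); first by rewrite -b3E -b2E -b1E.
  by rewrite /G3 /gram2 !(dotDr, dotZr); ring.
have W40 u x y : gram2 u b4 x y = 0 by rewrite /gram2 b40 !dot0l; ring.
have d4 (x : 'rV[C]_m) : dot b4 x = 0 by rewrite b40 dot0l.
have K31 : dot a3 a1 + be * dot a4 b1 = 0 by rewrite -dotZl -b3E.
have K41 : dot a4 a1 = 0 by move: H41; rewrite d4 addr0.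
have K32 : dot a3 a2 + be * dot a4 b2 + (gram2 a1 b2 a1 b1 + gram2 a2 b1 a1 b1) = 0.
  by rewrite -dotZl -b3E.
have K42 : dot a4 a2 + G3 a1 b1 = 0 by move: H42; rewrite d4 addr0.
have K43 : dot a4 a3 + (G3 a1 b2 + G3 a2 b1) = 0 by move: H43; rewrite d4 addr0.
have K33 : dot a3 a3 + be * be^* * dot a4 a4 + t = 4.
  by rewrite -H33 b3E dotZl dotZr mulrA.
have K44 : dot a4 a4 + (be^* * G3 a1 a4 + ga^* * G3 a2 a4 + de^* * G3 a3 a4) = 1.
  by rewrite -GE4; move: H44; rewrite d4 addr0.
have P2E x y : P2 x y = 3 * G3 x y + gram2 a2 b2 x y by rewrite /P2 /G3; ring.
have K22 : 3 * G3 a1 b1 + gram2 a2 b2 a1 b1 = 0 by rewrite -P2E.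
have K23 : 3 * G3 a1 b2 + gram2 a2 b2 a1 b2 + (3 * G3 a2 b1 + gram2 a2 b2 a2 b1) = 0.
  by rewrite -!P2E.
have Kq42 : be * gram2 a3 a4 a1 b1 = 0.
  apply: (eq_of_sub Q42); rewrite W40 b3E b2E /gram2 !(dotDl, dotZl); ring.
have Kg : gram_det a1 a2 a3 a4 b1 b2 (be *: a4) 0 1 1 = t * 2 ^+ 4.
  by rewrite -b3E -b40 gdet conjC1 mul1r.
rewrite !GE in K42 K43 K44 K22 K23.
have [be0|be0] := eqVneq be 0.
  by exfalso; apply: (@top_coef_be0 R m a1 a2 a3 a4 b1 b2 be ga de t).
by exfalso; apply: (@top_coef_be R m a1 a2 a3 a4 b1 b2 be ga de t).
Qed.

(** [x - y] is real, so both terms are nonnegative. It will be applied to two norms with known sum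
    and Gram determinant. *)
Lemma sub_sqr_norm0 (x y h : C) : 0 <= x -> 0 <= y ->
  (x - y) * (x - y) + 4 * (h * h^*) = 0 -> x = y /\ h = 0.
Proof.
move=> x0 y0 E; have xyr : (x - y) * (x - y) = (x - y) * (x - y)^*.
  by rewrite rmorphB /= !conj_Creal // ger0_real.
have h4 : 0 <= 4 * (h * h^*) by rewrite mulr_ge0 ?ler0n // mul_conjC_ge0.
move/eqP: E; rewrite xyr paddr_eq0 ?mul_conjC_ge0 //.
by rewrite mul_conjC_eq0 mulf_eq0 pnatr_eq0 /= mul_conjC_eq0 subr_eq0 => /andP[/eqP-> /eqP->].
Qed.

Lemma cubic_normal : a4 = 0 -> b4 = 0 -> b3 = 0 ->
  exists T : R, t = (T * (4 - T))%:C%C /\ normal_form T a1 a2 a3 b1 b2.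
Proof.
move=> a40 b40 b30; have d0 (x : 'rV[C]_m) : dot 0 x = 0 by apply: dot0l.
have W0 u x y : gram2 u b3 x y = 0 by rewrite /gram2 b30 !dot0l; ring.
have G0 x y : G3 x y = gram2 a2 b2 x y + gram2 a3 b1 x y by rewrite /G3 W0 add0r.
have K31 : dot a3 a1 = 0 by move: H31; rewrite b30 d0 addr0.
have K32 : dot a3 a2 = 0 by move: H32; rewrite b30 d0 Q32 !addr0.
have K33 : dot a3 a3 + t = 4 by move: H33; rewrite b30 d0 addr0.
have K42 : gram2 a2 b2 a1 b1 + gram2 a3 b1 a1 b1 = 0.
  by move: H42; rewrite a40 b40 !d0 !add0r G0.
have K43 : gram2 a2 b2 a1 b2 + gram2 a3 b1 a1 b2 + (gram2 a2 b2 a2 b1 + gram2 a3 b1 a2 b1) = 0.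
  by move: H43; rewrite a40 b40 !d0 !add0r !G0.
have Gr x : G3 x b3 = 0 by rewrite /G3 /gram2 b30 !dot0r; ring.
have K44 : gram2 a2 b2 a2 b2 + gram2 a3 b1 a2 b2 + (gram2 a2 b2 a3 b1 + gram2 a3 b1 a3 b1) = 1.
  by move: H44; rewrite a40 b40 !d0 !add0r Gr add0r !G0.
have K22 : 4 * gram2 a2 b2 a1 b1 + 3 * gram2 a3 b1 a1 b1 = 0.
  by move: Q22; rewrite /P2 W0 mulr0 add0r.
have [a30|a30] := eqVneq a3 0; last first.
  have [be b2E] : exists be, b2 = be *: a3.
    apply: wedge_eq0_collinear => //.
    have := Dw4 bA; rewrite -/a1 -/a2 -/a3 -/a4 -/b4 -/b3 -/b2 -/b1 a40 b40 b30.
    by rewrite !wedge0r wedge0l addr0 !add0r.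
  have WE x y : gram2 a2 b2 x y = be * gram2 a2 a3 x y by rewrite /gram2 b2E !dotZl; ring.
  have Kg z : gram_det a1 a2 a3 0 b1 b2 0 0 z 1 = t * (1 + z) ^+ 4.
    by have := gdet z 1; rewrite a40 b30 b40 conjC1 mulr1.
  rewrite !WE in K42 K43.
  have K44' : be^* * (be * gram2 a2 a3 a2 a3 + gram2 a3 b1 a2 a3) + (be * gram2 a2 a3 a3 b1 + gram2 a3 b1 a3 b1) = 1.
    apply: (eq_of_sub K44); rewrite !WE b2E /gram2 !dotZr; ring.
  have K22' : 4 * be * gram2 a2 a3 a1 b1 + 3 * gram2 a3 b1 a1 b1 = 0 by rewrite -K22 WE mulrA.
  by have := @cubic_normal_form R m a1 a2 a3 b1 b2 be t; apply.
(* If [a3 = 0], the known sums and Gram determinants make [a1], [b1] orthogonal of equal norm, and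
   likewise [a2], [b2]. This is the member [T = 2]. *)
have t4 : t = 4 by rewrite -K33 a30 d0 add0r.
have q0 : dot a1 a1 * dot b1 b1 - dot a1 b1 * (dot a1 b1)^* = 4.
  by rewrite -dotC -t4 -Q0.
have [n1m1 a1b1] : dot a1 a1 = dot b1 b1 /\ dot a1 b1 = 0.
  apply: sub_sqr_norm0; rewrite ?dot_ge0 //.
  apply: (eq_of_sub (eq_add (eq_scale (dot a1 a1 + dot b1 b1 + 4) H11) (eq_scale (- 4) q0))).
  by ring.
have m1 : dot b1 b1 = 2.
  apply: (mulfI (_ : 2 != 0 :> C)); first by rewrite pnatr_eq0.
  by apply: (eq_of_sub H11); rewrite n1m1; ring.
have h22 : dot a2 a2 + dot b2 b2 = 2 by apply: (eq_of_sub H22); rewrite t4; ring.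
have q44 : dot a2 a2 * dot b2 b2 - dot a2 b2 * (dot a2 b2)^* = 1.
  by rewrite -dotC; apply: (eq_of_sub K44); rewrite a30 /gram2 !(dot0l, dot0r); ring.
have [n2m2 a2b2] : dot a2 a2 = dot b2 b2 /\ dot a2 b2 = 0.
  apply: sub_sqr_norm0; rewrite ?dot_ge0 //.
  apply: (eq_of_sub (eq_add (eq_scale (dot a2 a2 + dot b2 b2 + 2) h22) (eq_scale (- 4) q44))).
  by ring.
have m2 : dot b2 b2 = 1.
  apply: (mulfI (_ : 2 != 0 :> C)); first by rewrite pnatr_eq0.
  by apply: (eq_of_sub h22); rewrite n2m2; ring.
pose p := dot a2 a1.
have b21 : dot b2 b1 = - p by apply/eqP; rewrite -addr_eq0 addrC H21.
have b12 : dot b1 b2 = - p^* by rewrite dotC b21 rmorphN.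
have b1a1 := dotC0 a1b1; have b2a2 := dotC0 a2b2.
(* With the norms known, [Q33] says that a positive combination of three squared moduli is 0. *)
have E : 2 * (p * p^*) + (dot b2 a1 * (dot b2 a1)^* + dot a2 b1 * (dot a2 b1)^*) = 0.
  apply: (eq_of_sub (eq_scale (- 1) Q33)).
  rewrite /gram2 n1m1 n2m2 m1 m2 b21 b12 a1b1 b1a1 a2b2 b2a2 t4 -/p (dotC a2 a1) -/p.
  by rewrite -!dotC; ring.
have [p0 b2a1 a2b1] : [/\ p = 0, dot b2 a1 = 0 & dot a2 b1 = 0].
  have p4 : 0 <= 2 * (p * p^*) by rewrite mulr_ge0 ?ler0n // mul_conjC_ge0.
  move/eqP: E; rewrite paddr_eq0 // ?addr_ge0 ?mul_conjC_ge0 //.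
  rewrite [X in _ && X]paddr_eq0 ?mul_conjC_ge0 //.
  rewrite mulf_eq0 pnatr_eq0 /= !mul_conjC_eq0.
  by move=> /and3P[/eqP-> /eqP-> /eqP->].
exists 2; split.
  have -> : 2 * (4 - 2) = 4 :> R by ring.
  by rewrite t4 rmorph_nat.
have T2 : (4 - 2 : R) = 2 by ring.
have T1 : (3 - 2 : R) = 1 by ring.
apply: (@normal_form_intro R m 2 a1 a2 a3 b1 b2 1 b2) => //.
- by rewrite ltr0n ler_nat.
- by rewrite conjC1 mulr1.
- by rewrite a30 scaler0 subrr normr0 scale0r.
- by rewrite T1 sqrtr1 scale1r.
- by rewrite b21 p0 oppr0.
- by rewrite n1m1 m1 rmorph_nat.
- by rewrite T2 m1 rmorph_nat.
- by apply: dotC0.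
- have -> : 2 ^+ 2 - 3 * 2 + 3 = 1 :> R by ring.
  by rewrite n2m2 m2 rmorph1.
- by rewrite a2b1 subrr normr0 !mulr0.
Qed.

End CoefficientEquations.

(** * Rotating the frame into normal form *)

Section Classification.
Variable R : realType.
Local Notation C := R[i].
Variable m : nat.
Implicit Types (A : nat -> 'M[C]_(2, m)) (t : C) (u : 'M[C]_2).

Lemma det_unitary2 u : u *m u^t* = 1%:M -> \det u * (\det u)^* = 1.
Proof. by move=> uU; rewrite -det_ct -det_mulmx uU det1. Qed.

(** A unit relation between the dependent rows is taken as second row of [u] and completed by an
    orthogonal unit vector. *)
Lemma rotate_row_eq0 (X : 'M[C]_(2, m)) : wedge (row 0 X) (row 1 X) = 0 ->
  exists2 u : 'M[C]_2, u *m u^t* = 1%:M & row 1 (u *m X) = 0.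
Proof.
move=> w0; suff [p [q [N E]]] : exists p q : C, p * p^* + q * q^* = 1 /\
    p *: row 0 X + q *: row 1 X = 0.
  pose u : 'M[C]_2 := \matrix_(i, j) (if i == 0 then (if j == 0 then q^* else - p^*)
                                     else (if j == 0 then p else q)).
  exists u; last by rewrite row_mulmx2 !mxE.
  apply/matrixP => i j; rewrite mulmx_ctE !mxE.
  rewrite /dot !big_ord_recl big_ord0 addr0 !mxE /=.
  case: (ord2P i) => ->; case: (ord2P j) => -> /=.
  - by rewrite rmorphN /= !conjCK mulrNN -N; ring.
  - by rewrite mulNr; ring.
  - by rewrite rmorphN /= !conjCK; ring.
  - by rewrite -N.
have [x0|x0] := eqVneq (row 0 X) 0.
  by exists 1, 0; rewrite conjC1 conjC0 x0 scaler0 scale0r !mulr0 !mulr1 !addr0.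
have [c cE] := wedge_eq0_collinear x0 w0.
have N0 : 0 < c * c^* + 1 by rewrite ltr_wpDl ?mul_conjC_ge0.
pose r := sqrtC (c * c^* + 1).
have r0 : r != 0 by rewrite sqrtC_eq0 gt_eqF.
have rc : r^* = r by rewrite conj_Creal // ger0_real // sqrtC_ge0 ltW.
exists (c / r), (- r^-1); split; last first.
  by rewrite cE scalerA mulNr mulrC scaleNr subrr.
have rr : r * r = c * c^* + 1 by rewrite -expr2 sqrtCK.
rewrite rmorphM rmorphN /= fmorphV /= rc.
by apply: (mulfI (mulf_neq0 r0 r0)); apply: (eq_of_sub (eq_scale (- 1) rr)); field.
Qed.

Lemma base_coefs_rotate (V0 : 'M[C]_(2, m)) A u : u *m u^t* = 1%:M -> base_coefs V0 A ->
  base_coefs (u *m V0) (fun k => u *m A k).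
Proof.
move=> uU [V1 A0 AV A5 wA]; split.
- by rewrite ctM mulmxA -(mulmxA u) V1 mulmx1.
- by rewrite A0.
- by move=> k k0; rewrite ctM mulmxA -(mulmxA u) AV // mulmx0 mul0mx.
- by move=> k k5; rewrite A5 // mulmx0.
have A5' k : (5 <= k)%N -> u *m A k = 0 by move=> k5; rewrite A5 // mulmx0.
have [Q [QE Qw]] := wedge_coef_poly A5; have [Q' [QE' Qw']] := wedge_coef_poly A5'.
have QQ p : Q' p = (\det u)%:P * Q p.
  apply: poly_eq_fun => z; rewrite -QE' hornerM hornerC -QE.
  rewrite -(pcurve_linear _ _ (mulmxDr u) (fun a X => esym (scalemxAr a u X))).
  by rewrite plucker_mul ffunZE.
move=> k l.
have wE i : wedge_coef (fun k => u *m A k) i = \det u *: wedge_coef A i.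
  by rewrite -Qw' -Qw; apply/ffunP => p; rewrite ffunZE !ffunE QQ coefCM.
by rewrite !wE hdotZl hdotZr mulrA det_unitary2 // mul1r wA.
Qed.

Lemma tau_rotate A u : u *m u^t* = 1%:M -> tau (fun k => u *m A k) = tau A.
Proof.
move=> uU; rewrite !tauE ctM mulmxA -(mulmxA u) !det_mulmx det_ct.
by rewrite mulrAC det_unitary2 // mul1r.
Qed.

Lemma pcurve_rotate A u z : pcurve (fun k => u *m A k) z = u *m pcurve A z.
Proof.
by rewrite (pcurve_linear _ _ (mulmxDr u) (fun a X => esym (scalemxAr a u X))).
Qed.

Lemma dcurve_rotate A u z : dcurve (fun k => u *m A k) z = u *m dcurve A z.
Proof. by rewrite /dcurve !mulmxDr -!scalemxAr. Qed.

Lemma gram4_rotate A u z : u *m u^t* = 1%:M ->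
  let B k := u *m A k in
  gram4 (pcurve B z) (dcurve B z) (pcurve B z) (dcurve B z)
    = gram4 (pcurve A z) (dcurve A z) (pcurve A z) (dcurve A z).
Proof.
move=> uU B; rewrite pcurve_rotate dcurve_rotate.
have := gram4_frame u 0 (pcurve A z) (dcurve A z).
by rewrite mul0mx (add0r (u *m dcurve A z)) (det_unitary2 uU) expr1n mul1r.
Qed.

Let gram_at A t := forall z, gram4 (pcurve A z) (dcurve A z) (pcurve A z) (dcurve A z)
  = t * (1 + z * z^*) ^+ 4.

Lemma classify_rotated (V0 : 'M[C]_(2, m)) A t : base_coefs V0 A -> tau A = t -> t != 0 -> gram_at A t ->
  exists (u : 'M[C]_2) (T : R), [/\ u *m u^t* = 1%:M, t = (T * (4 - T))%:C%C,
    u *m A 4%N = 0, row 1 (u *m A 3%N) = 0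
    & normal_form T (row 0 (u *m A 1%N)) (row 0 (u *m A 2%N)) (row 0 (u *m A 3%N))
                    (row 1 (u *m A 1%N)) (row 1 (u *m A 2%N))].
Proof.
move=> bA tA t0 gA.
(* The first rotation kills [b4], and then [a4 = 0] is forced. The coefficient of [z^6] thereby
   reduces to [a_3 /\ b_3], so a second rotation, which keeps [A 4 = 0], kills [b3]. *)
have [u uU b4] := rotate_row_eq0 (Dw7 bA).
pose A1 k := u *m A k; have bA1 := base_coefs_rotate uU bA.
have tA1 : tau A1 = t by rewrite tau_rotate.
have gA1 : gram_at A1 t by move=> z; rewrite gram4_rotate.
have a4 : row 0 (A1 4%N) = 0.
  exact: (top_coef_eq0 bA1 tA1 t0 (gram4_polarized gA1)).
have A14 : A1 4%N = 0 by apply/row_matrixP => i; rewrite linear0; case: (ord2P i) => ->.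
have w3 : wedge (row 0 (A1 3%N)) (row 1 (A1 3%N)) = 0.
  by have := Dw5 bA1; rewrite -/(A1 4%N) A14 linear0 linear0 wedge0l wedge0r add0r addr0.
have [v vU b3] := rotate_row_eq0 w3.
have bA2 := base_coefs_rotate vU bA1.
have gA2 : gram_at (fun k => v *m A1 k) t by move=> z; rewrite gram4_rotate.
have A24 : v *m A1 4%N = 0 by rewrite A14 mulmx0.
have [//|||//|T [tT nT]] := cubic_normal bA2 _ t0 (gram4_polarized gA2).
- by rewrite tau_rotate.
- by rewrite A24 linear0.
- by rewrite A24 linear0.
exists (v *m u), T; rewrite -!mulmxA; split=> //.
by rewrite ctM (mulmxA u) uU mul1mx.
Qed.

Lemma classify (V0 : 'M[C]_(2, m)) A t : base_coefs V0 A -> tau A = t -> t != 0 ->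
    gram_at A t ->
  exists (T : R) (F : 'M[C]_(6, m)),
    [/\ 0 < T <= 3, t = (T * (4 - T))%:C%C, F *m F^t* = 1%:M
      & forall z, rowspan (pcurve A z) = rowspan (sphere_family T z *m F)].
Proof.
move=> bA tA t0 gA; have [u [T [uU tT A4 b3 [T03 [th [f [thU fo [e1 e2 e3] [e4 e5]]]]]]]] :=
  classify_rotated bA tA t0 gA.
have bB := base_coefs_rotate uU bA; move: e1 e2 e3 e4 e5 b3 A4 bB.
pose B k := u *m A k; rewrite -!/(B _); set V := u *m V0 => e1 e2 e3 e4 e5 b3 B4 bB.
have [T0 T3] := andP T03.
have s0 : 0 < 4 - T by rewrite subr_gt0 (le_lt_trans T3) // ltr_nat.
have Vo i j k : dot (row i V) (row j (B k.+1)) = 0 by apply: (base_orthC _ _ bB).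
have cancel c (x y : 'rV[C]_m) : c != 0 -> dot x (c *: y) = 0 -> dot x y = 0.
  by move=> c0 /eqP; rewrite dotZr mulf_eq0 conjC_eq0 (negPf c0) => /eqP.
have real0 (x : R) : x != 0 -> (x%:C%C : C) != 0 by rewrite fmorph_eq0.
have f1 i : dot (row i V) (f 1%N) = 0.
  apply: (cancel (Num.sqrt T)%:C%C); first by rewrite real0 // gt_eqF // sqrtr_gt0.
  by rewrite -e1 dotZr Vo mulr0.
have f2 i : dot (row i V) (f 2%N) = 0.
  apply: (cancel (Num.sqrt (4 - T))%:C%C); first by rewrite real0 // gt_eqF // sqrtr_gt0.
  by rewrite -e4 Vo.
have f3 i : dot (row i V) (f 3%N) = 0.
  apply: (cancel (Num.sqrt (T / (4 - T)))%:C%C).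
    by rewrite real0 // gt_eqF // sqrtr_gt0 divr_gt0.
  have : dot (row i V) (th *: row 0 (B 2%N)) = 0 by rewrite dotZr Vo mulr0.
  by rewrite e2 dotDr dotZr f2 mulr0 add0r.
(* [f 0] is read off [a3], except at [T = 2], where [a3] vanishes and [b2] is used. *)
have f0 i : dot (row i V) (f 0%N) = 0.
  have [T2|T2] := eqVneq T 2.
    apply: (cancel (Num.sqrt (3 - T))%:C%C); last by rewrite -e5 Vo.
    rewrite real0 // T2; have -> : 3 - 2 = 1 :> R by ring.
    by rewrite sqrtr1 oner_eq0.
  apply: (cancel (`|T - 2|)%:C%C); first by rewrite real0 // normr_eq0 subr_eq0.
  by rewrite -e3 dotZr Vo mulr0.
have [/onb_rowsP V1 B0 _ _ _] := bB.
(* The first basis vector absorbs the phase [th]; the matrix [D] below multiplies the first row of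
   the frame by it. *)
pose g k := match k with 0%N => th *: row 0 V | 1%N => row 1 V | k'.+2 => f k' end.
pose F : 'M[C]_(6, m) := \matrix_(i < 6) g i.
exists T, F; split=> //.
  have gf (k : nat) i : (k < 4)%N -> dot (row i V) (f k) = 0.
    by case: k => [|[|[|[|k]]]].
  have g0 k : (k < 4)%N -> dot (th *: row 0 V) (f k) = 0.
    by move=> k4; rewrite dotZl gf ?mulr0.
  have thth : dot (th *: row 0 V) (th *: row 0 V) = 1.
    by rewrite dotZl dotZr V1 mulr1.
  have th01 : dot (th *: row 0 V) (row 1 V) = 0 by rewrite dotZl V1 mulr0.
  have V11 : dot (row 1 V) (row 1 V) = 1 by rewrite V1.
  have gg i j : (i < 6)%N -> (j < 6)%N -> dot (g i) (g j) = (i == j)%:R.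
    case: i => [|[|i]]; case: j => [|[|j]] i6 j6; first
      [ exact: thth | exact: th01 | exact: (dotC0 th01) | exact: V11 | exact: g0 | exact: gf
      | exact/dotC0/g0 | exact/dotC0/gf | exact: fo ].
  apply/matrixP => i j; rewrite mulmx_ctE !rowK gg // [RHS]mxE.
  by [].
move=> z; pose D : 'M[C]_2 := \matrix_(i, j) ((i == j)%:R * (if i == 0 then th else 1)).
have DU : D *m D^t* = 1%:M.
  apply/matrixP => i j; rewrite mulmx_ctE /dot !big_ord_recl big_ord0 addr0 !mxE.
  case: (ord2P i) => ->; case: (ord2P j) => -> /=;
    rewrite !(mul1r, mul0r, mulr0, conjC0, conjC1, addr0, add0r) //.
have unitary_unit (h : 'M[C]_2) : h *m h^t* = 1%:M -> h \in unitmx.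
  by case/mulmx1_unit.
rewrite -(rowspan_mul _ (unitary_unit _ uU)) -pcurve_rotate -(rowspan_mul _ (unitary_unit _ DU)).
congr rowspan; apply/row_matrixP => i.
have rE k : row k (pcurve B z) = row k V + z *: row k (B 1%N) + z ^+ 2 *: row k (B 2%N)
    + z ^+ 3 *: row k (B 3%N).
  have B0' : B 0%N = V by [].
  by rewrite pcurveE B4 scaler0 addr0 B0' !linearD !linearZ.
have fE k : row k (sphere_family T z *m F) = \sum_(l < 6) sphere_family T z k l *: g l.
  by rewrite row_mul mulmx_sum_row; apply: eq_bigr => l _; rewrite mxE rowK.
have DE k (X : 'M[C]_(2, m)) : row k (D *m X) = (if k == 0 then th else 1) *: row k X.
  rewrite row_mulmx2 !mxE; case: (ord2P k) => -> /=;
    by rewrite !(mul1r, mul0r, scale0r, addr0, add0r).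
rewrite DE fE rE !big_ord_recl big_ord0 !mxE.
have cycle (x y s w : 'rV[C]_m) : x + y + s + w = x + (w + (y + s)).
  by rewrite -!addrA; congr (x + _); rewrite [RHS]addrC -addrA.
case: (ord2P i) => -> /=.
  rewrite -[f (0 + 0)%N]/(f 0%N) -[f (0 + bump 0 0)%N]/(f 1%N).
  rewrite -[f (0 + bump 0 (bump 0 0))%N]/(f 2%N).
  rewrite -[f (0 + bump 0 (bump 0 (bump 0 0)))%N]/(f 3%N).
  rewrite scale1r scale0r add0r addr0 !scalerDr !(scalerA th) !(mulrC th) -!(scalerA _ th).
  by rewrite e1 e2 e3 scalerDr !scalerA !(mulrC _ (_%:C)%C) cycle addrA.
rewrite -[f (0 + 0)%N]/(f 0%N) -[f (0 + bump 0 (bump 0 0))%N]/(f 2%N).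
rewrite b3 e4 e5 scaler0 addr0 !scale0r !scale1r !add0r !addr0 !scalerA.
by rewrite !(mulrC _ (_%:C)%C) -addrA; congr (_ + _); apply: addrC.
Qed.

End Classification.
(** * The point at infinity *)

Section AtInfinity.
Variable R : realType.
Local Notation C := R[i].
Variable m : nat.
Implicit Types (f : C -> gr R m) (P Q : pair_idx m -> {poly C}).

(* [(w - z) h w] vanishes near [z], and its derivative at [z] is [h z]. *)
Lemma hasd_punctured_eq0 (h : C -> C) z d : hasd h z d ->
  (\forall w \near (z : C^o), w != z -> h w = 0) -> h z = 0.
Proof.
move=> hd h0; have := hasdM (hasdB (hasd_id z) (hasd_cst z z)) hd.
rewrite subrr mul0r subr0 mul1r addr0 => D.
apply: (hasd_unique D); apply: (hasd_near _ (hasd_cst 0 z)).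
apply: filterS h0 => w; have [->|wz] := eqVneq w z; first by rewrite subrr mul0r.
by move=> ->; rewrite ?mulr0.
Qed.

(** Proportionality of the Pluecker vectors passes to [z0] by continuity of the holomorphic frame,
    and a coordinate of [P] that does not vanish there fixes the factor. *)
Lemma plucker_spans_limit f P z0 : holomorphic_at f z0 -> (exists p, (P p).[z0] != 0) ->
    (forall z V, z != z0 -> rowspan V = val (f z) ->
       exists2 c : C, c != 0 & forall p, plucker V p = c * (P p).[z]) ->
  plucker_spans f P.
Proof.
move=> [F fF] [q q0] H z V; have [->{z}|z1] := eqVneq z z0; last exact: H.
move=> VE; have [Fz FD] := frame_hasd_at fF.
have FH : \forall w \near (z0 : C^o), w != z0 ->
    forall p, plucker (F w) p * (P q).[w] - plucker (F w) q * (P p).[w] = 0.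
  apply: filterS (frame_hasd fF) => w [Fw _] wz p.
  by have [c _ cE] := H w (F w) wz (esym Fw); rewrite !cE; ring.
have E p : plucker (F z0) p * (P q).[z0] = plucker (F z0) q * (P p).[z0].
  apply/eqP; rewrite -subr_eq0; apply/eqP.
  apply: (hasd_punctured_eq0 (hasdB (hasdM (hasd_plucker FD p) (hasd_horner (P q) z0))
    (hasdM (hasd_plucker FD q) (hasd_horner (P p) z0)))).
  by apply: filterS FH => w H' wz; apply: H'.
have [g gE] : exists g : 'M[C]_2, V = g *m F z0 by apply/rowspan_sub; rewrite VE Fz.
have V0 : plucker V != 0 by rewrite -plucker_rowspan_dim VE; apply: (valP (f z0)).
have VP p : plucker V p = plucker V q / (P q).[z0] * (P p).[z0].
  by rewrite gE plucker_mul !ffunZE; apply: (mulIf q0); apply: (eq_of_sub (eq_scale (\det g) (E p))); field.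
exists (plucker V q / (P q).[z0]) => //.
by apply: contra_neq V0 => c0; apply/ffunP => p; rewrite VP c0 mul0r ffunE.
Qed.

(** The Pluecker curve in the coordinate [1/z], as a form of degree 4. *)
Definition reverse_poly P p : {poly C} := \poly_(k < 5) (P p)`_(4 - k).

Lemma reverse_polyE P p z : veronese_poly P -> z != 0 ->
  (reverse_poly P p).[z] = z ^+ 4 * (P p).[z^-1].
Proof.
move=> vP z0; rewrite horner_poly (horner_coef_wide _ (veronese_size p vP)).
rewrite !big_ord_recr !big_ord0 /=; move: (P p) => q.
by rewrite !exprVn; field.
Qed.

(** Away from 0 this is the substitution [z |-> 1/z]. Polynomiality reaches 0 in the first argument,
    and Hermitian symmetry carries this over to the second. *)
Lemma veronese_reverse P : veronese_poly P -> veronese_poly (reverse_poly P).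
Proof.
move=> vP; pose G z w := \sum_p (reverse_poly P p).[z] * ((reverse_poly P p).[w])^*.
have GC z w : G w z = (G z w)^*.
  by rewrite rmorph_sum; apply: eq_bigr => p _ /=; rewrite [RHS]rmorphM /= conjCK mulrC.
have Gp w : polyfun (fun z => G z w).
  apply: polyfun_sum => p; apply: polyfunM; first exact: polyfun_horner.
  exact: polyfun_cst.
have Kp (w : C) : polyfun (fun z => (1 + z * w^*) ^+ 4).
  apply: polyfunX; apply: polyfunD; first exact: polyfun_cst.
  by apply: polyfunM; [exact: polyfun_id | exact: polyfun_cst].
have ext w : (forall z, z != 0 -> G z w = (1 + z * w^*) ^+ 4) ->
    forall z, G z w = (1 + z * w^*) ^+ 4.
  move=> H; apply: (polyfun_eq_cofinite (Gp w) (Kp w) (polyfun_id _) _ H).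
  exact: oner_neq0.
have E1 w : w != 0 -> forall z, G z w = (1 + z * w^*) ^+ 4.
  move=> w0; apply: ext => z z0; rewrite /G.
  under eq_bigr do rewrite !reverse_polyE // rmorphM /= mulrACA.
  rewrite -mulr_sumr vP rmorphXn /= fmorphV /= -!exprMn; congr (_ ^+ _).
  by field; rewrite conjC_eq0 w0 z0.
move=> z w; move: z; apply: ext => z z0.
by rewrite GC E1 // rmorphXn rmorphD rmorphM /= conjC1 conjCK mulrC.
Qed.

Lemma plucker_spans_reverse (phi : sphere R -> gr R m) P :
    plucker_spans (phi \o @chart0 R) P -> veronese_poly P ->
    holomorphic_at (phi \o @chartoo R) 0 ->
  plucker_spans (phi \o @chartoo R) (reverse_poly P).
Proof.
move=> fP vP hol; apply: (plucker_spans_limit hol).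
  exact: veronese_nocz (veronese_reverse vP).
move=> z V z0; rewrite /= /chartoo (negPf z0) => VE.
have [c c0 cE] := fP z^-1 V VE; exists (c / z ^+ 4) => [|p].
  by rewrite mulf_neq0 ?invr_eq0 ?expf_neq0.
by rewrite cE reverse_polyE // mulrA divfK // expf_neq0.
Qed.

Lemma sff_base f P z0 s : plucker_spans f P -> veronese_poly P -> sff_sqnorm_at s f z0 ->
  exists (V0 : 'M[C]_(2, m)) A, [/\ base_coefs V0 A,
    forall z, 1 + z * z0^* != 0 -> val (f z) = rowspan (pcurve A (mobius z0 z))
    & tau A = 6 - s%:C%C].
Proof.
move=> fP vP [F [e [B [cF eE BE sE]]]].
have [[fF _] FV] := (nbhs_singleton cF.1, nbhs_singleton cF.2).
have [A bA fA] := mobius_coefs fP vP FV (esym fF).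
exists (F z0), A; split=> //.
have /(sff_sqnorm_base bA fA s cF erefl) : exists (e : 'I_2 -> C)
    (B : 'I_2 -> 'I_2 -> 'M[C]_(2, m)),
    [/\ forall i j, Defs.induced F z0 (e i) (e j) = (i == j)%:R,
        forall i j, is_sff F z0 (e i) (e j) (B i j)
      & s = \sum_i \sum_j gmetric (F z0) (B i j) (B i j)] by exists e, B.
by move=> ->; rewrite (base_norm2 bA) /tau opprB addrC subrK.
Qed.

Lemma base_sff f z0 s (V0 : 'M[C]_(2, m)) A : base_coefs V0 A ->
    (forall z, 1 + z * z0^* != 0 -> val (f z) = rowspan (pcurve A (mobius z0 z))) ->
  tau A = 6 - s%:C%C -> sff_sqnorm_at s f z0.
Proof.
move=> bA fA tA; have cF := base_chart_frame bA fA.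
have F0 := base_frame_at z0 bA.
have [_ /(_ _)[|e [B [eE BE sE]]]] := sff_sqnorm_base bA fA s cF F0.
  by rewrite (base_norm2 bA) -/(tau A) tA opprB addrC subrK.
by exists (fun z => pcurve A (mobius z0 z)), e, B.
Qed.

End AtInfinity.
(** * The family *)

Section FamilyCoefficients.
Variable R : realType.
Local Notation C := R[i].
Variable m : nat.
Variables (T : R) (X : 'M[C]_(6, m)).
Hypothesis T03 : 0 < T <= 3.
Hypothesis XU : X *m X^t* = 1%:M.
Local Notation "x %:C" := (real_complex R x) : ring_scope.

Let x (j : nat) : 'rV[C]_m := row (inord j) X.
Let y : C := (Num.sqrt (3 - T))%:C.
Let s : C := (Num.sqrt (4 - T))%:C.
Let q : C := (Num.sqrt T)%:C.
Let p : C := (`|T - 2|)%:C.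
Let c4 : C := (Num.sqrt ((3 - T) / (4 - T)) * `|T - 2|)%:C.
Let c5 : C := (Num.sqrt (T / (4 - T)))%:C.

Definition family_coef (k : nat) : 'M[C]_(2, m) :=
  \matrix_(i < 2) nth 0 (nth [::]
    [:: [:: x 0; q *: x 3; c4 *: x 4 + c5 *: x 5; p *: x 2];
        [:: x 1; s *: x 4; y *: x 2; 0]] i) k.

Lemma family_row z :
  row 0 (sphere_family T z *m X)
    = x 0 + z *: (q *: x 3) + z ^+ 2 *: (c4 *: x 4 + c5 *: x 5) + z ^+ 3 *: (p *: x 2)
  /\ row 1 (sphere_family T z *m X) = x 1 + z *: (s *: x 4) + z ^+ 2 *: (y *: x 2).
Proof.
have fE k : row k (sphere_family T z *m X) = \sum_(l < 6) sphere_family T z k l *: x l.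
  by rewrite row_mul mulmx_sum_row; apply: eq_bigr => l _; rewrite mxE /x inord_val.
have s6 (u0 u1 u2 u3 u4 u5 : 'rV[C]_m) :
    u0 + (u1 + (u2 + (u3 + (u4 + (u5 + 0))))) = u0 + u1 + u3 + (u4 + u5) + u2.
  by rewrite addr0 -!addrA; do 2 congr (_ + _); rewrite [LHS]addrC -!addrA.
split; rewrite fE !big_ord_recl big_ord0 !mxE s6 /= ?scale0r ?scale1r ?addr0 ?add0r;
  rewrite !scalerA; [rewrite scalerDr !scalerA|]; by rewrite !(mulrC _ (_%:C)).
Qed.

Lemma pcurve_family z : pcurve family_coef z = sphere_family T z *m X.
Proof.
have [r0 r1] := family_row z; apply/row_matrixP => i.
have add0 (u : 'rV[C]_m) c : u + c *: 0 = u by rewrite scaler0 addr0.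
rewrite pcurveE !linearD !linearZ /= !rowK; case: (ord2P i) => -> /=.
  by apply: etrans (esym r0); apply: (add0 _ (z ^+ 4)).
by apply: etrans (esym r1); apply: etrans (add0 _ (z ^+ 4)) _; apply: (add0 _ (z ^+ 3)).
Qed.

Let T0 : 0 < T. Proof. by have /andP[] := T03. Qed.
Let y0 : 0 <= 3 - T. Proof. by have /andP[_ T3] := T03; rewrite subr_ge0. Qed.
Let s0 : 0 < 4 - T.
Proof. by have /andP[_ T3] := T03; rewrite subr_gt0 (le_lt_trans T3) // ltr_nat. Qed.
Let s1 : s != 0. Proof. by rewrite fmorph_eq0 gt_eqF // sqrtr_gt0. Qed.
Let sq : s * s = 4 - T%:C.
Proof. by rewrite sqrtC_sq ?ltW // rmorphB /= rmorph_nat. Qed.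
Let yq : y * y = 3 - T%:C. Proof. by rewrite sqrtC_sq // rmorphB /= rmorph_nat. Qed.
Let qq : q * q = T%:C. Proof. by rewrite sqrtC_sq ?ltW. Qed.
Let pq : p * p = (T%:C - 2) ^+ 2.
Proof.
rewrite /p -rmorphM -expr2 real_normK ?num_real //.
by rewrite rmorphXn rmorphB /= rmorph_nat.
Qed.
Let c4E : c4 = y * p / s.
Proof. by rewrite /c4 sqrtrM // sqrtrV ?ltW // mulrAC rmorphM /= fmorphV rmorphM. Qed.
Let c5E : c5 = q / s.
Proof. by rewrite /c5 sqrtrM ?(ltW T0) // sqrtrV ?ltW // rmorphM /= fmorphV. Qed.
Let c4s : c4 * s = y * p. Proof. by rewrite c4E divfK. Qed.
Let n2E : c4 * c4 + c5 * c5 = T%:C ^+ 2 - 3 * T%:C + 3.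
Proof.
apply: (mulfI (mulf_neq0 s1 s1)).
transitivity (y * y * (p * p) + q * q); first by rewrite c4E c5E; field.
by rewrite yq pq qq sq; ring.
Qed.
Let yc : y^* = y. Proof. exact: conj_realC. Qed.
Let sc : s^* = s. Proof. exact: conj_realC. Qed.
Let qc : q^* = q. Proof. exact: conj_realC. Qed.
Let pc : p^* = p. Proof. exact: conj_realC. Qed.
Let c4c : c4^* = c4. Proof. exact: conj_realC. Qed.
Let c5c : c5^* = c5. Proof. exact: conj_realC. Qed.

Let xx i j : (i < 6)%N -> (j < 6)%N -> dot (x i) (x j) = (i == j)%:R.
Proof.
by move=> i6 j6; rewrite /x -mulmx_ctE XU mxE -val_eqE /= !inordK.
Qed.

Let a1 : row 0 (family_coef 1) = q *: x 3. Proof. by rewrite rowK. Qed.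
Let a2 : row 0 (family_coef 2) = c4 *: x 4 + c5 *: x 5. Proof. by rewrite rowK. Qed.
Let a3 : row 0 (family_coef 3) = p *: x 2. Proof. by rewrite rowK. Qed.
Let a4 : row 0 (family_coef 4) = 0. Proof. by rewrite rowK. Qed.
Let b1 : row 1 (family_coef 1) = s *: x 4. Proof. by rewrite rowK. Qed.
Let b2 : row 1 (family_coef 2) = y *: x 2. Proof. by rewrite rowK. Qed.
Let b3 : row 1 (family_coef 3) = 0. Proof. by rewrite rowK. Qed.
Let b4 : row 1 (family_coef 4) = 0. Proof. by rewrite rowK. Qed.

Let n1 : dot (q *: x 3) (q *: x 3) = T%:C.
Proof. by rewrite dotZl dotZr xx // qc mulr1 qq. Qed.
Let m1 : dot (s *: x 4) (s *: x 4) = 4 - T%:C.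
Proof. by rewrite dotZl dotZr xx // sc mulr1 sq. Qed.
Let n2 : dot (c4 *: x 4 + c5 *: x 5) (c4 *: x 4 + c5 *: x 5) = c4 * c4 + c5 * c5.
Proof. by rewrite !(dotDl, dotDr, dotZl, dotZr) !xx //= c4c c5c; ring. Qed.
Let r12 : dot (c4 *: x 4 + c5 *: x 5) (s *: x 4) = y * p.
Proof.
by rewrite !(dotDl, dotZl, dotZr) !xx //= sc c4E; field.
Qed.
Let r21 : dot (s *: x 4) (c4 *: x 4 + c5 *: x 5) = y * p.
Proof. by rewrite dotC r12 rmorphM /= yc pc. Qed.

Lemma family_orth k i j : (0 < k)%N -> dot (row i (family_coef k)) (row j (family_coef 0)) = 0.
Proof.
case: k => [//|[|[|[|k]]]] _; rewrite !rowK;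
  case: (ord2P i) => ->; case: (ord2P j) => -> /=;
  by rewrite ?nth_nil ?(dot0l, dotDl, dotZl) ?xx //= ?(mulr0, addr0).
Qed.

(** Only the squares of the radicals and the product [c4 * s = y * p] enter, so the identity becomes
    polynomial in [T]. *)
Lemma hdot_plucker_family z w :
  hdot (plucker (pcurve family_coef z)) (plucker (pcurve family_coef w)) = (1 + z * w^*) ^+ 4.
Proof.
have conjR (c : R) k : (c%:C * w ^+ k)^* = c%:C * w^* ^+ k.
  by rewrite rmorphM rmorphXn /= conj_realC.
have conjR1 (c : R) : (c%:C * w)^* = c%:C * w^* by rewrite rmorphM /= conj_realC.
rewrite hdot_plucker !pcurve_family ctM mulmxA -(mulmxA _ X) XU mulmx1 det2E.
rewrite !mxE !big_ord_recl !big_ord0 !mxE /=.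
rewrite !conjR !conjR1 !conjC0 !conjC1 !(mul0r, mulr0, mul1r, addr0, add0r).
rewrite -/y -/s -/q -/p -/c4 -/c5; set v := w^*.
transitivity ((1 + q * q * (z * v) + (c4 * c4 + c5 * c5) * (z * v) ^+ 2 + p * p * (z * v) ^+ 3)
    * (1 + s * s * (z * v) + y * y * (z * v) ^+ 2)
  - (y * p * z ^+ 3 * v ^+ 2 + c4 * s * z ^+ 2 * v)
    * (y * p * z ^+ 2 * v ^+ 3 + c4 * s * z * v ^+ 2)); first by ring.
rewrite c4s n2E qq sq yq pq.
transitivity ((1 + T%:C * (z * v) + (T%:C ^+ 2 - 3 * T%:C + 3) * (z * v) ^+ 2
    + (T%:C - 2) ^+ 2 * (z * v) ^+ 3) * (1 + (4 - T%:C) * (z * v) + (3 - T%:C) * (z * v) ^+ 2)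
  - y * y * (p * p) * (z * v) ^+ 3 * (1 + z * v) ^+ 2); first by ring.
by rewrite yq pq; ring.
Qed.

Lemma family_base : base_coefs (family_coef 0) family_coef.
Proof.
have A4 k : (4 <= k)%N -> family_coef k = 0.
  move=> k4; apply/matrixP => i j; rewrite !mxE.
  by case: (ord2P i) => -> /=; rewrite nth_default ?mxE.
have A5 k : (5 <= k)%N -> family_coef k = 0 by move=> k5; apply: A4; apply: ltnW.
have [Q [QE Qw]] := wedge_coef_poly A5.
split=> //.
- apply/matrixP => i j; rewrite mulmx_ctE !rowK mxE.
  by case: (ord2P i) => ->; case: (ord2P j) => -> /=; rewrite xx.
- by move=> k k0; apply/orth_rowsP => i j; apply: family_orth.
- move=> k l; rewrite -!Qw; apply: veronese_poly_coef => z w.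
  rewrite -hdot_plucker_family; apply: eq_bigr => e _.
  by rewrite !QE.
Qed.

Lemma gram4_family z :
  gram4 (pcurve family_coef z) (dcurve family_coef z) (pcurve family_coef z) (dcurve family_coef z)
    = (T * (4 - T))%:C * (1 + z * z^*) ^+ 4.
Proof.
rewrite (gram_det_base family_base) a1 a2 a3 a4 b1 b2 b3 b4.
rewrite (@gram_det_expand R m _ _ _ _ p y _ _ _ 1 _ _ n1 m1 n2 _ r12 r21); last first.
- by rewrite dotZr xx // mulr0.
- by rewrite dotDl !dotZl !xx //= !mulr0 addr0.
- by rewrite dotZl dotZr xx //= !mulr0.
- by rewrite dotZl xx //= mulr0.
- by rewrite dotZl dotDr !dotZr !xx //= !mulr0 addr0 mulr0.
- by rewrite xx.
rewrite pc yc n2E !mulr1 yq pq rmorphM rmorphB /= rmorph_nat; set v := z * z^*.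
have ypyp : y * p * (y * p) = (3 - T%:C) * (T%:C - 2) ^+ 2 by rewrite mulrACA yq pq.
rewrite ypyp.
transitivity (T%:C * (4 - T%:C) + 4 * T%:C * (4 - T%:C) * v
  + 6 * T%:C * (4 - T%:C) * v ^+ 2 + 4 * T%:C * (4 - T%:C) * v ^+ 3 + T%:C * (4 - T%:C) * v ^+ 4).
  have pypy : p * y * (y * p) = (3 - T%:C) * (T%:C - 2) ^+ 2 by rewrite (mulrC p y).
  by rewrite pypy; ring.
by ring.
Qed.

End FamilyCoefficients.

(** * Geometry of a sphere with normalized Pluecker curve *)

Section VeroneseSpheres.
Variable R : realType.
Local Notation C := R[i].
Variable m : nat.
Implicit Types (f : C -> gr R m) (P Q : pair_idx m -> {poly C}).

Lemma spans_base f P z0 : plucker_spans f P -> veronese_poly P ->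
  exists (V0 : 'M[C]_(2, m)) A, base_coefs V0 A /\
    forall z, 1 + z * z0^* != 0 -> val (f z) = rowspan (pcurve A (mobius z0 z)).
Proof.
move=> fP vP; have [V0 V1 VE] := gr_basis (f z0).
by have [A bA fA] := mobius_coefs fP vP V1 VE; exists V0, A.
Qed.

Lemma spans_holomorphic f P z0 : plucker_spans f P -> veronese_poly P -> holomorphic_at f z0.
Proof.
move=> fP vP; have [V0 [A [bA fA]]] := spans_base z0 fP vP.
by have [fF _] := base_chart_frame bA fA; eexists; apply: fF.
Qed.

(** The differential at [z0] is a nonzero multiple of [A 1], which is orthogonal to the plane and
    has squared norm 4. *)
Lemma spans_immersive f P z0 : plucker_spans f P -> veronese_poly P -> immersive_at f z0.
Proof.
move=> fP vP; have [V0 [A [bA fA]]] := spans_base z0 fP vP.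
have cF := base_chart_frame bA fA; have F0 := base_frame_at z0 bA.
exists (fun z => pcurve A (mobius z0 z)); first by have [] := cF.
have [jet _] := chart_frame_jet bA fA cF F0.
move=> u; rewrite jet => H.
have fV : val (f z0) = rowspan V0 by rewrite fA ?conj_kernel_neq0 // F0.
have [g gE] : exists g : 'M[C]_2, (u * (1 + z0 * z0^*)^-1) *: A 1%N = g *m V0.
  by apply/sub_rowspan => i; rewrite -fV.
have [V1 _ AV _ _] := bA.
have g0 : g = 0.
  by have := congr1 (mulmx^~ (V0^t*)) gE; rewrite -mulmxA V1 mulmx1 -scalemxAl AV // scaler0.
have A1 : A 1%N != 0.
  apply/eqP => A1; have := base_norm1 bA; rewrite A1 /mdot.
  rewrite !linear0 !dot0l addr0 => /eqP.
  by rewrite eq_sym pnatr_eq0.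
move/eqP: gE; rewrite g0 mul0mx scaler_eq0 (negPf A1) orbF mulf_eq0 invr_eq0.
by rewrite (negPf (conj_kernel_neq0 z0)) orbF => /eqP.
Qed.

Lemma spans_gauss f P z0 : plucker_spans f P -> veronese_poly P -> gauss_curvature_at 1 f z0.
Proof.
move=> fP vP; have [F fF] := spans_holomorphic z0 fP vP.
by exists F => //; apply: gauss_veronese fP vP fF.
Qed.

Lemma veronese_max_size P : veronese_poly P -> (\max_p size (P p))%N = 5.
Proof.
move=> vP; apply/eqP; rewrite eqn_leq; apply/andP; split.
  by apply/bigmax_leqP => p _; apply: veronese_size.
have [p p4] : exists p, (P p)`_4 != 0.
  apply: contrapT => H; have := veronese_poly_coef 4 4 vP; rewrite eqxx mul1r binn.
  rewrite (_ : vcoef P 4 = 0) ?hdot0l => [/eqP|]; first by rewrite eq_sym oner_eq0.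
  apply/ffunP => p; rewrite !ffunE; apply/eqP; apply: contraT => p4.
  by exfalso; apply: H; exists p.
apply: leq_trans (leq_bigmax p); rewrite ltnNge; apply: contra p4 => p4.
by rewrite nth_default.
Qed.

Lemma spans_constantly_curved (phi : sphere R -> gr R m) P Q :
    plucker_spans (phi \o @chart0 R) P -> veronese_poly P ->
    plucker_spans (phi \o @chartoo R) Q -> veronese_poly Q ->
  constantly_curved 4 phi.
Proof.
move=> fP vP fQ vQ; split.
- by move=> z; split; [apply: spans_holomorphic fP vP | apply: spans_holomorphic fQ vQ].
- by move=> z; split; [apply: spans_immersive fP vP | apply: spans_immersive fQ vQ].
- by exists 1 => z; split; [apply: spans_gauss fP vP | apply: spans_gauss fQ vQ].
- by exists P; split; [move=> z; apply: veronese_nocz | apply: veronese_max_size | apply: fP].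
- move=> z; have [F fF] := spans_holomorphic z fP vP.
  by exists F => // u v; apply: induced_veronese fP vP fF.
Qed.

Lemma constantly_curved_spans (phi : sphere R -> gr R m) : constantly_curved 4 phi ->
  exists2 Q, plucker_spans (phi \o @chart0 R) Q & veronese_poly Q.
Proof. by move=> [_ _ _ [P [P0 _ fP]] met]; apply: (veronese_of_metric fP P0). Qed.

Lemma pcurve_spans f (V0 : 'M[C]_(2, m)) A : base_coefs V0 A ->
    (forall z, val (f z) = rowspan (pcurve A z)) ->
  exists2 Q, plucker_spans f Q & veronese_poly Q.
Proof.
move=> bA fA; have [_ _ _ A5 _] := bA; have [Q [QE _]] := wedge_coef_poly A5.
exists Q => [z V VE|z w]; last first.
  by rewrite -(plucker_pcurve_norm z w bA); apply: eq_bigr => p _; rewrite !QE.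
have [g gE] : exists g : 'M[C]_2, V = g *m pcurve A z by apply/rowspan_sub; rewrite VE fA.
have pV p : plucker V p = \det g * (Q p).[z] by rewrite gE plucker_mul ffunZE QE.
exists (\det g) => //; have : plucker V != 0.
  by rewrite -plucker_rowspan_dim VE; apply: (valP (f z)).
by apply: contra_neq => g0; apply/ffunP => p; rewrite pV g0 mul0r ffunE.
Qed.

Lemma mobius0 (z : C) : mobius 0 z = z.
Proof. by rewrite /mobius conjC0 mulr0 addr0 divr1 subr0. Qed.

(** [gram4_centre] turns the Gram identity into the value of [tau] at [z0], and S is determined by
    [tau]. *)
Lemma pcurve_sff f (V0 : 'M[C]_(2, m)) A (s : R) z0 : base_coefs V0 A ->
    (forall z, val (f z) = rowspan (pcurve A z)) ->
    (forall z, gram4 (pcurve A z) (dcurve A z) (pcurve A z) (dcurve A z)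
      = (6 - s%:C%C) * (1 + z * z^*) ^+ 4) ->
  sff_sqnorm_at s f z0.
Proof.
move=> bA fA gA; have [Q fQ vQ] := pcurve_spans bA fA.
have [V1 [A' [bA' fA']]] := spans_base z0 fQ vQ.
apply: (base_sff bA' fA'); have := gram4_centre bA fA bA' fA'; rewrite gA => E.
by apply/esym/(mulIf _ E); rewrite expf_neq0 // conj_kernel_neq0.
Qed.

(** Since S is constant, [tau] would vanish at every point of both charts, and the sphere would be
    reducible everywhere, infinity included. *)
Lemma irreducible_tau (phi : sphere R -> gr R m) P s :
    plucker_spans (phi \o @chart0 R) P -> veronese_poly P -> holomorphic phi ->
    has_sff_sqnorm s phi -> irreducible phi ->
  6 - s%:C%C != 0 :> C.
Proof.
move=> fP vP hol sff; apply: contra_not_neq => s6.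
have fQ := plucker_spans_reverse fP vP (hol 0).2; have vQ := veronese_reverse vP.
move=> z; split.
  have [V0 [A [bA fA tA]]] := sff_base fP vP (sff z).1.
  by apply: (reducible_base bA fA); rewrite tA.
have [V0 [A [bA fA tA]]] := sff_base fQ vQ (sff z).2.
by apply: (reducible_base bA fA); rewrite tA.
Qed.

Lemma sphere_classification (phi : sphere R -> gr R m) s :
    constantly_curved 4 phi -> irreducible phi -> has_sff_sqnorm s phi ->
  exists (T : R) (F : 'M[C]_(6, m)), [/\ 0 < T <= 3, s = T ^+ 2 - 4 * T + 6, F *m F^t* = 1%:M
    & forall z, val (phi (chart0 z)) = rowspan (sphere_family T z *m F)].
Proof.
move=> cc irr sff; have [Q fQ vQ] := constantly_curved_spans cc.
have s6 : 6 - s%:C%C != 0 :> C.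
  by apply: irreducible_tau fQ vQ _ sff irr; have [] := cc.
have [V0 [A [bA fA tA]]] := sff_base fQ vQ (sff 0).1.
have fA0 z : val (phi (chart0 z)) = rowspan (pcurve A z).
  by rewrite -[in RHS](mobius0 z) -fA // conjC0 mulr0 addr0 oner_eq0.
have gA z : gram4 (pcurve A z) (dcurve A z) (pcurve A z) (dcurve A z)
    = (6 - s%:C%C) * (1 + z * z^*) ^+ 4.
  have [V1 [A' [bA' fA' tA']]] := sff_base fQ vQ (sff z).1.
  by rewrite (gram4_centre bA fA0 bA' fA') tA'.
have [T [F [T03 tT FU FE]]] := classify bA tA s6 gA.
exists T, F; split=> // [|z]; last by rewrite fA0 FE.
apply: (@complexI R); rewrite rmorphD rmorphB rmorphXn rmorphM /= !rmorph_nat.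
move: tT; rewrite rmorphM rmorphB /= rmorph_nat => tT.
by apply: (eq_of_sub (eq_scale (- 1) tT)); ring.
Qed.

End VeroneseSpheres.

(** * A unitary map exchanging 0 and infinity *)

Section SwapMatrix.
Variable R : realType.
Local Notation C := R[i].
Variable T : R.
Hypothesis T03 : 0 < T <= 3.
Local Notation "x %:C" := (real_complex R x) : ring_scope.

(** With [b] it forms a unit vector, since [(T - 2)^2 + (3 - T) T = 4 - T]. *)
Let a := `|T - 2| / Num.sqrt (4 - T).
Let b := Num.sqrt (3 - T) * Num.sqrt T / Num.sqrt (4 - T).

Definition swap_real : 'M[R]_6 := \matrix_(i, j) nth 0 (nth [::]
  [:: [:: 0; 0; 1; 0; 0; 0]; [:: 0; 0; 0; 0; - a; b]; [:: 1; 0; 0; 0; 0; 0];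
      [:: 0; 0; 0; 0; b; a]; [:: 0; - a; 0; b; 0; 0]; [:: 0; b; 0; a; 0; 0]] i) j.

(* [sphere_family T w *m swap_matrix] is a frame at [w^-1]: it exchanges the two charts. *)
Definition swap_matrix : 'M[C]_6 := map_mx (real_complex R) swap_real.

Let s2 : Num.sqrt (4 - T) ^+ 2 = 4 - T.
Proof. by rewrite sqr_sqrtr //; have /andP[_ T3] := T03; lra. Qed.
Let y2 : Num.sqrt (3 - T) ^+ 2 = 3 - T.
Proof. by rewrite sqr_sqrtr //; have /andP[_ T3] := T03; lra. Qed.
Let q2 : Num.sqrt T ^+ 2 = T.
Proof. by rewrite sqr_sqrtr //; have /andP[T0 _] := T03; lra. Qed.
Let p2 : `|T - 2| ^+ 2 = (T - 2) ^+ 2.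
Proof. by rewrite real_normK ?num_real. Qed.
Let s0 : Num.sqrt (4 - T) != 0.
Proof. by rewrite gt_eqF // sqrtr_gt0; have /andP[_ T3] := T03; lra. Qed.

Let ab : a * a + b * b = 1.
Proof.
have s20 := mulf_neq0 s0 s0; apply: (mulfI s20).
transitivity (`|T - 2| ^+ 2 + Num.sqrt (3 - T) ^+ 2 * Num.sqrt T ^+ 2).
  by rewrite /a /b; field.
by rewrite p2 y2 q2 -expr2 s2; ring.
Qed.

Lemma swap_realK : swap_real *m swap_real^T = 1%:M.
Proof.
apply/matrixP => i j; rewrite !mxE !big_ord_recl big_ord0 !mxE.
case: i => [[|[|[|[|[|[|//]]]]]] ?]; case: j => [[|[|[|[|[|[|//]]]]]] ?] /=;
  rewrite ?(mul0r, mulr0, mul1r, mulr1, addr0, add0r, mulrNN) //.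
all: try (by rewrite ab); try (by rewrite addrC ab); try (by ring).
Qed.

Lemma swap_unitary : swap_matrix *m swap_matrix^t* = 1%:M.
Proof.
have -> : swap_matrix^t* = map_mx (real_complex R) (swap_real^T).
  by apply/matrixP => i j; rewrite !mxE conj_realC.
by rewrite -map_mxM swap_realK map_mx1.
Qed.

Lemma family_swap w : w != 0 ->
  rowspan (sphere_family T w *m swap_matrix) = rowspan (sphere_family T w^-1).
Proof.
(* [sphere_family T w^-1] starts with the identity block, so [G] has to consist of the first two
   columns of the frame on the left. *)
move=> w0; pose g := Num.sqrt (3 - T) * (T - 1).
pose G : 'M[C]_2 := \matrix_(i, j)
  (if i == 0 then (if j == 0 then (`|T - 2|)%:C * w ^+ 3 else g%:C * w ^+ 2)
   else (if j == 0 then (Num.sqrt (3 - T))%:C * w ^+ 2 else - (`|T - 2|)%:C * w)).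
have detG : \det G = - w ^+ 4.
  transitivity (- (`|T - 2| ^+ 2 + Num.sqrt (3 - T) ^+ 2 * (T - 1))%:C * w ^+ 4).
    rewrite det2E !mxE /= /g !(rmorphD, rmorphM, rmorphXn) /=; ring.
  rewrite p2 y2; have -> : (T - 2) ^+ 2 + (3 - T) * (T - 1) = 1 by ring.
  by rewrite rmorph1 mulN1r.
have Gu : G \in unitmx by rewrite unitmxE detG unitfE oppr_eq0 expf_neq0.
rewrite -[RHS](rowspan_mul _ Gu); congr rowspan.
pose y : C := (Num.sqrt (3 - T))%:C; pose s : C := (Num.sqrt (4 - T))%:C.
pose q : C := (Num.sqrt T)%:C; pose p : C := (`|T - 2|)%:C.
have [T0 T3] := andP T03.
have s1 : s != 0 by rewrite fmorph_eq0.
have sq : s ^+ 2 = 4 - T%:C by rewrite /s -rmorphXn s2 rmorphB /= rmorph_nat.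
have yq : y ^+ 2 = 3 - T%:C by rewrite /y -rmorphXn y2 rmorphB /= rmorph_nat.
have qq : q ^+ 2 = T%:C by rewrite /q -rmorphXn q2.
have pq : p ^+ 2 = (T%:C - 2) ^+ 2.
  by rewrite /p -rmorphXn p2 rmorphXn rmorphB /= rmorph_nat.
have y0 : 0 <= 3 - T by lra.
have s0' : 0 <= 4 - T by lra.
have c4E : (Num.sqrt ((3 - T) / (4 - T)) * `|T - 2|)%:C = y * p / s.
  by rewrite sqrtrM // sqrtrV // mulrAC rmorphM /= fmorphV rmorphM.
have c5E : (Num.sqrt (T / (4 - T)))%:C = q / s.
  by rewrite sqrtrM ?(ltW T0) // sqrtrV // rmorphM /= fmorphV.
have aE : a%:C = p / s by rewrite rmorphM /= fmorphV.
have naE : (- a)%:C = - (p / s) by rewrite rmorphN /= aE.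
have bE : b%:C = y * q / s by rewrite !rmorphM /= fmorphV.
have gE : g%:C = y * (T%:C - 1) by rewrite rmorphM rmorphB /= rmorph1.
have gs : (q ^+ 2 - p ^+ 2) = (T%:C - 1) * s ^+ 2 by rewrite qq pq sq; ring.
have ys : y ^+ 2 + 1 = s ^+ 2 by rewrite yq sq; ring.
have py : p ^+ 2 + y ^+ 2 * (T%:C - 1) = 1 by rewrite pq yq; ring.
apply/matrixP => i j; rewrite !mxE !big_ord_recl !big_ord0 !mxE /=.
case: (ord2P i) => ->; case: j => [[|[|[|[|[|[|//]]]]]] ?] /=;
  rewrite ?rmorph0 ?rmorph1 ?c4E ?c5E ?aE ?naE ?bE ?gE -/y -/s -/q -/p
    ?(mul0r, mulr0, mul1r, mulr1, addr0, add0r) //.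
all: try by field; rewrite ?s1 ?w0.
all: try by field; rewrite ?s1.
all: try by field; rewrite ?w0.
- by apply: (eq_of_sub (eq_scale (y * w ^+ 2 / s ^+ 2) gs)); field.
- by apply: (eq_of_sub (eq_scale (- 1) py)); field.
- by apply: (eq_of_sub (eq_scale (p * q * w ^+ 2 / s ^+ 2) ys)); field; rewrite ?s1 ?w0.
- by apply: (eq_of_sub (eq_scale (w * y / s) gs)); field; rewrite ?s1 ?w0.
- by apply: (eq_of_sub (eq_scale (- p / s) ys)); field; rewrite ?s1 ?w0.
Qed.

End SwapMatrix.

(** * Spheres given by the family *)

Section FamilySpheres.
Variable R : realType.
Local Notation C := R[i].
Variable m : nat.

(** Off [z0] the frame satisfies [F z = F z *m V0^t* *m G z], because [G] is normalized by [V0];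
    this persists at [z0], and the inclusion of planes is an equality by dimension. *)
Lemma holomorphic_limit (f : C -> gr R m) z0 (G : C -> 'M[C]_(2, m)) D (V0 : 'M[C]_(2, m)) :
    holomorphic_at f z0 -> hasdM2 G z0 D -> (forall z, G z *m V0^t* = 1%:M) ->
    (forall z, z != z0 -> val (f z) = rowspan (G z)) ->
  val (f z0) = rowspan (G z0).
Proof.
move=> [F fF] GD GV fG; have [F0 FD] := frame_hasd_at fF.
have key : F z0 = F z0 *m V0^t* *m G z0.
  apply/matrixP => i j; apply/eqP; rewrite -subr_eq0 [X in _ - X]mxE; apply/eqP.
  pose h w := F w i j - \sum_k (F w *m V0^t*) i k * G w k j.
  have hD := hasdB (FD i j) (hasd_sum (fun k => hasdM (hasd_mulmx_cst (V0^t*) i k FD) (GD k j))).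
  rewrite -/(h z0); apply: (hasd_punctured_eq0 (h := h) hD).
  apply: filterS (frame_hasd fF) => w [Fw _] wz.
  have [g gE] : exists g : 'M[C]_2, F w = g *m G w by apply/rowspan_sub; rewrite -Fw fG.
  rewrite /h; have -> : \sum_k (F w *m V0^t*) i k * G w k j = F w i j; last by rewrite subrr.
  by rewrite gE -[g *m G w *m _]mulmxA GV mulmx1 [RHS]mxE.
apply/eqP; rewrite eqEdim (eqP (valP (f z0))) F0; apply/andP; split.
  by apply/rowspan_sub; exists (F z0 *m V0^t*).
by apply: leq_trans (dim_span _) _.
Qed.

Lemma rowspan_mulr n (A B : 'M[C]_(2, n)) (X : 'M[C]_(n, m)) :
  rowspan A = rowspan B -> rowspan (A *m X) = rowspan (B *m X).
Proof.
move=> AB; apply/eqP; rewrite eqEsubv; apply/andP; split; apply/rowspan_sub.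
  have [g ->] : exists g : 'M[C]_2, A = g *m B by apply/rowspan_sub; rewrite AB.
  by exists g; rewrite mulmxA.
have [g ->] : exists g : 'M[C]_2, B = g *m A by apply/rowspan_sub; rewrite AB.
by exists g; rewrite mulmxA.
Qed.

Section Family.
Variables (T : R) (X : 'M[C]_(6, m)).
Hypotheses (T03 : 0 < T <= 3) (XU : X *m X^t* = 1%:M).

Lemma swap_orthonormal : swap_matrix T *m X *m (swap_matrix T *m X)^t* = 1%:M.
Proof. by rewrite ctM mulmxA -(mulmxA _ X) XU mulmx1 swap_unitary. Qed.

Lemma family_rowspan_dim z : \dim (rowspan (sphere_family T z *m X)) == 2%N.
Proof.
rewrite plucker_rowspan_dim -pcurve_family; apply/eqP => P0.
have := hdot_plucker_family T03 XU z z; rewrite P0 hdot0l => /esym/eqP.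
by rewrite expf_eq0 /= (negPf (conj_kernel_neq0 z)).
Qed.

Variable phi : sphere R -> gr R m.
Hypothesis phi0 : forall z, val (phi (chart0 z)) = rowspan (sphere_family T z *m X).

Lemma family_infinity : holomorphic_at (phi \o @chartoo R) 0 ->
  forall w, val (phi (chartoo w)) = rowspan (sphere_family T w *m (swap_matrix T *m X)).
Proof.
move=> hol; have off w : w != 0 ->
    val (phi (chartoo w)) = rowspan (sphere_family T w *m (swap_matrix T *m X)).
  move=> w0; rewrite /chartoo (negPf w0) -/(chart0 _) phi0 mulmxA.
  exact/rowspan_mulr/esym/family_swap.
move=> w; have [->|w0] := eqVneq w 0; last exact: off.
have bA := family_base T03 swap_orthonormal.
set A := family_coef T _ in bA.
rewrite -pcurve_family -/A; apply: (@holomorphic_limit (phi \o @chartoo R) 0 (pcurve A) _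
  (A 0%N) hol (hasdM2_pcurve A (hasd_id 0))).
  by move=> z; apply: (base_orth_mul bA).
by move=> z z0; rewrite /A pcurve_family; apply: off.
Qed.

Hypothesis phioo :
  forall w, val (phi (chartoo w)) = rowspan (sphere_family T w *m (swap_matrix T *m X)).

Let phi0' z : val ((phi \o @chart0 R) z) = rowspan (pcurve (family_coef T X) z).
Proof. by rewrite pcurve_family -phi0. Qed.
Let phioo' z :
  val ((phi \o @chartoo R) z) = rowspan (pcurve (family_coef T (swap_matrix T *m X)) z).
Proof. by rewrite pcurve_family -phioo. Qed.

Lemma family_sff : has_sff_sqnorm (T ^+ 2 - 4 * T + 6) phi.
Proof.
have sE : (T * (4 - T))%:C%C = 6 - (T ^+ 2 - 4 * T + 6)%:C%C :> C.
  by rewrite -[6](rmorph_nat (real_complex R)) -rmorphB; congr (_%:C%C); ring.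
move=> z; split.
  apply: (pcurve_sff _ (family_base T03 XU) phi0') => w.
  by rewrite (gram4_family T03 XU) sE.
apply: (pcurve_sff _ (family_base T03 swap_orthonormal) phioo') => w.
by rewrite (gram4_family T03 swap_orthonormal) sE.
Qed.

Lemma family_constantly_curved : constantly_curved 4 phi.
Proof.
have [P fP vP] := pcurve_spans (family_base T03 XU) phi0'.
have [Q fQ vQ] := pcurve_spans (family_base T03 swap_orthonormal) phioo'.
exact: spans_constantly_curved fP vP fQ vQ.
Qed.

(** All the planes lie in the span of the six rows of [X], so fullness bounds [m] above;
    orthonormality of these rows bounds it below. *)
Lemma family_full_size : linearly_full phi -> m = 6%N.
Proof.
pose H : {vspace 'rV[C]_m} := <<[seq row i X | i <- enum 'I_6]>>%VS.
have HX (M : 'M[C]_(2, 6)) : (rowspan (M *m X) <= H)%VS.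
  apply/span_subvP => v; rewrite !inE => vM.
  have [i ->] : exists i, v = row i (M *m X) by case/orP: vM => /eqP ->; eexists.
  rewrite row_mul mulmx_sum_row; apply: memv_suml => l _; apply: memvZ.
  by apply: memv_span; apply: map_f; rewrite mem_enum.
move=> full; have HE : H = fullv.
  apply: full => -[z|]; first by rewrite -/(chart0 z) phi0.
  by have := phioo 0; rewrite /chartoo eqxx => ->; rewrite mulmxA.
apply/eqP; rewrite eqn_leq (mulmx1_min XU) andbT.
have := dim_span [seq row i X | i <- enum 'I_6].
by rewrite -/H HE dimvf dim_matrix size_map size_enum_ord mul1r.
Qed.

End Family.
End FamilySpheres.

(** * Existence, fullness and irreducibility of the members *)

Section FamilyExists.
Variable R : realType.
Local Notation C := R[i].

(** A nonzero Gram determinant means rank 4, hence a nonzero 4 x 4 minor. *)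
Lemma wedge4_gram4 m (V W : 'M[C]_(2, m)) : wedge4_eq0 V W -> gram4 V W V W = 0.
Proof.
move=> H; apply/eqP; apply: contraT; rewrite /gram4; set K := col_mx V W => g0.
have Kfree : row_free K.
  apply/row_freeP; exists (K^t* *m invmx (K *m K^t*)).
  by rewrite mulmxA mulmxV // unitmxE unitfE.
have Kfull : row_full K^T by rewrite /row_full mxrank_tr.
have := fullrowsub_unit Kfull; rewrite unitmxE unitfE.
have -> : rowsub (fullrankfun Kfull) K^T = (colsub (fullrankfun Kfull) K)^T.
  by apply/matrixP => i j; rewrite !mxE.
by rewrite det_tr H eqxx.
Qed.

(** The component of the curve outside [H] is a polynomial that vanishes identically, and so do its
    coefficients. *)
Lemma pcurve_mem m (H : {vspace 'rV[C]_m}) (A : nat -> 'rV[C]_m) :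
  (forall z, pcurve A z \in H) -> forall k, (k < 5)%N -> A k \in H.
Proof.
move=> AH k k5; pose g v := v - projv H v.
have gD u v : g (u + v) = g u + g v by rewrite /g linearD opprD addrACA.
have gZ c v : g (c *: v) = c *: g v by rewrite /g linearZ scalerBr.
have gA z : pcurve (g \o A) z = 0.
  by rewrite -[LHS](pcurve_linear _ _ gD gZ) /g projv_id ?subrr.
suff /eqP : g (A k) = 0 by rewrite subr_eq0 => /eqP ->; apply: memv_proj.
apply/rowP => j; rewrite [RHS]mxE.
apply: (@poly_sum_coef _ 5 (fun k => g (A k) 0 j) (fun=> 0)) => // s.
rewrite [RHS]big1 => [|i _]; last by rewrite mul0r.
transitivity (pcurve (g \o A) s 0 j); last by rewrite gA mxE.
by rewrite summxE; apply: eq_bigr => i _; rewrite [RHS]mxE mulrC.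
Qed.

Variable T : R.
Hypothesis T03 : 0 < T <= 3.

Let XU : (1%:M : 'M[C]_6) *m 1%:M^t* = 1%:M.
Proof. by rewrite trmx1 map_mx1 mulmx1. Qed.

(** The value at infinity is taken from the swapped family at 0; at the other points [family_swap]
    reconciles the two charts. *)
Lemma family_exists : exists phi : sphere R -> gr R 6,
  (forall z, val (phi (chart0 z)) = rowspan (sphere_family T z *m 1%:M)) /\
  (forall w, val (phi (chartoo w)) = rowspan (sphere_family T w *m (swap_matrix T *m 1%:M))).
Proof.
pose span_gr V (h : \dim (rowspan V) == 2%N) : gr R 6 :=
  exist (fun W : {vspace 'rV[C]_6} => is_true (\dim W == 2%N)) (rowspan V) h.
pose phi (p : sphere R) : gr R 6 := match p with
  | Some z => span_gr _ (family_rowspan_dim T03 XU z)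
  | None => span_gr _ (family_rowspan_dim T03 (swap_orthonormal T03 XU) 0) end.
exists phi; split=> // w; rewrite /chartoo; have [->|w0] := eqVneq w 0; first by [].
by rewrite /= mulmxA; apply/rowspan_mulr/esym/family_swap.
Qed.

Variable phi : sphere R -> gr R 6.
Hypothesis phi0 : forall z, val (phi (chart0 z)) = rowspan (sphere_family T z).

Let phi1 z : val (phi (chart0 z)) = rowspan (pcurve (family_coef T 1%:M) z).
Proof. by rewrite pcurve_family mulmx1. Qed.

Lemma family_irreducible : irreducible phi.
Proof.
move=> red; have [red0 _] := red 0.
have cd z := hasdM2_pcurve (family_coef T 1%:M) (hasd_id z).
have /red0 : frame_near (phi \o @chart0 R) 0 (pcurve (family_coef T 1%:M)).
  by apply: filterS (near_chart 0) => z _; split=> [|i j]; [apply: phi1 | apply: hasd_cdiff (cd z i j)].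
rewrite (hasdM2_cderiv (cd 0)) => /wedge4_gram4.
rewrite scale1r (gram4_family T03 XU) conjC0 mulr0 addr0 expr1n mulr1.
have [T0 T3] := andP T03 => /eqP; rewrite fmorph_eq0 mulf_eq0 => /orP[]/eqP; lra.
Qed.

Lemma family_linearly_full : linearly_full phi.
Proof.
move=> H phiH; pose x k : 'rV[C]_6 := row (inord k) 1%:M.
have rH i k : (k < 5)%N -> row i (family_coef T 1%:M k) \in H.
  apply: (pcurve_mem (A := fun k => row i (family_coef T 1%:M k))) => z.
  have -> : pcurve (fun k => row i (family_coef T 1%:M k)) z
      = row i (pcurve (family_coef T 1%:M) z).
    by rewrite !pcurveE !linearD !linearZ.
  by apply: (subvP (phiH (chart0 z))); rewrite phi1 row_rowspan.
have Z c (v : 'rV[C]_6) : c != 0 -> c *: v \in H -> v \in H.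
  by move=> c0 /(memvZ c^-1); rewrite scalerA mulVf // scale1r.
have [T0 T3] := andP T03.
have sqr0 (r : R) : 0 < r -> (Num.sqrt r)%:C%C != 0 :> C.
  by move=> r0; rewrite fmorph_eq0 gt_eqF // sqrtr_gt0.
have s0 : 0 < 4 - T by lra.
have x0 : x 0%N \in H by have := rH 0 0%N isT; rewrite rowK.
have x1 : x 1%N \in H by have := rH 1 0%N isT; rewrite rowK.
have x3 : x 3%N \in H by have := rH 0 1%N isT; rewrite rowK; apply/Z/sqr0.
have x4 : x 4%N \in H by have := rH 1 1%N isT; rewrite rowK; apply/Z/sqr0.
have x2 : x 2%N \in H.
  (* [x 2] occurs in [a3], with a coefficient that vanishes at [T = 2], and in [b2], with one that
     does not vanish there. *)
  have [T2|T2] := eqVneq T 2; last first.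
    have := rH 0 3%N isT; rewrite rowK; apply: Z.
    by rewrite fmorph_eq0 normr_eq0 subr_eq0.
  by have := rH 1 2%N isT; rewrite rowK; apply/Z/sqr0; rewrite T2; lra.
have x5 : x 5%N \in H.
  have := rH 0 2%N isT; rewrite rowK /= rpredDl; last exact: memvZ.
  by apply: Z; apply: sqr0; rewrite divr_gt0.
apply/vspaceP => v; rewrite memvf -[v]mulmx1 mulmx_sum_row memv_suml // => l _.
apply: memvZ; have -> : row l 1%:M = x l by rewrite /x inord_val.
by case: l => [[|[|[|[|[|[|//]]]]]] ?].
Qed.

End FamilyExists.

(** * The two Veronese members *)

Section VeroneseMembers.
Variable R : realType.
Local Notation C := R[i].
Local Notation "x %:C" := (real_complex R x) : ring_scope.

Definition select_mx n (h : 'I_n -> 'I_n) : 'M[C]_n := \matrix_(i, j) (i == h j)%:R.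

Lemma mulmx_select k n (A : 'M[C]_(k, n)) h i j : (A *m select_mx h) i j = A i (h j).
Proof.
rewrite mxE (bigD1 (h j)) //= mxE eqxx mulr1 big1 ?addr0 // => l lj.
by rewrite mxE (negPf lj) mulr0.
Qed.

Lemma select_unitary n (h : 'I_n -> 'I_n) : injective h -> select_mx h \is unitarymx.
Proof.
move=> h_inj; apply/unitarymxP; apply: mulmx1C; apply/matrixP => i j.
by rewrite mulmx_select !mxE conjC_nat (inj_eq h_inj) eq_sym.
Qed.

Lemma oplus_veroneseE a b z i j :
  oplus (@veronese R a) (@veronese R b) z i j =
  if i == 0
  then (if (j < a.+1)%N then (Num.sqrt ('C(a, j)%:R : R))%:C * z ^+ j else 0)
  else (if (j < a.+1)%N then 0
        else (Num.sqrt ('C(b, j - a.+1)%:R : R))%:C * z ^+ (j - a.+1)).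
Proof.
rewrite /oplus; case: (@split_ordP 1 1 i) => k ->; case: (split_ordP j) => l ->;
  rewrite (ord1 k) -[_ == 0]val_eqE /= ?ltn_ord.
- by apply: etrans (block_mxEul _ _ _ _ _ _) _; rewrite mxE.
- by apply: etrans (block_mxEur _ _ _ _ _ _) _; rewrite mxE.
- by apply: etrans (block_mxEdl _ _ _ _ _ _) _; rewrite mxE.
- by rewrite addKn; apply: etrans (block_mxEdr _ _ _ _ _ _) _; rewrite mxE.
Qed.

(** Column [j] of the family comes from column [col3 j] of the direct sum when [T = 3], and from
    column [col2 j] when [T = 2]. *)
Let col3 (j : 'I_6) : 'I_6 := inord (nth 0%N [:: 2; 0; 5; 3; 1; 4]%N j).
Let col2 (j : 'I_6) : 'I_6 := inord (nth 0%N [:: 0; 3; 5; 1; 4; 2]%N j).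

Let col3E j : col3 j = nth 0%N [:: 2; 0; 5; 3; 1; 4]%N j :> nat.
Proof. by rewrite inordK //; case: j => [[|[|[|[|[|[|//]]]]]] ?]. Qed.
Let col2E j : col2 j = nth 0%N [:: 0; 3; 5; 1; 4; 2]%N j :> nat.
Proof. by rewrite inordK //; case: j => [[|[|[|[|[|[|//]]]]]] ?]. Qed.

Let col3_inj : injective col3.
Proof.
move=> i j /(congr1 val); rewrite /= !col3E.
by case: i => [[|[|[|[|[|[|//]]]]]] ?]; case: j => [[|[|[|[|[|[|//]]]]]] ?] //= _; apply/val_inj.
Qed.
Let col2_inj : injective col2.
Proof.
move=> i j /(congr1 val); rewrite /= !col2E.
by case: i => [[|[|[|[|[|[|//]]]]]] ?]; case: j => [[|[|[|[|[|[|//]]]]]] ?] //= _; apply/val_inj.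
Qed.

Lemma family3_veronese : exists2 U : 'M[C]_6, U \is unitarymx &
  forall z, rowspan (sphere_family 3 z) = rowspan (oplus (@veronese R 1) (@veronese R 3) z *m U).
Proof.
exists (select_mx col3); first exact: select_unitary.
(* The cubic curve is the first row of the family but the second of the direct sum: [P] exchanges
   the rows. *)
move=> z; pose P : 'M[C]_2 := select_mx (@rev_ord 2).
have Pu : P \in unitmx by apply: unitarymx_unit; apply/select_unitary/rev_ord_inj.
rewrite -[RHS](rowspan_mul _ Pu); congr rowspan; apply/matrixP => i j.
have e1 : 3 - 2 = 1 :> R by ring.
have e2 : 4 - 3 = 1 :> R by ring.
rewrite [RHS]mxE !big_ord_recl big_ord0 !mulmx_select !(@oplus_veroneseE 1 3) col3E !mxE.
rewrite subrr e1 e2 !divr1 sqrtr0 sqrtr1 normr1 mul0r.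
case: (ord2P i) => -> /=; case: j => [[|[|[|[|[|[|//]]]]]] ?] /=;
  rewrite -?[(2 - 2)%N]/0%N -?[(3 - 2)%N]/1%N -?[(4 - 2)%N]/2%N -?[(5 - 2)%N]/3%N;
  rewrite ?bin0 ?binn ?bin1 -?[binomial 3 2]/3%N ?sqrtr1 ?expr0 ?expr1;
  by rewrite ?rmorph1 ?rmorph0 ?(mul0r, mulr0, mul1r, mulr1, addr0, add0r).
Qed.

Lemma family2_veronese : exists2 U : 'M[C]_6, U \is unitarymx &
  forall z, rowspan (sphere_family 2 z) = rowspan (oplus (@veronese R 2) (@veronese R 2) z *m U).
Proof.
exists (select_mx col2); first exact: select_unitary.
move=> z; congr rowspan; apply/matrixP => i j.
have e1 : 3 - 2 = 1 :> R by ring.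
have e2 : 4 - 2 = 2 :> R by ring.
rewrite [RHS]mulmx_select (@oplus_veroneseE 2 2) col2E !mxE.
rewrite subrr e1 e2 normr0 mulr0 divff ?pnatr_eq0 // sqrtr1.
case: (ord2P i) => -> /=; case: j => [[|[|[|[|[|[|//]]]]]] ?] /=;
  rewrite -?[(3 - 3)%N]/0%N -?[(4 - 3)%N]/1%N -?[(5 - 3)%N]/2%N;
  rewrite ?bin0 ?binn ?bin1 ?sqrtr1 ?expr0 ?expr1;
  by rewrite ?rmorph1 ?rmorph0 ?(mul0r, mulr0, mul1r, mulr1, addr0, add0r).
Qed.

End VeroneseMembers.

Unset Implicit Arguments.

Theorem theorem1p1 (R : realType) :
  (forall (n : nat) (phi : sphere R -> gr R n.+2),
      (2 <= n)%N -> constantly_curved 4 phi -> linearly_full phi ->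
      irreducible phi -> (exists s, has_sff_sqnorm s phi) -> n = 4%N)
  /\ (forall phi : sphere R -> gr R 6,
      constantly_curved 4 phi -> linearly_full phi ->
      irreducible phi -> (exists s, has_sff_sqnorm s phi) ->
      exists t : R, 0 < t <= 3 /\
        (exists2 U : 'M[R[i]]_6, U \is unitarymx &
           given_by phi (fun z => sphere_family t z *m U))
        /\ has_sff_sqnorm (t ^+ 2 - 4 * t + 6) phi)
  /\ (forall t : R, 0 < t <= 3 ->
      exists phi : sphere R -> gr R 6,
        given_by phi (sphere_family t)
        /\ constantly_curved 4 phi /\ linearly_full phi /\ irreducible phi
        /\ has_sff_sqnorm (t ^+ 2 - 4 * t + 6) phi)
  /\ ((exists2 U : 'M[R[i]]_6, U \is unitarymx &
         forall z, rowspan (sphere_family 3 z)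
           = rowspan (oplus (@veronese R 1) (@veronese R 3) z *m U))
      /\ forall phi : sphere R -> gr R 6, given_by phi (sphere_family 3) ->
           has_sff_sqnorm 3 phi)
  /\ ((exists2 U : 'M[R[i]]_6, U \is unitarymx &
         forall z, rowspan (sphere_family 2 z)
           = rowspan (oplus (@veronese R 2) (@veronese R 2) z *m U))
      /\ forall phi : sphere R -> gr R 6, given_by phi (sphere_family 2) ->
           has_sff_sqnorm 2 phi).
Proof.
(* Holomorphy determines the sphere near infinity, so a description on [C] alone covers both
   charts. *)
have sphere_norm (m : nat) (X : 'M[R[i]]_(6, m)) (T : R) (phi : sphere R -> gr R m) :
    0 < T <= 3 -> X *m X^t* = 1%:M -> holomorphic phi ->
    (forall z, val (phi (chart0 z)) = rowspan (sphere_family T z *m X)) ->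
    forall w, val (phi (chartoo w)) = rowspan (sphere_family T w *m (swap_matrix T *m X)).
  by move=> T03 XU hol phi0; apply: family_infinity => //; have [] := hol 0.
have id_unitary : (1%:M : 'M[R[i]]_6) *m 1%:M^t* = 1%:M by rewrite trmx1 map_mx1 mulmx1.
have member_sff (T : R) (phi : sphere R -> gr R 6) : 0 < T <= 3 ->
    given_by phi (sphere_family T) -> has_sff_sqnorm (T ^+ 2 - 4 * T + 6) phi.
  move=> T03 [hol phi0].
  have phi1 z : val (phi (chart0 z)) = rowspan (sphere_family T z *m 1%:M) by rewrite mulmx1.
  exact: (family_sff T03 id_unitary phi1 (sphere_norm _ _ _ _ T03 id_unitary hol phi1)).
split; [|split; [|split; [|split]]].
- move=> n phi n2 cc full irr [s sff].
  have [T [F [T03 sE FU phi0]]] := sphere_classification cc irr sff.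
  have [hol _ _ _ _] := cc.
  have := family_full_size FU phi0 (sphere_norm _ _ _ _ T03 FU hol phi0) full.
  by case.
- move=> phi cc full irr [s sff].
  have [T [F [T03 sE FU phi0]]] := sphere_classification cc irr sff.
  have [hol _ _ _ _] := cc.
  exists T; split=> //; split; last by rewrite -sE.
  by exists F; [apply/unitarymxP | split].
- move=> T T03; have [phi [phi0 phioo]] := family_exists T03.
  have phi1 z : val (phi (chart0 z)) = rowspan (sphere_family T z) by rewrite phi0 mulmx1.
  have cc := family_constantly_curved T03 id_unitary phi0 phioo.
  exists phi; split; first by split=> //; have [] := cc.
  split=> //; split; first exact: (family_linearly_full T03 phi1).
  split; first exact: (family_irreducible T03 phi1).
  exact: (family_sff T03 id_unitary phi0 phioo).
- split=> [|phi gphi]; first exact: family3_veronese.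
  have /member_sff : 0 < (3 : R) <= 3 by rewrite ltr0n lexx.
  by move=> /(_ phi gphi); have -> : 3 ^+ 2 - 4 * 3 + 6 = 3 :> R by ring.
- split=> [|phi gphi]; first exact: family2_veronese.
  have /member_sff : 0 < (2 : R) <= 3 by rewrite ltr0n ler_nat.
  by move=> /(_ phi gphi); have -> : 2 ^+ 2 - 4 * 2 + 6 = 2 :> R by ring.
Qed.
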